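(* Work over $\overline{\mathbb{Q}}$, and for a finite group $\Gamma$ let $\mathcal{A}_4(\Gamma)\subset\mathcal{M}_4$ be the set of conjugacy classes of degree $4$ endomorphisms of $\mathbb{P}^1$ whose automorphism group contains a subgroup isomorphic to $\Gamma$. Then: (1) $\mathcal{A}_4(C_5)=\mathcal{A}_4(D_5)$ is the single conjugacy class given by $f(z)=\frac{1}{z^4}$. (2) $\mathcal{A}_4(C_4)$ is an irreducible curve in $\mathcal{M}_4$ given by the one-parameter family $f_k(z)=\frac{z^4+1}{kz^3}$ for $k\neq0$. (3) $\mathcal{A}_4(D_3)$ is an irreducible curve in $\mathcal{M}_4$ given by the family $f_k(z)=\frac{z^4+kz}{kz^3+1}$ for $k\neq\pm1$. (4) $\mathcal{A}_4(C_3)$ is an irreducible surface in $\mathcal{M}_4$ given by the family $f_{k_1,k_2}(z)=\frac{z^4+k_1z}{k_2z^3+1}$ for $k_1k_2\neq1$. (5) $\mathcal{A}_4(C_2)$ is given by the three-parameter family $f_{k_1,k_2,k_3}(z)=\frac{z^4+k_1z^2+1}{k_2z^3+k_3z}$ for $k_2^2+k_3^2\neq k_1k_2k_3$.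
   Context: $\mathcal{M}_4=\mathrm{Rat}_4/\mathrm{PGL}_2$ is the moduli space of degree $4$ endomorphisms of $\mathbb{P}^1$ up to conjugation $f^\alpha=\alpha^{-1}\circ f\circ\alpha$, and $[f]$ is the class of $f$. $\mathrm{Aut}(f)=\{\alpha\in\mathrm{PGL}_2(\overline{\mathbb{Q}}): f^\alpha=f\}$. $C_n$ is the cyclic group of order $n$ and $D_n$ the dihedral group of order $2n$. A locus is ''given by'' a family of maps if it equals the set of conjugacy classes of the maps in the family, the parameters ranging over all values in $\overline{\mathbb{Q}}$ subject to the stated conditions. *)

(* Defs.v *)
From HB Require Import structures.
(* mpoly comes first since it shadows names of ssrbool; its notations clash with
   those of topology. *)
From mathcomp Require Export -(notations) mpoly.
From mathcomp Require Export all_boot all_order all_algebra all_fingroup.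
From mathcomp Require Export all_solvable all_field.
From mathcomp Require Export all_classical topology.
From mathcomp Require Import ring.
From mathcomp Require Import generic_quotient.

Set Implicit Arguments.
Unset Strict Implicit.
Unset Printing Implicit Defensive.

Import Order.TTheory GRing.Theory Num.Theory.

Local Open Scope classical_set_scope.
Local Open Scope quotient_scope.
Local Open Scope ring_scope.

(* The ground field is algC, the algebraic closure of rat. P^1(algC) is
   algC + {infinity}, with None as the point at infinity. *)
Definition P1 : Type := option algC.

(* [u : v]; junk value None at u = v = 0 *)
Definition hpt (u v : algC) : P1 := if v == 0 then None else Some (u / v).

(* The map z |-> p(z) / q(z) of P^1; it is meaningful for p, q coprime. *)
Definition ratfun (p q : {poly algC}) (z : P1) : P1 :=
  match z with
  | Some z => hpt p.[z] q.[z]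
  | None => let d := (maxn (size p) (size q)).-1 in hpt p`_d q`_d
  end.

Definition lowest_terms (d : nat) (r : {poly algC} * {poly algC}) : bool :=
  coprimep r.1 r.2 && (maxn (size r.1) (size r.2) == d.+1).

(* Rat_d: the degree d endomorphisms of P^1. As algC is infinite, such a
   morphism is determined by its action on points. *)
Record Rat (d : nat) := MkRat {
  ratmap :> P1 -> P1;
  ratmapP : exists r, lowest_terms d r /\ ratmap = ratfun r.1 r.2 }.

HB.instance Definition _ d := gen_eqMixin (Rat d).
HB.instance Definition _ d := gen_choiceMixin (Rat d).

Lemma ratmap_inj d : injective (@ratmap d).
Proof.
move=> [f Hf] [g Hg] /= E; rewrite -E in Hg *.
by rewrite (Prop_irrelevance Hf Hg).
Qed.

(* Zariski topology on Rat_d, as a subspace of P^(2d+1): f = p / q has the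
   homogeneous coordinates [p_0 : .. : p_d : q_0 : .. : q_d]. They are unique up
   to a common nonzero factor, so that the vanishing at f of a homogeneous
   polynomial does not depend on the representative chosen here. *)
Definition coefs d (f : Rat d) (i : 'I_(d.+1 + d.+1)) : algC :=
  let r := projT1 (cid (ratmapP f)) in
  match fintype.split i with
  | inl j => r.1`_j
  | inr j => r.2`_j
  end.

Definition zariski_closed d (Z : set (Rat d)) : Prop :=
  exists I : set (mpoly.mpoly (d.+1 + d.+1) algC),
    (forall P, I P -> exists e, P \is mpoly.ishomog1 e (@mpoly.mdeg (d.+1 + d.+1))) /\
    Z = [set f | forall P, I P -> mpoly.meval (coefs f) P = 0].

Section ZariskiTopology.
Variable d : nat.

Definition zariski_open (U : set (Rat d)) : Prop := zariski_closed (~` U).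

Lemma zariski_openT : zariski_open setT.
Proof.
exists [set 1]; split.
  by move=> P ->; exists 0%N; apply: mpoly.dhomog1.
rewrite setCT; apply/seteqP; split => // f /(_ 1 erefl).
by rewrite mpoly.meval1 => /eqP; rewrite oner_eq0.
Qed.

Lemma zariski_openI : setI_closed zariski_open.
Proof.
move=> U V [I [hI EI]] [J [hJ EJ]].
exists [set P | exists A B, [/\ I A, J B & P = A * B]]; split.
  move=> _ [A [B [/hI [a ha] /hJ [b hb] ->]]].
  by exists (a + b)%N; apply: mpoly.dhomogM.
rewrite setCI EI EJ; apply/seteqP; split => f.
  move=> h _ /= [A [B [IA JB ->]]].
  rewrite mpoly.mevalM; case: h => [/(_ _ IA)|/(_ _ JB)] ->; first exact: mul0r.
  exact: mulr0.
move=> h; apply: contrapT => /not_orP [/existsNP [A]].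
move=> /not_implyP [IA nA] /existsNP [B /not_implyP [JB nB]].
have /eqP := h (A * B) (ex_intro _ A (ex_intro _ B (And3 IA JB erefl))).
by rewrite mpoly.mevalM mulf_eq0 => /orP [/eqP|/eqP].
Qed.

Lemma zariski_open_bigU (I : Type) (U : I -> set (Rat d)) :
  (forall i, zariski_open (U i)) -> zariski_open (\bigcup_i U i).
Proof.
move=> oU; exists [set P | (exists e, P \is mpoly.ishomog1 e (@mpoly.mdeg (d.+1 + d.+1))) /\
  exists i, forall f, (~` U i) f -> mpoly.meval (coefs f) P = 0].
split; first by move=> P [].
apply/seteqP; split => f.
  move=> nf P [_ [i hi]]; apply: hi => fi; apply: nf; by exists i.
move=> h [i _ fi]; have [J [hJ EJ]] := oU i.
suff: (~` U i) f by [].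
rewrite EJ => P JP; apply: h; split; first exact: hJ.
by exists i => g; rewrite EJ => /(_ P JP).
Qed.

HB.instance Definition _ := isOpenTopological.Build (Rat d)
  zariski_openT zariski_openI zariski_open_bigU.

End ZariskiTopology.

Definition GL2 := {A : 'M[algC]_2 | A \in unitmx}.
HB.instance Definition _ := Choice.on GL2.

Definition eq_scalar (A B : GL2) : bool :=
  `[< exists2 c : algC, c != 0 & val A = c *: val B >].

Lemma eq_scalar_refl : reflexive eq_scalar.
Proof. by move=> A; apply/asboolP; exists 1; rewrite ?oner_eq0 ?scale1r. Qed.

Lemma eq_scalar_sym : symmetric eq_scalar.
Proof.
suff h A B : eq_scalar A B -> eq_scalar B A.
  by move=> A B; apply/idP/idP; apply: h.
move=> /asboolP [c c0 E]; apply/asboolP; exists c^-1; rewrite ?invr_eq0 //.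
by rewrite E scalerA mulVf // scale1r.
Qed.

Lemma eq_scalar_trans : transitive eq_scalar.
Proof.
move=> B A C /asboolP [c c0 E] /asboolP [e e0 E']; apply/asboolP.
by exists (c * e); rewrite ?mulf_neq0 // E E' scalerA.
Qed.

Canonical eq_scalar_equiv :=
  EquivRel eq_scalar eq_scalar_refl eq_scalar_sym eq_scalar_trans.

Definition PGL2 := {eq_quot eq_scalar_equiv}.
HB.instance Definition _ := Choice.on PGL2.
HB.instance Definition _ := EqQuotient.on PGL2.

Definition GL2_one : GL2 := @exist _ (fun M => M \in unitmx) 1%:M (unitmx1 _ _).

Lemma GL2_mul_subproof (A B : GL2) : val A *m val B \in unitmx.
Proof. by rewrite unitmx_mul (valP A) (valP B). Qed.

Definition GL2_mul (A B : GL2) : GL2 := @exist _ (fun M => M \in unitmx) _ (GL2_mul_subproof A B).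

Lemma GL2_inv_subproof (A : GL2) : invmx (val A) \in unitmx.
Proof. by rewrite unitmx_inv (valP A). Qed.

Definition GL2_inv (A : GL2) : GL2 := @exist _ (fun M => M \in unitmx) _ (GL2_inv_subproof A).

Definition PGL2_one : PGL2 := \pi_PGL2 GL2_one.
Definition PGL2_mul (a b : PGL2) : PGL2 := \pi_PGL2 (GL2_mul (repr a) (repr b)).
Definition PGL2_inv (a : PGL2) : PGL2 := \pi_PGL2 (GL2_inv (repr a)).

Lemma eq_pgl (A B : GL2) :
  \pi_PGL2 A = \pi_PGL2 B <-> exists2 c : algC, c != 0 & val A = c *: val B.
Proof.
split=> [/eqP|h]; first by rewrite eqmodE => /asboolP.
by apply/eqP; rewrite eqmodE; apply/asboolP.
Qed.

Lemma repr_pgl (A : GL2) :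
  exists2 c : algC, c != 0 & val (repr (\pi_PGL2 A)) = c *: val A.
Proof. by apply/eq_pgl; rewrite reprK. Qed.

Lemma PGL2_mulE (A B : GL2) :
  PGL2_mul (\pi_PGL2 A) (\pi_PGL2 B) = \pi_PGL2 (GL2_mul A B).
Proof.
have [a a0 EA] := repr_pgl A; have [b b0 EB] := repr_pgl B.
apply/eq_pgl; exists (a * b); rewrite ?mulf_neq0 //=.
by rewrite EA EB -scalemxAl -scalemxAr scalerA.
Qed.

Lemma PGL2_invE (A : GL2) : PGL2_inv (\pi_PGL2 A) = \pi_PGL2 (GL2_inv A).
Proof.
have [a a0 EA] := repr_pgl A.
apply/eq_pgl; exists a^-1; rewrite ?invr_eq0 //= EA.
by rewrite invmxZ // unitmxZ ?unitfE // (valP A).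
Qed.

Lemma PGL2_mulA : associative PGL2_mul.
Proof.
elim/quotW=> A; elim/quotW=> B; elim/quotW=> C.
rewrite (PGL2_mulE B C) (PGL2_mulE A B) (PGL2_mulE A (GL2_mul B C)).
rewrite (PGL2_mulE (GL2_mul A B) C); apply: (congr1 \pi_PGL2).
by apply: val_inj; rewrite /= mulmxA.
Qed.

Lemma PGL2_mul1 : left_id PGL2_one PGL2_mul.
Proof.
elim/quotW=> A; rewrite (PGL2_mulE GL2_one A); apply: (congr1 \pi_PGL2).
by apply: val_inj; rewrite /= mul1mx.
Qed.

Lemma PGL2_mulr1 : right_id PGL2_one PGL2_mul.
Proof.
elim/quotW=> A; rewrite (PGL2_mulE A GL2_one); apply: (congr1 \pi_PGL2).
by apply: val_inj; rewrite /= mulmx1.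
Qed.

Lemma PGL2_mulV : left_inverse PGL2_one PGL2_inv PGL2_mul.
Proof.
elim/quotW=> A; rewrite (PGL2_invE A) (PGL2_mulE (GL2_inv A) A).
by apply: (congr1 \pi_PGL2); apply: val_inj; rewrite /= mulVmx // (valP A).
Qed.

Lemma PGL2_mulrV : right_inverse PGL2_one PGL2_inv PGL2_mul.
Proof.
elim/quotW=> A; rewrite (PGL2_invE A) (PGL2_mulE A (GL2_inv A)).
by apply: (congr1 \pi_PGL2); apply: val_inj; rewrite /= mulmxV // (valP A).
Qed.

HB.instance Definition _ := isGroup.Build PGL2
  PGL2_mulA PGL2_mul1 PGL2_mulr1 PGL2_mulV PGL2_mulrV.

(* z |-> (a z + b) / (c z + d) *)
Definition moebius (A : 'M[algC]_2) : P1 -> P1 :=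
  ratfun (A 0 0 *: 'X + (A 0 1)%:P) (A 1 0 *: 'X + (A 1 1)%:P).

(* the action of PGL_2 on P^1; see pglactE for the independence of the
   representative *)
Definition pglact (a : PGL2) : P1 -> P1 := moebius (val (repr a)).

Definition conjmap (f : P1 -> P1) (a : PGL2) : P1 -> P1 :=
  pglact a^-1%g \o f \o pglact a.

Definition AutP1 (f : P1 -> P1) : set PGL2 := [set a | conjmap f a = f].

Lemma hptZ (c u v : algC) : c != 0 -> hpt (c * u) (c * v) = hpt u v.
Proof.
move=> c0; rewrite /hpt mulf_eq0 (negbTE c0) /=; case: ifP => // _.
by rewrite -mulf_div divff // mul1r.
Qed.

Lemma hpt_surj (z : P1) : exists x y, (x != 0) || (y != 0) /\ z = hpt x y.
Proof.
case: z => [x|].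
  by exists x, 1; rewrite oner_eq0 orbT /hpt oner_eq0 divr1.
by exists 1, 0; rewrite oner_eq0 /hpt eqxx.
Qed.

Lemma unitmx22 (A : 'M[algC]_2) :
  (A \in unitmx) = (A 0 0 * A 1 1 - A 0 1 * A 1 0 != 0).
Proof.
rewrite unitmxE unitfE (expand_det_row _ 0) big_ord_recl big_ord1 /cofactor.
rewrite !det_mx11 !mxE /= expr0 expr1 mul1r mulN1r mulrN.
by congr (~~ (_ * _ - _ * _ == 0)); congr (A _ _); apply: val_inj.
Qed.

Lemma mul22E (A B : 'M[algC]_2) i j :
  (A *m B) i j = A i 0 * B 0 j + A i 1 * B 1 j.
Proof. by rewrite mxE big_ord_recl big_ord1; congr (_ + _ * _); congr (_ _ _);
  apply: val_inj. Qed.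

Lemma moebius_hpt (A : 'M[algC]_2) (x y : algC) :
  A \in unitmx -> (x != 0) || (y != 0) ->
  moebius A (hpt x y) = hpt (A 0 0 * x + A 0 1 * y) (A 1 0 * x + A 1 1 * y).
Proof.
rewrite unitmx22 => uA; have [-> /=|y0 _] := eqVneq y 0.
  rewrite orbF => x0; rewrite {1}/hpt eqxx !mulr0 !addr0 /moebius /ratfun.
  have sz (a b : algC) : (size (a *: 'X + b%:P)%R <= 2)%N.
    rewrite (leq_trans (size_polyD _ _)) // geq_max size_polyC.
    by rewrite (leq_trans (size_scale_leq _ _)) ?size_polyX //; case: eqP.
  have cf (a b : algC) : (a *: 'X + b%:P)`_1 = a.
    by rewrite coefD coefZ coefX coefC /= mulr1 addr0.
  have lb (a b : algC) : a != 0 -> (1 < size (a *: 'X + b%:P)%R)%N.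
    by apply: contraNT; rewrite -leqNgt => /leq_sizeP /(_ 1%N (leqnn _));
      rewrite cf => ->.
  set m := maxn _ _; have -> : m = 2%N.
    apply/eqP; rewrite eqn_leq geq_max !sz /= leq_max.
    have [a0|a0] := eqVneq (A 0 0) 0; last by rewrite lb.
    rewrite (lb (A 1 0)) ?orbT //; apply: contraNneq uA => c0.
    by rewrite a0 c0 mul0r mulr0 subr0.
  by rewrite /= !cf ![_ * x]mulrC hptZ.
rewrite {1}/hpt (negbTE y0) /moebius /ratfun.
rewrite !hornerD !hornerZ !hornerX !hornerC.
have h a b : y^-1 * (a * x + b * y) = a * (x / y) + b by field.
rewrite -[RHS](@hptZ y^-1) ?invr_eq0 //; by rewrite !h.
Qed.

Lemma moebiusZ (c : algC) (A : 'M[algC]_2) :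
  c != 0 -> A \in unitmx -> moebius (c *: A) = moebius A.
Proof.
move=> c0 uA; apply: funext => z; have [x [y [h ->]]] := hpt_surj z.
rewrite !moebius_hpt //; last by rewrite unitmxZ // unitfE.
by rewrite !mxE -!mulrA -!mulrDr hptZ.
Qed.

Lemma moebiusM (A B : 'M[algC]_2) : A \in unitmx -> B \in unitmx ->
  moebius (A *m B) = moebius A \o moebius B.
Proof.
move=> uA uB; apply: funext => z; have [x [y [h ->]]] := hpt_surj z.
rewrite /= !moebius_hpt //; last by rewrite unitmx_mul uA.
  rewrite !mul22E; congr hpt; rewrite !mulrDl !mulrDr !mulrA -!addrA;
  by congr (_ + _); rewrite addrCA.
move: uB; rewrite unitmx22; apply: contraNT.
rewrite negb_or !negbK => /andP [/eqP e1 /eqP e2].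
set D := _ - _; have Dx : D * x = 0.
  rewrite [LHS](_ : _ = B 1 1 * (B 0 0 * x + B 0 1 * y)
    - B 0 1 * (B 1 0 * x + B 1 1 * y)); last by rewrite /D; ring.
  by rewrite e1 e2 !mulr0 subr0.
have Dy : D * y = 0.
  rewrite [LHS](_ : _ = B 0 0 * (B 1 0 * x + B 1 1 * y)
    - B 1 0 * (B 0 0 * x + B 0 1 * y)); last by rewrite /D; ring.
  by rewrite e1 e2 !mulr0 subr0.
by case/orP: h => h0; [move/eqP: Dx | move/eqP: Dy];
  rewrite mulf_eq0 (negbTE h0) orbF.
Qed.

Lemma moebius1 : moebius 1%:M = id.
Proof.
apply: funext => z; have [x [y [h ->]]] := hpt_surj z.
by rewrite moebius_hpt ?unitmx1 // !mxE /= !mul1r !mul0r addr0 add0r.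
Qed.

Lemma pglactE (A : GL2) : pglact (\pi_PGL2 A) = moebius (val A).
Proof.
by rewrite /pglact; have [c c0 ->] := repr_pgl A; rewrite moebiusZ ?(valP A).
Qed.

Lemma pglact1 : pglact 1%g = id.
Proof. by rewrite pglactE moebius1. Qed.

Lemma pglactM (a b : PGL2) : pglact (a * b)%g = pglact a \o pglact b.
Proof. by rewrite pglactE moebiusM //; apply: valP. Qed.

Lemma conjmap1 (f : P1 -> P1) : conjmap f 1%g = f.
Proof. by rewrite /conjmap invg1 pglact1. Qed.

Lemma conjmapM (f : P1 -> P1) (a b : PGL2) :
  conjmap f (a * b)%g = conjmap (conjmap f a) b.
Proof. by rewrite /conjmap invgM !pglactM. Qed.

(* M_d = Rat_d / PGL_2. It is a geometric quotient, so that its Zariski topology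
   is the quotient topology. *)
Definition conjugate_maps d (f g : Rat d) : bool :=
  `[< exists a : PGL2, conjmap f a = g >].

Lemma conjugate_refl d : reflexive (@conjugate_maps d).
Proof. by move=> f; apply/asboolP; exists 1%g; rewrite conjmap1. Qed.

Lemma conjugate_sym d : symmetric (@conjugate_maps d).
Proof.
suff h f g : @conjugate_maps d f g -> conjugate_maps g f.
  by move=> f g; apply/idP/idP; apply: h.
move=> /asboolP [a E]; apply/asboolP; exists a^-1%g.
by rewrite -E -conjmapM mulgV conjmap1.
Qed.

Lemma conjugate_trans d : transitive (@conjugate_maps d).
Proof.
move=> g f h /asboolP [a E] /asboolP [b E']; apply/asboolP.
by exists (a * b)%g; rewrite conjmapM E E'.
Qed.

Canonical conjugate_equiv d := EquivRel (@conjugate_maps d)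
  (@conjugate_refl d) (@conjugate_sym d) (@conjugate_trans d).

Definition moduli (d : nat) : topologicalType :=
  quotient_topology {eq_quot (conjugate_equiv d)}.

Definition mclass d (f : Rat d) : moduli d :=
  \pi_{eq_quot (conjugate_equiv d)} f.

(* S, a subgroup of gT, contains a subgroup isomorphic to Gam: the image of an
   injective homomorphism *)
Definition contains_copy (gT : groupType) (S : set gT) (Gam : finGroupType) :=
  exists rho : Gam -> gT,
    [/\ {morph rho : x y / (x * y)%g}, injective rho & range rho `<=` S].

(* As finGroupTypes, C_n is 'Z_n under addition, and D_n is 'D_(2n), MathComp's
   index being the order of the group. *)
Definition aut_locus (d : nat) (Gam : finGroupType) : set (moduli d) :=
  [set mclass f | f in [set f : Rat d | contains_copy (AutP1 f) Gam]].
Arguments aut_locus : clear implicits.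

(* The first conjunct says that all the maps of the family have degree d. *)
Definition given_by d (L : set (moduli d)) (family : set (P1 -> P1)) : Prop :=
  (forall F, family F -> exists f : Rat d, f = F :> (P1 -> P1)) /\
  L = [set mclass f | f in [set f : Rat d | family f]].

Section Dimension.
Variable X : topologicalType.
Implicit Types A Z : set X.

Definition irreducible A : Prop :=
  A !=set0 /\
  forall B C, closed B -> closed C -> A `<=` B `|` C -> A `<=` B \/ A `<=` C.

Definition irreducible_chain A (n : nat) : Prop :=
  exists Z : nat -> set X,
    (forall i, (i <= n)%N ->
      irreducible (Z i) /\ exists2 C, closed C & Z i = A `&` C) /\
    (forall i, (i < n)%N -> Z i `<` Z i.+1).

(* Krull dimension for the subspace topology *)
Definition has_dim A (d : nat) : Prop :=
  forall n, irreducible_chain A n <-> (n <= d)%N.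

(* As usual, a subvariety is closed. *)
Definition irreducible_subvariety (d : nat) A : Prop :=
  [/\ closed A, irreducible A & has_dim A d].

Definition irreducible_curve := irreducible_subvariety 1.
Definition irreducible_surface := irreducible_subvariety 2.

End Dimension.

(* Main.v *)
Require Import Defs.
From mathcomp Require Import ring generic_quotient.

(** An automorphism of order n of f is conjugate to z |-> zeta z for a primitive
    n-th root of unity zeta. If f = p / q in lowest terms commutes with the latter,
    then p(zeta X) = c zeta p and q(zeta X) = c q for some c; as p and q do not both
    vanish at 0, nor both at infinity, few monomials are left, and rescaling z yields
    the families of the theorem (after z |-> 1 / z if necessary). An additional
    involution inverting the symmetry of order 3 has the form z |-> e / z, and forces
    k1 = k2.

    For closedness, write [a, b] for the determinant, F for the lift of f to k^2, and
    let A v = zeta [v, b] a + [a, v] b. If [a, b] != 0, then f commutes with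
    z |-> zeta z in the basis (a, b), with a given multiplier, if and only if
    F (A v) = omega [a, b]^3 A (F v) for all v. These equations are homogeneous in f, a
    and b, and have no solution with proportional a and b: otherwise [a, b] = 0 and A
    is a nonzero nilpotent map onto the line of a, so that F a = 0. Hence the locus is
    the projection to Rat_4 of a closed subset of Rat_4 x P^1 x P^1, which is closed by
    elimination theory. The parameters k, k1, k2 are quotients of multihomogeneous
    functions of (f, a, b), so that the images in M_4 of points and of curves
    h(k1, k2) = 0 are closed as well.

    In a chain Z0 < Z1 < Z2 < Z3 of irreducible closed subsets of the surface, Z2 is
    contained in the image of a curve h = 0. For minimal h, an equation of Z1 which is
    not a multiple of h has finitely many common zeros with h. So Z1 is finite, hence
    a point, which is a contradiction. *)

Set Implicit Arguments.
Unset Strict Implicit.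
Unset Printing Implicit Defensive.

Import Order.TTheory GRing.Theory Num.Theory.

Local Open Scope classical_set_scope.
Local Open Scope quotient_scope.
Local Open Scope ring_scope.

(** * Maps of degree 4 as pairs of binary quartic forms *)

(** A closed set of classes in the quotient topology is a closed, conjugation-invariant set of maps.
    The obstacle is that PGL_2 is not complete: the conjugates of the members of a family might
    degenerate along with the conjugating maps. A symmetry with given multiplier is determined by
    its two fixed points, which range over the complete variety P^1 x P^1; once the diagonal is
    excluded by the equations themselves, no limit can escape.

    The parametrizations are not injective (z |-> 1 / z exchanges k1 and k2), and their fibres are
    never studied. Dimensions are bounded above by counting parameters, which only requires the
    images of single parameters to be closed; they are bounded below by explicit chains, whose
    strictness comes from a few pairs of maps shown not to be conjugate. *)

Lemma poly_fun_eq0 (p : {poly algC}) : (forall x, p.[x] = 0) -> p = 0.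
Proof.
move=> h; apply: (@roots_geq_poly_eq0 _ p [seq i%:R | i <- iota 0 (size p)]).
- by apply/allP => x _; apply/eqP/h.
- by rewrite map_inj_uniq ?iota_uniq // => i j /eqP; rewrite eqr_nat => /eqP.
- by rewrite size_map size_iota.
Qed.

Lemma poly_fun_inj (p q : {poly algC}) : (forall x, p.[x] = q.[x]) -> p = q.
Proof.
move=> h; apply/eqP; rewrite -subr_eq0; apply/eqP/poly_fun_eq0 => x.
by rewrite hornerD hornerN h subrr.
Qed.

(* the binary quartic form y^4 p(x / y) *)
Definition form4 (p : {poly algC}) (x y : algC) : algC :=
  p`_0 * y ^+ 4 + p`_1 * x * y ^+ 3 + p`_2 * x ^+ 2 * y ^+ 2 +
  p`_3 * x ^+ 3 * y + p`_4 * x ^+ 4.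

Definition nonzero2 (x y : algC) := (x != 0) || (y != 0).

Lemma nonzero2_neq (x y : algC) : nonzero2 x y -> ~ (x = 0 /\ y = 0).
Proof. by move=> h [x0 y0]; move: h; rewrite /nonzero2 x0 y0 eqxx. Qed.

Lemma nonzero2P (x y : algC) : reflect (~ (x = 0 /\ y = 0)) (nonzero2 x y).
Proof.
apply: (iffP idP); first exact: nonzero2_neq.
move=> h; rewrite /nonzero2 -negb_and; apply/negP => /andP [/eqP ? /eqP ?].
exact: h.
Qed.

Lemma horner5 (p : {poly algC}) x : (size p <= 5)%N ->
  p.[x] = p`_0 + p`_1 * x + p`_2 * x ^+ 2 + p`_3 * x ^+ 3 + p`_4 * x ^+ 4.
Proof.
move=> sp; rewrite (horner_coef_wide x sp) !big_ord_recr big_ord0 /=.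
by rewrite add0r expr0 mulr1 expr1.
Qed.

Lemma form4_horner (p : {poly algC}) x y : (size p <= 5)%N -> y != 0 ->
  form4 p x y = y ^+ 4 * p.[x / y].
Proof. by move=> sp y0; rewrite horner5 // /form4; field. Qed.

Lemma form4_1 (p : {poly algC}) x : (size p <= 5)%N -> form4 p x 1 = p.[x].
Proof.
by move=> sp; rewrite form4_horner ?oner_eq0 // expr1n mul1r divr1.
Qed.

Lemma form4_0 (p : {poly algC}) x : form4 p x 0 = p`_4 * x ^+ 4.
Proof. by rewrite /form4; ring. Qed.

Lemma form4Z (p : {poly algC}) c x y :
  form4 p (c * x) (c * y) = c ^+ 4 * form4 p x y.
Proof. by rewrite /form4; ring. Qed.

Lemma form4_inj (p q : {poly algC}) : (size p <= 5)%N -> (size q <= 5)%N ->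
  (forall x y, form4 p x y = form4 q x y) -> p = q.
Proof.
by move=> sp sq h; apply: poly_fun_inj => x; rewrite -!form4_1.
Qed.

Lemma coef_ge5 (p : {poly algC}) : (size p <= 5)%N -> p`_4 = 0 -> (size p <= 4)%N.
Proof.
move=> sp p4; apply/leq_sizeP => j; rewrite leq_eqVlt => /orP [/eqP <- //|].
by move/leq_sizeP: sp; apply.
Qed.

(** Over an algebraically closed field, coprimality excludes a common zero with y != 0, and the
    exact degree excludes one at y = 0. It is in this form that degree 4 is checked for each
    family. *)
Lemma lowest_terms4P (p q : {poly algC}) :
  reflect [/\ (size p <= 5)%N, (size q <= 5)%N &
    forall x y, nonzero2 x y -> nonzero2 (form4 p x y) (form4 q x y)]
  (lowest_terms 4 (p, q)).
Proof.
rewrite /lowest_terms /=; apply: (iffP andP) => [[cpq /eqP m5]|[sp sq h]].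
  have sp : (size p <= 5)%N by rewrite -m5 leq_maxl.
  have sq : (size q <= 5)%N by rewrite -m5 leq_maxr.
  split=> // x y; have [-> |y0 _] := eqVneq y 0.
    rewrite /nonzero2 eqxx orbF => x0; rewrite !form4_0.
    rewrite !(mulIr_eq0 _ (mulIf (expf_neq0 4 x0))).
    apply/nonzero2P => -[p4 q4].
    by have := coef_ge5 sp p4; have := coef_ge5 sq q4; move: m5;
      case: (leqP (size p) (size q)) => ? -> // /ltnW.
  rewrite /nonzero2 !form4_horner // !(mulrI_eq0 _ (mulfI (expf_neq0 4 y0))).
  have [/eqP r|//] := eqVneq (p.[x / y]) 0.
  by move/Pdiv.ClosedField.coprimepP: cpq => /(_ _ r).
split.
  apply/Pdiv.ClosedField.coprimepP => x /eqP r.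
  have := h x 1; rewrite /nonzero2 oner_eq0 orbT => /(_ isT).
  by rewrite !form4_1 // r eqxx.
have := h 1 0; rewrite /nonzero2 oner_eq0 => /(_ isT).
rewrite !form4_0 !expr1n !mulr1 => nz.
rewrite eqn_leq geq_max sp sq /= leq_max.
have gt (r : {poly algC}) : r`_4 != 0 -> (4 < size r)%N.
  by apply: contraNT; rewrite -leqNgt => /leq_sizeP ->.
by case/orP: nz => /gt ->; rewrite ?orbT.
Qed.

Lemma ratfun_hpt (p q : {poly algC}) x y : lowest_terms 4 (p, q) ->
  nonzero2 x y -> ratfun p q (hpt x y) = hpt (form4 p x y) (form4 q x y).
Proof.
move=> lt; have /andP [_ /eqP /= m5] := lt; case/lowest_terms4P: lt => sp sq _.
rewrite /nonzero2 {1}/hpt; have [-> |y0 _] := eqVneq y 0.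
  rewrite orbF => x0 /=; rewrite m5 /= !form4_0 ![_ * x ^+ 4]mulrC hptZ //.
  by rewrite expf_neq0.
by rewrite /= !form4_horner // hptZ // expf_neq0.
Qed.

Lemma hpt_eqP (x y x' y' : algC) : nonzero2 x y -> nonzero2 x' y' ->
  hpt x y = hpt x' y' <-> x * y' = x' * y.
Proof.
rewrite /nonzero2 /hpt; have [-> |y0] := eqVneq y 0.
  rewrite orbF => x0; have [-> _|y'0 _] := eqVneq y' 0; first by rewrite !mulr0.
  split=> // /eqP; rewrite mulr0 mulf_eq0 (negbTE x0) (negbTE y'0) //.
move=> _; have [-> |y'0 _] := eqVneq y' 0.
  rewrite orbF => x0; split=> // /eqP; rewrite mulr0 eq_sym mulf_eq0.
  by rewrite (negbTE x0) (negbTE y0).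
split=> [[] /eqP|e]; first by rewrite eqr_div // => /eqP.
by congr Some; apply/eqP; rewrite eqr_div // e.
Qed.

Lemma proportional2 (x y x' y' : algC) : nonzero2 x y -> nonzero2 x' y' ->
  x * y' = x' * y -> exists2 c, c != 0 & x = c * x' /\ y = c * y'.
Proof.
move=> nz nz' e; have [x'0|x'0] := eqVneq x' 0.
  have y'0 : y' != 0 by move: nz'; rewrite /nonzero2 x'0 eqxx.
  have x0 : x = 0.
    by move/eqP: e; rewrite x'0 mul0r mulf_eq0 (negbTE y'0) orbF => /eqP.
  have y0 : y != 0 by move: nz; rewrite /nonzero2 x0 eqxx.
  exists (y / y'); first by rewrite mulf_neq0 ?invr_eq0.
  by rewrite x'0 x0 mulr0 divfK.
have x0 : x != 0.
  apply/eqP => x0; move/eqP: e; rewrite x0 mul0r eq_sym mulf_eq0 (negbTE x'0) /=.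
  by move=> /eqP y0; move: nz; rewrite /nonzero2 x0 y0 eqxx.
exists (x / x'); first by rewrite mulf_neq0 ?invr_eq0.
split; first by rewrite divfK.
by rewrite mulrAC e; field.
Qed.

Lemma form4D (p q : {poly algC}) x y : form4 (p + q) x y = form4 p x y + form4 q x y.
Proof. by rewrite /form4 !coefD; ring. Qed.

Lemma form4Zp (p : {poly algC}) c x y : form4 (c *: p) x y = c * form4 p x y.
Proof. by rewrite /form4 !coefZ; ring. Qed.

Lemma lowest_terms_neq0 (p q : {poly algC}) : lowest_terms 4 (p, q) ->
  p != 0 /\ q != 0.
Proof.
move=> /andP [/= c m]; split; apply/eqP => e; move: c m; rewrite e.
  by rewrite coprime0p -size_poly_eq1 size_poly0 max0n => /eqP ->.
by rewrite coprimep0 -size_poly_eq1 size_poly0 maxn0 => /eqP ->.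
Qed.

Lemma lowest_terms_uniq (p q p' q' : {poly algC}) :
  lowest_terms 4 (p, q) -> lowest_terms 4 (p', q') ->
  (forall x y, form4 p x y * form4 q' x y = form4 p' x y * form4 q x y) ->
  exists2 c, c != 0 & p = c *: p' /\ q = c *: q'.
Proof.
move=> lt lt' h.
have [p0 q0] := lowest_terms_neq0 lt; have [p'0 q'0] := lowest_terms_neq0 lt'.
have /andP [/= co _] := lt; have /andP [/= co' _] := lt'.
case/lowest_terms4P: lt => sp sq _; case/lowest_terms4P: lt' => sp' sq' _.
have e : p * q' = p' * q.
  by apply: poly_fun_inj => x; rewrite !hornerM -!form4_1.
have : p %= p'.
  rewrite /eqp; apply/andP; split.
    by rewrite -(Gauss_dvdpl _ co) -e dvdp_mulr.
  by rewrite -(Gauss_dvdpl _ co') e dvdp_mulr.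
case/eqpP => -[c1 c2] /= /andP [c10 c20] E.
have Ep : p = (c2 / c1) *: p'.
  by rewrite mulrC -scalerA -E scalerA mulVf // scale1r.
exists (c2 / c1); first by rewrite mulf_neq0 ?invr_eq0.
split=> //; apply: (mulfI p'0); rewrite -e {1}Ep.
by rewrite -scalerAl -scalerAr.
Qed.

Lemma lowest_terms_inv4 : lowest_terms 4 (1, 'X^4).
Proof.
apply/lowest_terms4P; rewrite size_poly1 size_polyXn; split=> // x y /nonzero2P n.
apply/nonzero2P => -[] /eqP; rewrite /form4 !coefXn !coef1 /=.
rewrite !mul0r !addr0 mul1r expf_eq0 /= => /eqP y0 /eqP.
by rewrite !add0r mul1r expf_eq0 /= => /eqP x0; apply: n.
Qed.

(* junk value z |-> 1 / z^4 outside of degree 4 *)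
Definition mkRat (p q : {poly algC}) : Rat 4 :=
  match pselect (lowest_terms 4 (p, q)) with
  | left h => @MkRat 4 (ratfun p q)
      (ex_intro _ (p, q) (conj (h : lowest_terms 4 (p, q)) (erefl : ratfun p q = _)))
  | right _ => @MkRat 4 (ratfun 1 'X^4)
      (ex_intro _ (1, 'X^4) (conj lowest_terms_inv4 (erefl : ratfun 1 'X^4 = _)))
  end.

Lemma mkRatE (p q : {poly algC}) : lowest_terms 4 (p, q) ->
  mkRat p q = ratfun p q :> (P1 -> P1).
Proof. by rewrite /mkRat; case: pselect. Qed.

Lemma mclass_eqP (f g : Rat 4) :
  mclass f = mclass g <-> exists a : PGL2, conjmap f a = g.
Proof.
have E : reflect (mclass f = mclass g) (conjugate_maps f g).
  exact: (@eqmodP (Rat 4) (conjugate_equiv 4) f g).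
by split=> [/E/asboolP|h] //; apply/E/asboolP.
Qed.

Lemma pglactP (a : PGL2) :
  exists2 A : 'M[algC]_2, A \in unitmx & pglact a = moebius A.
Proof. by exists (val (repr a)); first exact: (valP (repr a)). Qed.

Lemma pglactKV (a : PGL2) z : pglact a (pglact a^-1%g z) = z.
Proof. by have := congr1 (@^~ z) (pglactM a a^-1%g); rewrite mulgV pglact1. Qed.

Lemma pglactVK (a : PGL2) z : pglact a^-1%g (pglact a z) = z.
Proof. by have := pglactKV a^-1%g z; rewrite invgK. Qed.

Lemma conjmapP (f g : P1 -> P1) (a : PGL2) :
  conjmap f a = g <-> f \o pglact a = pglact a \o g.
Proof.
split=> [<-|e]; apply: funext => z; rewrite /conjmap /= ?pglactKV //.
by have /= -> := congr1 (@^~ z) e; rewrite pglactVK.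
Qed.

Lemma AutP1P (f : P1 -> P1) (a : PGL2) :
  AutP1 f a <-> f \o pglact a = pglact a \o f.
Proof. exact: conjmapP. Qed.

(* f o M = M o g for the lifts of f = p / q and g = p' / q' to k^2 *)
Definition conj4 (M : 'M[algC]_2) (p q p' q' : {poly algC}) := forall s t,
  [/\ form4 p (M 0 0 * s + M 0 1 * t) (M 1 0 * s + M 1 1 * t) =
        M 0 0 * form4 p' s t + M 0 1 * form4 q' s t &
      form4 q (M 0 0 * s + M 0 1 * t) (M 1 0 * s + M 1 1 * t) =
        M 1 0 * form4 p' s t + M 1 1 * form4 q' s t].

Lemma moebius_nonzero (M : 'M[algC]_2) s t : M \in unitmx -> nonzero2 s t ->
  nonzero2 (M 0 0 * s + M 0 1 * t) (M 1 0 * s + M 1 1 * t).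
Proof.
rewrite unitmx22 => u /nonzero2P n; apply/nonzero2P => -[e1 e2]; apply: n.
set D := _ - _ in u; split; apply: (mulfI u); rewrite mulr0 /D.
  transitivity (M 1 1 * (M 0 0 * s + M 0 1 * t) - M 0 1 * (M 1 0 * s + M 1 1 * t)).
    by ring.
  by rewrite e1 e2 !mulr0 subr0.
transitivity (M 0 0 * (M 1 0 * s + M 1 1 * t) - M 1 0 * (M 0 0 * s + M 0 1 * t)).
  by ring.
by rewrite e1 e2 !mulr0 subr0.
Qed.

Lemma conj4_ratfun (M : 'M[algC]_2) p q p' q' :
  M \in unitmx -> lowest_terms 4 (p, q) -> lowest_terms 4 (p', q') ->
  conj4 M p q p' q' ->
  ratfun p q \o moebius M = moebius M \o ratfun p' q'.
Proof.
move=> uM lt lt' h; apply: funext => z; have [s [t [n ->]]] := hpt_surj z.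
rewrite /= moebius_hpt // !ratfun_hpt ?moebius_nonzero //.
have [-> ->] := h s t; rewrite moebius_hpt //.
by case/lowest_terms4P: lt' => _ _; apply.
Qed.

(* the coefficient of s^i t^(4-i) in p(s (a, b) + t (c, d)) *)
Definition sub4 (p : {poly algC}) (a b c d : algC) (i : nat) : algC :=
  match i with
  | 0 => form4 p c d
  | 1 => p`_0 * (b * d ^+ 3 *+ 4) + p`_1 * (a * d ^+ 3 + c * b * d ^+ 2 *+ 3)
       + p`_2 * (a * c * d ^+ 2 *+ 2 + c ^+ 2 * b * d *+ 2)
       + p`_3 * (a * c ^+ 2 * d *+ 3 + c ^+ 3 * b) + p`_4 * (a * c ^+ 3 *+ 4)
  | 2 => p`_0 * (b ^+ 2 * d ^+ 2 *+ 6) + p`_1 * (a * b * d ^+ 2 *+ 3 + c * b ^+ 2 * d *+ 3)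
       + p`_2 * (a ^+ 2 * d ^+ 2 + a * c * b * d *+ 4 + c ^+ 2 * b ^+ 2)
       + p`_3 * (a ^+ 2 * c * d *+ 3 + a * c ^+ 2 * b *+ 3) + p`_4 * (a ^+ 2 * c ^+ 2 *+ 6)
  | 3 => p`_0 * (d * b ^+ 3 *+ 4) + p`_1 * (c * b ^+ 3 + a * d * b ^+ 2 *+ 3)
       + p`_2 * (c * a * b ^+ 2 *+ 2 + a ^+ 2 * d * b *+ 2)
       + p`_3 * (c * a ^+ 2 * b *+ 3 + a ^+ 3 * d) + p`_4 * (c * a ^+ 3 *+ 4)
  | _ => form4 p a b
  end.

Lemma sub4E (p : {poly algC}) a b c d s t :
  form4 p (a * s + c * t) (b * s + d * t) =
  sub4 p a b c d 0 * t ^+ 4 + sub4 p a b c d 1 * s * t ^+ 3 +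
  sub4 p a b c d 2 * s ^+ 2 * t ^+ 2 +
  sub4 p a b c d 3 * s ^+ 3 * t + sub4 p a b c d 4 * s ^+ 4.
Proof. by rewrite /= /form4; ring. Qed.

Lemma form4_poly (c : nat -> algC) s t :
  form4 (\poly_(i < 5) c i) s t = c 0%N * t ^+ 4 + c 1%N * s * t ^+ 3 +
    c 2%N * s ^+ 2 * t ^+ 2 + c 3%N * s ^+ 3 * t + c 4%N * s ^+ 4.
Proof. by rewrite /form4 !coef_poly. Qed.

Lemma conj4_exists (M : 'M[algC]_2) p q : M \in unitmx -> lowest_terms 4 (p, q) ->
  exists p' q', lowest_terms 4 (p', q') /\ conj4 M p q p' q'.
Proof.
move=> uM lt; have u := uM; rewrite unitmx22 in u; set D := _ - _ in u.
pose cp := sub4 p (M 0 0) (M 1 0) (M 0 1) (M 1 1).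
pose cq := sub4 q (M 0 0) (M 1 0) (M 0 1) (M 1 1).
(* The lift of M^-1 o f o M: the adjugate of M, divided by the determinant, is applied to the
   coefficients of F o M. *)
exists (\poly_(i < 5) (D^-1 * (M 1 1 * cp i - M 0 1 * cq i))).
exists (\poly_(i < 5) (D^-1 * (M 0 0 * cq i - M 1 0 * cp i))).
set p' := \poly_(i < 5) _; set q' := \poly_(i < 5) _.
have cj : conj4 M p q p' q'.
  move=> s t; rewrite !sub4E -/cp -/cq !form4_poly.
  by rewrite /D; split; field.
split=> //; apply/lowest_terms4P; rewrite !size_poly; split=> // x y n.
have := moebius_nonzero uM n; case/lowest_terms4P: lt => _ _ h /h.
move=> /nonzero2P n'; apply/nonzero2P => -[e1 e2]; apply: n'.
by have [-> ->] := cj x y; rewrite e1 e2 !mulr0 addr0.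
Qed.

Lemma conj4_mclass (M : 'M[algC]_2) p q p' q' :
  M \in unitmx -> lowest_terms 4 (p, q) -> lowest_terms 4 (p', q') ->
  conj4 M p q p' q' -> mclass (mkRat p q) = mclass (mkRat p' q').
Proof.
move=> uM lt lt' h; apply/mclass_eqP.
exists (\pi_PGL2 (exist (fun M => M \in unitmx) M uM)).
by apply/conjmapP; rewrite !mkRatE // pglactE; apply: conj4_ratfun.
Qed.

Lemma ratfun_inj (p q p' q' : {poly algC}) :
  lowest_terms 4 (p, q) -> lowest_terms 4 (p', q') ->
  ratfun p q = ratfun p' q' ->
  exists2 c, c != 0 & p = c *: p' /\ q = c *: q'.
Proof.
move=> lt lt' e; apply: lowest_terms_uniq => // x y.
have [n|] := boolP (nonzero2 x y).
  have := congr1 (fun g => g (hpt x y)) e; rewrite !ratfun_hpt // => /hpt_eqP.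
  by apply; [case/lowest_terms4P: lt | case/lowest_terms4P: lt'] => _ _; apply.
rewrite /nonzero2 negb_or !negbK => /andP [/eqP -> /eqP ->].
by rewrite !form4_0 !expr0n /= !mulr0.
Qed.

(** Equality of maps determines lifts only up to a scalar: [conj4_exists] yields an exact lift of
    the conjugate, and [ratfun_inj] compares it with p' and q'. *)
Lemma ratfun_comp_inj (M : 'M[algC]_2) p q p' q' :
  M \in unitmx -> lowest_terms 4 (p, q) -> lowest_terms 4 (p', q') ->
  ratfun p q \o moebius M = moebius M \o ratfun p' q' ->
  exists2 c, c != 0 & conj4 M p q (c *: p') (c *: q').
Proof.
move=> uM lt lt' e.
have [p1 [q1 [lt1 cj]]] := conj4_exists uM lt.
have e1 := conj4_ratfun uM lt lt1 cj; rewrite e in e1.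
have /ratfun_inj : ratfun p1 q1 = ratfun p' q'.
  apply: funext => z; have := congr1 (fun g => moebius (invmx M) (g z)) e1 => /=.
  have := moebiusM (A := invmx M) (B := M); rewrite unitmx_inv => /(_ uM uM).
  rewrite mulVmx // moebius1 => k; have kk w : moebius (invmx M) (moebius M w) = w.
    by have := congr1 (fun g => g w) k.
  by rewrite !kk.
by move=> /(_ lt1 lt') [c c0 [E1 E2]]; exists c => //; rewrite -E1 -E2.
Qed.

Lemma mclass_conj4 p q p' q' :
  lowest_terms 4 (p, q) -> lowest_terms 4 (p', q') ->
  mclass (mkRat p q) = mclass (mkRat p' q') ->
  exists2 M : 'M[algC]_2, M \in unitmx &
    exists2 c, c != 0 & conj4 M p q (c *: p') (c *: q').
Proof.
move=> lt lt' /mclass_eqP [a /conjmapP]; rewrite !mkRatE //.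
have [M uM ->] := pglactP a => e; exists M => //; exact: ratfun_comp_inj.
Qed.

(** * Elimination over P^1 *)

(* C d f is read as: f is homogeneous of degree d. *)
Record graded (D : nmodType) (X : Type) (C : D -> (X -> algC) -> Prop) : Prop := Graded {
  graded0 : forall d, C d (fun _ => 0);
  gradedD : forall d f g, C d f -> C d g -> C d (fun x => f x + g x);
  graded_const : forall c, C 0 (fun _ => c);
  gradedM : forall d e f g, C d f -> C e g -> C (d + e) (fun x => f x * g x) }.

Lemma graded_ext (D : nmodType) (X : Type) (C : D -> (X -> algC) -> Prop) d f g :
  f =1 g -> C d f -> C d g.
Proof. by move=> e; have -> : f = g by apply: funext. Qed.

Section GradedTheory.
Variables (D : nmodType) (X : Type) (C : D -> (X -> algC) -> Prop).
Hypothesis gC : graded C.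


Lemma gradedZ d c f : C d f -> C d (fun x => c * f x).
Proof. by move=> h; rewrite -[d]add0r; apply: (gradedM gC) => //; apply: graded_const. Qed.

Lemma gradedB d f g : C d f -> C d g -> C d (fun x => f x - g x).
Proof.
move=> hf hg; apply: (gradedD gC) => //.
by apply: graded_ext (gradedZ (-1) hg) => x; rewrite mulN1r.
Qed.

Lemma gradedMn d f n : C d f -> C d (fun x => f x *+ n).
Proof. by move=> h; apply: graded_ext (gradedZ n%:R h) => x; rewrite mulr_natl. Qed.

Lemma gradedX d f n : C d f -> C (d *+ n) (fun x => f x ^+ n).
Proof.
move=> h; elim: n => [|n IH]; first exact: graded_const.
rewrite mulrS; apply: (@graded_ext _ _ _ _ (fun x => f x * f x ^+ n)) => [x|].
  by rewrite exprS.
exact: (gradedM gC).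
Qed.

Lemma graded_sum d (I : Type) (r : seq I) (P : pred I) (F : I -> X -> algC) :
  (forall i, C d (F i)) -> C d (fun x => \sum_(i <- r | P i) F i x).
Proof.
move=> h; elim: r => [|i r IH].
  by apply: graded_ext (graded0 gC d) => x; rewrite big_nil.
case Pi: (P i).
  by apply: graded_ext (gradedD gC (h i) IH) => x; rewrite big_cons Pi.
by apply: graded_ext IH => x; rewrite big_cons Pi.
Qed.

Lemma graded_prod d n (F : 'I_n -> X -> algC) :
  (forall i, C d (F i)) -> C (d *+ n) (fun x => \prod_i F i x).
Proof.
elim: n F => [|n IH] F h.
  by apply: graded_ext (graded_const gC 1) => x; rewrite big_ord0.
rewrite mulrS; apply: graded_ext (gradedM gC (h ord0) (IH _ (fun i => h (lift ord0 i)))) => x.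
by rewrite big_ord_recl.
Qed.

Lemma graded_det d n (M : X -> 'M[algC]_n) :
  (forall i j, C d (fun x => M x i j)) -> C (d *+ n) (fun x => \det (M x)).
Proof.
move=> h; apply: graded_sum => s; apply: gradedZ.
exact: (graded_prod (F := fun i x => M x i (s i))).
Qed.

(* functions on X x k^2 which are binary forms of degree n with coefficients of
   degree d *)
Definition adjoin2 (e : D * nat) (f : X * (algC * algC) -> algC) : Prop :=
  exists2 g : nat -> X -> algC, forall j, C e.1 (g j) &
    forall x y, f (x, y) = \sum_(j < e.2.+1) g j x * y.1 ^+ j * y.2 ^+ (e.2 - j).

Lemma adjoin2_monomial d n i c : C d c -> (i <= n)%N ->
  adjoin2 (d, n) (fun z => c z.1 * z.2.1 ^+ i * z.2.2 ^+ (n - i)).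
Proof.
move=> hc le; exists (fun j x => if j == i then c x else 0) => /= [j|x y].
  by case: (j == i) => //; apply: (graded0 gC).
rewrite (bigD1 (Ordinal (le : (i < n.+1)%N))) //= eqxx big1 ?addr0 // => j.
by rewrite -val_eqE /= => /negbTE ->; rewrite !mul0r.
Qed.

Lemma adjoin2_0 e : adjoin2 e (fun _ => 0).
Proof.
exists (fun _ _ => 0) => [j|x y]; first exact: (graded0 gC).
by rewrite big1 // => j _; rewrite !mul0r.
Qed.

Lemma adjoin2_D e f g : adjoin2 e f -> adjoin2 e g -> adjoin2 e (fun x => f x + g x).
Proof.
case=> [a ha Ea] [b hb Eb]; exists (fun j x => a j x + b j x) => [j|x y].
  exact: (gradedD gC).
by rewrite Ea Eb -big_split; apply: eq_bigr => j _; rewrite /= !mulrDl.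
Qed.

(** Adjoining a factor P^1 preserves gradedness, so that it can be done twice, for a and for b, and
    undone by two eliminations. *)
Lemma adjoin2_graded : graded adjoin2.
Proof.
split; [exact: adjoin2_0 | exact: adjoin2_D | |].
  move=> c; apply: graded_ext (adjoin2_monomial (graded_const gC c) (leqnn 0)) => z.
  by rewrite !expr0 !mulr1.
move=> [d n] [e m] f g [a ha Ea] [b hb Eb] /=.
have -> : (fun x => f x * g x) = (fun z => \sum_(i < n.+1) \sum_(j < m.+1)
    (a i z.1 * b j z.1) * z.2.1 ^+ (i + j) * z.2.2 ^+ (n + m - (i + j))).
  apply: funext => -[x y] /=; rewrite Ea Eb /= mulr_suml; apply: eq_bigr => i _.
  rewrite mulr_sumr; apply: eq_bigr => j _.
  have -> : (n + m - (i + j) = (n - i) + (m - j))%N.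
    by have := ltn_ord i; have := ltn_ord j; rewrite !ltnS => hj hi;
      rewrite subnDA -addnBAC // addnBA.
  by rewrite !exprD; ring.
have sum_adj k (F : 'I_k -> X * (algC * algC) -> algC) :
    (forall i, adjoin2 (d + e, (n + m)%N) (F i)) ->
    adjoin2 (d + e, (n + m)%N) (fun z => \sum_(i < k) F i z).
  move=> h; elim: k F h => [|k IH] F h.
    by apply: graded_ext (adjoin2_0 _) => z; rewrite big_ord0.
  have hI := IH (fun i => F (lift ord0 i)) (fun i => h (lift ord0 i)).
  by apply: graded_ext (adjoin2_D (h ord0) hI) => z; rewrite big_ord_recl.
apply: (sum_adj) => i; apply: (sum_adj) => j; apply: (adjoin2_monomial (c := fun x => a i x * b j x)).
  exact: (gradedM gC).
by rewrite leq_add // -ltnS.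
Qed.

Lemma adjoin2_base d f : C d f -> adjoin2 (d, 0%N) (fun z => f z.1).
Proof.
move=> h; apply: graded_ext (adjoin2_monomial h (leqnn 0)) => z.
by rewrite !expr0 !mulr1.
Qed.

Lemma adjoin2_fst : adjoin2 (0, 1%N) (fun z => z.2.1).
Proof.
apply: graded_ext (adjoin2_monomial (graded_const gC 1) (leqnn 1)) => z.
by rewrite expr0 mulr1 mul1r.
Qed.

Lemma adjoin2_snd : adjoin2 (0, 1%N) (fun z => z.2.2).
Proof.
apply: graded_ext (adjoin2_monomial (n := 1) (graded_const gC 1) (leq0n 1)) => z.
by rewrite expr0 mulr1 mul1r.
Qed.

End GradedTheory.

(** * Resultants of binary forms of fixed degree *)

Section BinarySylvester.
Variable n : nat.
Implicit Types p q : {poly algC}.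

Definition bform p (y : algC * algC) := \sum_(j < n.+1) p`_j * y.1 ^+ j * y.2 ^+ (n - j).

Lemma bform_horner p x : (size p <= n.+1)%N -> bform p (x, 1) = p.[x].
Proof.
move=> sp; rewrite (horner_coef_wide x sp); apply: eq_bigr => j _.
by rewrite /= expr1n mulr1.
Qed.

Lemma bform_infty p x : bform p (x, 0) = p`_n * x ^+ n.
Proof.
rewrite /bform big_ord_recr /= subnn expr0 mulr1 big1 ?add0r // => j _.
by rewrite expr0n subn_eq0 leqNgt ltn_ord mulr0.
Qed.

Lemma bformZ p c y : bform p (c * y.1, c * y.2) = c ^+ n * bform p y.
Proof.
rewrite /bform mulr_sumr; apply: eq_bigr => j _ /=; rewrite !exprMn.
have -> : c ^+ n = c ^+ j * c ^+ (n - j) by rewrite -exprD subnKC // -ltnS.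
by ring.
Qed.

Lemma bform_dehom p y : (size p <= n.+1)%N -> y.2 != 0 ->
  bform p y = y.2 ^+ n * p.[y.1 / y.2].
Proof.
case: y => a b /= sp b0; rewrite -bform_horner // -bformZ /=; congr bform.
by rewrite mulr1 mulrCA divff // mulr1.
Qed.

Local Notation band r := (lin1_mx (poly_rV \o r \o* rVpoly)).

(** The format is 2n by 2n whatever the actual degrees of p and q. Hence the determinant is the
    resultant of binary forms of degree n, sees common zeros at infinity, and is a fixed form in the
    coefficients even where the leading ones vanish. *)
Definition Sylv p q : 'M[algC]_(n + n) := col_mx (band p) (band q).

Lemma SylvE p q (i j : 'I_(n + n)) :
  let S_ (r : {poly algC}) (k : nat) := r`_(j - k) *+ (k <= j)%N in
  Sylv p q i j = match fintype.split i with inl k => S_ p k | inr k => S_ q k end.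
Proof.
move=> S_; rewrite mxE; case: {i}(fintype.split i) => i; rewrite !mxE /=;
  by rewrite rVpoly_delta coefXnM ltnNge if_neg -mulrb.
Qed.

Lemma mul_Sylv p q u : (size p <= n.+1)%N -> (size q <= n.+1)%N ->
  rVpoly (u *m Sylv p q) = rVpoly (lsubmx u) * p + rVpoly (rsubmx u) * q.
Proof.
move=> sp sq; rewrite -{1}[u]hsubmxK mul_row_col !mul_rV_lin1 /= -linearD.
rewrite poly_rV_K //.
have bound (v : 'rV[algC]_n) (r : {poly algC}) : (size r <= n.+1)%N -> (size (rVpoly v * r)%R <= n + n)%N.
  move=> sr; rewrite (leq_trans (size_polyMleq _ _)) // -subn1 leq_subLR.
  by rewrite add1n -addnS leq_add ?size_poly.
by rewrite (leq_trans (size_polyD _ _)) // geq_max !bound.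
Qed.

(** If the determinant were nonzero, every polynomial of degree below 2n would be U p + V q with U,
    V of degree below n. A common zero at infinity contradicts this for 'X^(2n-1), a finite one for
    1. *)
Lemma Sylv_common_zero p q y : (0 < n)%N -> (size p <= n.+1)%N -> (size q <= n.+1)%N ->
  nonzero2 y.1 y.2 -> bform p y = 0 -> bform q y = 0 -> \det (Sylv p q) = 0.
Proof.
move=> n0 sp sq ny py qy; apply/eqP/negP => dS.
have uS : Sylv p q \in unitmx by rewrite unitmxE unitfE; apply/negP.
have span (r : {poly algC}) : (size r <= n + n)%N -> exists U V : {poly algC},
    [/\ (size U <= n)%N, (size V <= n)%N & r = U * p + V * q].
  move=> sr; pose u := poly_rV r *m invmx (Sylv p q).
  exists (rVpoly (lsubmx u)), (rVpoly (rsubmx u)); rewrite !size_poly; split=> //.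
  by rewrite -mul_Sylv // mulmxKV // poly_rV_K.
have [y20|y20] := eqVneq y.2 0.
  have y10 : y.1 != 0 by move: ny; rewrite /nonzero2 y20 eqxx orbF.
  have top (r : {poly algC}) : (size r <= n.+1)%N -> bform r y = 0 -> (size r <= n)%N.
    move=> sr; rewrite [y]surjective_pairing y20 bform_infty => /eqP.
    rewrite mulf_eq0 expf_eq0 (negbTE y10) andbF orbF => /eqP rn.
    apply/leq_sizeP => j; rewrite leq_eqVlt => /orP [/eqP <- //|].
    by move/leq_sizeP: sr; apply.
  have [|U [V [sU sV E]]] := span 'X^((n + n).-1).
    by rewrite size_polyXn prednK // addn_gt0 n0.
  have small (W r : {poly algC}) : (size W <= n)%N -> (size r <= n)%N -> (W * r)`_(n + n).-1 = 0.
    move=> sW sr; have [->|W0] := eqVneq W 0; first by rewrite mul0r coef0.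
    apply: nth_default; rewrite (leq_trans (size_polyMleq _ _)) //.
    by rewrite -!subn1 leq_sub2r // leq_add.
  have /eqP := congr1 (fun r : {poly algC} => r`_(n + n).-1) E.
  rewrite coefXn eqxx coefD !small ?addr0 ?oner_eq0 //; exact: top.
have rt (r : {poly algC}) : (size r <= n.+1)%N -> bform r y = 0 -> r.[y.1 / y.2] = 0.
  move=> sr /eqP; rewrite bform_dehom // mulf_eq0 expf_eq0 (negbTE y20) andbF.
  by move/eqP.
have [|U [V [_ _ E]]] := span 1; first by rewrite size_poly1 addn_gt0 n0.
have /eqP := congr1 (fun r : {poly algC} => r.[y.1 / y.2]) E.
by rewrite hornerD !hornerM (rt p) // (rt q) // !mulr0 addr0 hornerC oner_eq0.
Qed.

(** A kernel vector is a relation U p + V q = 0 with U, V of degree below n. Without a common zero,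
    p and q are coprime and one of them has degree exactly n; it divides V or U, which must then
    vanish. *)
Lemma det_Sylv_eq0 p q : (size p <= n.+1)%N -> (size q <= n.+1)%N -> p != 0 ->
  \det (Sylv p q) = 0 ->
  exists y, [/\ nonzero2 y.1 y.2, bform p y = 0 & bform q y = 0].
Proof.
move=> sp sq p0 /eqP /det0P [u u0 E]; apply: contrapT => nz.
have cz y : nonzero2 y.1 y.2 -> bform p y = 0 -> bform q y <> 0.
  by move=> ny py qy; apply: nz; exists y.
have co : coprimep p q.
  apply/Pdiv.ClosedField.coprimepP => x /eqP px; apply/eqP => qx.
  apply: (cz (x, 1)); rewrite ?bform_horner //.
  by rewrite /nonzero2 oner_eq0 orbT.
have top : (size p == n.+1) || (size q == n.+1).
  apply: contrapT => /negP; rewrite negb_or => /andP [np nq].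
  have small (r : {poly algC}) : (size r <= n.+1)%N -> size r != n.+1 -> bform r (1, 0) = 0.
    rewrite leq_eqVlt bform_infty => /orP [/eqP -> /eqP //|lt _].
    by rewrite nth_default ?mul0r.
  apply: (cz (1, 0)); rewrite ?small //.
  by rewrite /nonzero2 oner_eq0.
set U := rVpoly (lsubmx u); set V := rVpoly (rsubmx u).
have E0 : U * p + V * q = 0 by rewrite -mul_Sylv // E linear0.
have E1 : U * p = - V * q by apply/eqP; rewrite mulNr -addr_eq0 E0.
have sU : (size U <= n)%N by rewrite size_poly.
have sV : (size V <= n)%N by rewrite size_poly.
have small_dvd (r W : {poly algC}) : r %| W -> size r = n.+1 -> (size W <= n)%N -> W = 0.
  move=> d sr sW; apply/eqP; apply: contraT => W0; have := dvdp_leq W0 d.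
  by rewrite sr => /leq_trans /(_ sW); rewrite ltnn.
have [U0 V0] : U = 0 /\ V = 0.
  (* For q = 0, coprimality makes p constant, and the degree condition leaves n = 0, where U and V
     have no coefficients. *)
  have [q0|q0] := eqVneq q 0.
    have sp1 : size p = 1%N by move: co; rewrite q0 coprimep0 -size_poly_eq1 => /eqP.
    move: top; rewrite sp1 q0 size_poly0 orbF => /eqP [n0].
    by split; apply/eqP; rewrite -size_poly_leq0 [X in (_ <= X)%N]n0.
  case/orP: top => /eqP sr.
    have V0 : V = 0.
      apply: (small_dvd p) => //; rewrite -dvdpNr -(Gauss_dvdpl _ co) -E1.
      by rewrite dvdp_mull.
    split=> //; apply/eqP; move/eqP: E1; rewrite V0 oppr0 mul0r mulf_eq0.
    by rewrite (negbTE p0) orbF.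
  have co' : coprimep q p by rewrite coprimep_sym.
  have U0 : U = 0.
    apply: (small_dvd q) => //; rewrite -(Gauss_dvdpl _ co') E1.
    by rewrite dvdp_mull.
  split=> //; apply/eqP; move/eqP: E0; rewrite U0 mul0r add0r mulf_eq0.
  by rewrite (negbTE q0) orbF.
case/eqP: u0; rewrite -[u]hsubmxK.
rewrite -[lsubmx u]rVpolyK -[rsubmx u]rVpolyK -/U -/V U0 V0 !linear0.
exact: row_mx0.
Qed.

End BinarySylvester.

Section Elimination.
Variables (D : nmodType) (X : Type) (C : D -> (X -> algC) -> Prop).
Hypothesis gC : graded C.
Variables (I : Type) (d : D) (n : nat) (F : I -> X * (algC * algC) -> algC).
Hypothesis n_gt0 : (0 < n)%N.
Hypothesis hF : forall i, adjoin2 C (d, n) (F i).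

Let coef i := projT1 (cid2 (hF i)).
Let pol i x := \poly_(j < n.+1) coef i j x.

Lemma pol_bform i x y : F i (x, y) = bform n (pol i x) y.
Proof.
rewrite /pol /coef; case: cid2 => g /= _ ->; apply: eq_bigr => j _.
by rewrite coef_poly ltn_ord.
Qed.

Let size_pol i x : (size (pol i x) <= n.+1)%N. Proof. exact: size_poly. Qed.

Let comb (s : seq (algC * I)) x := \sum_(t <- s) t.1 *: pol t.2 x.

Let size_comb s x : (size (comb s x) <= n.+1)%N.
Proof.
elim: s => [|t s IH]; first by rewrite /comb big_nil size_poly0.
rewrite /comb big_cons (leq_trans (size_polyD _ _)) // geq_max IH andbT.
exact: leq_trans (size_scale_leq _ _) _.
Qed.

Let graded_pol i j : C d (fun x => (pol i x)`_j).
Proof.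
have h : C d (coef i j) by rewrite /coef; case: cid2.
case: (ltnP j n.+1) => jn.
  by apply: graded_ext h => x; rewrite coef_poly jn.
apply: graded_ext (graded0 gC d) => x.
by rewrite coef_poly ltnNge jn.
Qed.

Let graded_comb s j : C d (fun x => (comb s x)`_j).
Proof.
apply: (@graded_ext _ _ _ _ (fun x => \sum_(t <- s) (t.1 * (pol t.2 x)`_j))) => [x|].
  by rewrite coef_sum; apply: eq_bigr => t _; rewrite coefZ.
by apply: graded_sum => // t; apply: gradedZ => //; apply: graded_pol.
Qed.

Let bform_lin s x y : bform n (comb s x) y = \sum_(t <- s) t.1 * bform n (pol t.2 x) y.
Proof.
rewrite /bform; under [RHS]eq_bigr => t _ do rewrite mulr_sumr.
rewrite exchange_big /=; apply: eq_bigr => j _; rewrite coef_sum !mulr_suml.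
by apply: eq_bigr => t _; rewrite coefZ !mulrA.
Qed.

(* The resultants of all pairs of linear combinations of the equations cut out
   the projection: if there is no common zero, then a combination which vanishes
   at none of the finitely many zeros of a nonzero equation has nonzero
   resultant with it. *)
Lemma elimination : exists J : set (X -> algC),
  (forall r, J r -> C (d *+ (n + n)) r) /\
  forall x, (exists2 y, nonzero2 y.1 y.2 & forall i, F i (x, y) = 0) <->
    (forall r, J r -> r x = 0).
Proof.
exists [set r | exists s s', r = fun x => \det (Sylv n (comb s x) (comb s' x))].
split=> [_ [s [s' ->]]|x].
  apply: graded_det => // i j.
  have aux s1 (k : nat) : C d (fun x => (comb s1 x)`_(j - k) *+ (k <= j)%N).
    by apply: gradedMn => //; apply: graded_comb.
  case E: (fintype.split i) => [k|k].
    by apply: graded_ext (aux s k) => x; rewrite SylvE E.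
  by apply: graded_ext (aux s' k) => x; rewrite SylvE E.
split=> [[y ny zy] _ [s [s' ->]]|h].
  have comb0 s1 : bform n (comb s1 x) y = 0.
    by rewrite bform_lin big1 // => t _; rewrite -pol_bform zy mulr0.
  exact: Sylv_common_zero (ny) _ _.
have [all0|/existsNP [i0 /eqP ni0]] := pselect (forall i, pol i x = 0).
  exists (1, 0); first by rewrite /nonzero2 oner_eq0.
  by move=> i; rewrite pol_bform all0 /bform big1 // => j _; rewrite coef0 !mul0r.
have comb1 i : comb [:: (1, i)] x = pol i x by rewrite /comb big_seq1 scale1r.
apply: contrapT => nz.
have nzy y : nonzero2 y.1 y.2 -> exists i, bform n (pol i x) y != 0.
  move=> ny; apply: contrapT => /forallNP all0; apply: nz; exists y => // i.
  by rewrite pol_bform; apply/eqP; apply: contrapT => /negP; apply: all0.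
suff [s hs] : exists s, forall y, nonzero2 y.1 y.2 ->
    bform n (pol i0 x) y = 0 -> bform n (comb s x) y != 0.
  have := h (fun x => \det (Sylv n (comb [:: (1, i0)] x) (comb s x))).
  rewrite comb1 => /(_ (ex_intro _ _ (ex_intro _ s erefl))) d0.
  have [y [ny y0 sy]] := det_Sylv_eq0 (size_pol i0 x) (size_comb s x) ni0 d0.
  by have /eqP := hs y ny y0.
have [rs Ers] := closed_field_poly_normal (pol i0 x).
pose zs := (1, 0) :: [seq (r, 1) | r <- rs] : seq (algC * algC).
have zsP y : nonzero2 y.1 y.2 -> bform n (pol i0 x) y = 0 ->
    exists2 z, z \in zs & exists2 c, c != 0 & y = (c * z.1, c * z.2).
  move=> ny y0; have [y20|y20] := eqVneq y.2 0.
    exists (1, 0); first by rewrite inE eqxx.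
    exists y.1; first by move: ny; rewrite /nonzero2 y20 eqxx orbF.
    by rewrite mulr1 mulr0 -y20 -surjective_pairing.
  exists (y.1 / y.2, 1).
    rewrite inE map_f ?orbT //.
    have -> : (y.1 / y.2 \in rs) = root (pol i0 x) (y.1 / y.2).
      by rewrite Ers rootZ ?lead_coef_eq0 // root_prod_XsubC.
    rewrite /root; move/eqP: y0.
    by rewrite bform_dehom // mulf_eq0 expf_eq0 (negbTE y20) andbF.
  exists y.2 => //=; rewrite mulr1 mulrCA divff // mulr1.
  exact: surjective_pairing.
suff [s hs] : exists s, forall z, z \in zs -> bform n (comb s x) z != 0.
  exists s => y ny /(zsP _ ny) [z /hs sz [c c0 ->]].
  by rewrite bformZ mulf_neq0 // expf_neq0.
have : forall z, z \in zs -> nonzero2 z.1 z.2.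
  move=> z; rewrite inE => /orP [/eqP ->|/mapP [r _ ->]].
    by rewrite /nonzero2 oner_eq0.
  by rewrite /nonzero2 oner_eq0 orbT.
elim: zs {zsP} => [|z zs IH] nzs; first by exists [::].
have [|s hs] := IH; first by move=> w wz; apply: nzs; rewrite inE wz orbT.
have [i hi] := nzy z (nzs _ (mem_head _ _)).
have [/eqP sz|sz] := boolP (bform n (comb s x) z == 0); last first.
  by exists s => w; rewrite inE => /orP [/eqP -> //|/hs].
(* The roots of [Q] are the values t for which adding t times equation i creates a zero at one of
   the points already treated; t != 0 is what takes care of the new point z. *)
pose Q := \prod_(w <- zs) ((bform n (comb s x) w)%:P + bform n (pol i x) w *: 'X).
have Q0 : Q != 0.
  rewrite prodf_seq_neq0; apply/allP => w /hs; apply: contraNneq.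
  by move=> /(congr1 (fun r => r.[0])); rewrite hornerD hornerC hornerZ hornerX mulr0 addr0 horner0 => ->.
have [t /andP [t0 Qt]] : exists t, (t != 0) && (Q.[t] != 0).
  apply: contrapT => /forallNP hall; suff : Q * 'X = 0.
    by move/eqP; rewrite mulf_eq0 (negbTE Q0) polyX_eq0.
  apply: poly_fun_eq0 => t; rewrite hornerM hornerX.
  have [->|t0] := eqVneq t 0; first by rewrite mulr0.
  by have /negP := hall t; rewrite t0 negbK => /eqP ->; rewrite mul0r.
exists ((t, i) :: s) => w; rewrite inE bform_lin big_cons /= -bform_lin.
case/orP => [/eqP ->|wz]; first by rewrite sz addr0 mulf_neq0.
move: Qt; rewrite horner_prod prodf_seq_neq0 => /allP /(_ w wz) /=.
by rewrite hornerD hornerC hornerZ hornerX addrC mulrC.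
Qed.

End Elimination.

(** * The maps with a symmetry of given type form a closed set *)

Definition num (f : Rat 4) : {poly algC} := (projT1 (cid (ratmapP f))).1.
Definition den (f : Rat 4) : {poly algC} := (projT1 (cid (ratmapP f))).2.

Lemma num_den_lowest f : lowest_terms 4 (num f, den f).
Proof. by rewrite /num /den; case: cid => -[p q] []. Qed.

Lemma num_denE f : f = mkRat (num f) (den f).
Proof.
apply: ratmap_inj; rewrite mkRatE ?num_den_lowest //.
by rewrite /num /den; case: cid => -[p q] [].
Qed.

Definition rat_form (e : nat) (h : Rat 4 -> algC) : Prop :=
  exists2 P : mpoly.mpoly (5 + 5) algC,
    P \is mpoly.ishomog1 e (@mpoly.mdeg (5 + 5)) & forall f, h f = mpoly.meval (coefs f) P.

Lemma rat_form_graded : graded rat_form.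
Proof.
split.
- by move=> e; exists 0 => [|f]; rewrite ?rpred0 // mpoly.meval0.
- move=> e f g [P hP EP] [Q hQ EQ]; exists (P + Q) => [|x]; first exact: rpredD.
  by rewrite mpoly.mevalD EP EQ.
- move=> c; exists (c *: 1) => [|x]; last by rewrite mpoly.mevalZ mpoly.meval1 mulr1.
  exact/mpoly.dhomogZ/mpoly.dhomog1.
- move=> d e f g [P hP EP] [Q hQ EQ]; exists (P * Q) => [|x].
    exact: mpoly.dhomogM.
  by rewrite mpoly.mevalM EP EQ.
Qed.

Lemma rat_form_coefs i : rat_form 1 (fun f => coefs f i).
Proof.
exists (mpoly.mpolyX _ (mpoly.mnm1 i)) => [|f]; last by rewrite mpoly.mevalXU.
by rewrite mpoly.dhomogX; apply/eqP; exact: mpoly.mdeg1.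
Qed.

Lemma coefs_num f (i : 'I_5) : coefs f (lshift 5 i) = (num f)`_i.
Proof. by rewrite /coefs /num (unsplitK (inl i)). Qed.

Lemma coefs_den f (i : 'I_5) : coefs f (rshift 5 i) = (den f)`_i.
Proof. by rewrite /coefs /den (unsplitK (inr i)). Qed.

Lemma rat_form_num i : (i < 5)%N -> rat_form 1 (fun f => (num f)`_i).
Proof.
move=> i5; apply: graded_ext (rat_form_coefs (lshift 5 (Ordinal i5))) => f.
exact: coefs_num.
Qed.

Lemma rat_form_den i : (i < 5)%N -> rat_form 1 (fun f => (den f)`_i).
Proof.
move=> i5; apply: graded_ext (rat_form_coefs (rshift 5 (Ordinal i5))) => f.
exact: coefs_den.
Qed.

Section Form4Graded.
Variables (D : nmodType) (X : Type) (C : D -> (X -> algC) -> Prop).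
Hypothesis gC : graded C.

Lemma gradedM_eq d e k f g : C d f -> C e g -> d + e = k -> C k (fun x => f x * g x).
Proof. by move=> hf hg <-; apply: (gradedM gC). Qed.

Lemma graded_form4 d e k (p : X -> {poly algC}) u v :
  (forall i, (i < 5)%N -> C d (fun x => (p x)`_i)) -> C e u -> C e v ->
  d + e *+ 4 = k -> C k (fun x => form4 (p x) (u x) (v x)).
Proof.
move=> hp hu hv <-.
have mono i : (i <= 4)%N -> C (d + e *+ 4) (fun x => (p x)`_i * (u x ^+ i * v x ^+ (4 - i))).
  move=> i4; apply: (gradedM gC); first exact: hp.
  apply: (gradedM_eq (gradedX gC i hu) (gradedX gC (4 - i) hv)).
  by rewrite -mulrnDr subnKC.
have h := gradedD gC (gradedD gC (gradedD gC (gradedD gC (mono 0%N isT) (mono 1%N isT))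
  (mono 2 isT)) (mono 3 isT)) (mono 4 isT).
by apply: graded_ext h => x; rewrite /form4 /=; ring.
Qed.

End Form4Graded.

Definition det2 (a b : algC * algC) := a.1 * b.2 - a.2 * b.1.

(* det2 a b times the linear map with eigenvectors a, b of eigenvalues zeta, 1 *)
Definition rot (zeta : algC) (a b v : algC * algC) : algC * algC :=
  (zeta * det2 v b * a.1 + det2 a v * b.1, zeta * det2 v b * a.2 + det2 a v * b.2).

Definition hom4 (f : Rat 4) (v : algC * algC) : algC * algC :=
  (form4 (num f) v.1 v.2, form4 (den f) v.1 v.2).

(* In the basis (a, b), f commutes with z |-> zeta z. The factor det2 a b ^+ 3
   makes this equation fail for proportional a and b. *)
Definition rot_eq zeta omega f a b v :=
  let r := rot zeta a b (hom4 f v) in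
  hom4 f (rot zeta a b v) =
    (omega * det2 a b ^+ 3 * r.1, omega * det2 a b ^+ 3 * r.2).

(** The three degrees are those in the coefficients of f, in a and in b. *)
Notation tri := (adjoin2 (adjoin2 rat_form)).

Section Tri.
Implicit Types x : Rat 4 * (algC * algC) * (algC * algC).

Lemma tri_graded : graded tri.
Proof. exact/adjoin2_graded/adjoin2_graded/rat_form_graded. Qed.

Let g1 := rat_form_graded.
Let g2 := adjoin2_graded g1.
Let g3 := tri_graded.

Lemma tri_a1 : tri (0, 1, 0)%N (fun x => x.1.2.1).
Proof. exact: (adjoin2_base g2 (adjoin2_fst g1)). Qed.

Lemma tri_a2 : tri (0, 1, 0)%N (fun x => x.1.2.2).
Proof. exact: (adjoin2_base g2 (adjoin2_snd g1)). Qed.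

Lemma tri_b1 : tri (0, 0, 1)%N (fun x => x.2.1).
Proof. exact: (adjoin2_fst g2). Qed.

Lemma tri_b2 : tri (0, 0, 1)%N (fun x => x.2.2).
Proof. exact: (adjoin2_snd g2). Qed.

Lemma tri_num i : (i < 5)%N -> tri (1, 0, 0)%N (fun x => (num x.1.1)`_i).
Proof. by move=> /rat_form_num h; exact: (adjoin2_base g2 (adjoin2_base g1 h)). Qed.

Lemma tri_den i : (i < 5)%N -> tri (1, 0, 0)%N (fun x => (den x.1.1)`_i).
Proof. by move=> /rat_form_den h; exact: (adjoin2_base g2 (adjoin2_base g1 h)). Qed.

Lemma tri_const c : tri (0, 0, 0)%N (fun _ => c).
Proof. exact: (graded_const g3). Qed.

Lemma tri_det2 d e k u v : tri d (fun x => (u x).1) -> tri d (fun x => (u x).2) ->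
  tri e (fun x => (v x).1) -> tri e (fun x => (v x).2) -> d + e = k ->
  tri k (fun x => det2 (u x) (v x)).
Proof.
by move=> u1 u2 v1 v2 E; apply: (gradedB g3);
  [apply: (gradedM_eq g3 u1 v2) | apply: (gradedM_eq g3 u2 v1)].
Qed.

Lemma tri_detab : tri (0, 1, 1)%N (fun x => det2 x.1.2 x.2).
Proof. exact: tri_det2 tri_a1 tri_a2 tri_b1 tri_b2 _. Qed.

Lemma tri_rot z d k v : tri d (fun x => (v x).1) -> tri d (fun x => (v x).2) ->
  d + (0, 1, 1)%N = k ->
  tri k (fun x => (rot z x.1.2 x.2 (v x)).1) /\ tri k (fun x => (rot z x.1.2 x.2 (v x)).2).
Proof.
move=> v1 v2 E.
have vb := gradedZ g3 z (tri_det2 v1 v2 tri_b1 tri_b2 erefl).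
have av := tri_det2 tri_a1 tri_a2 v1 v2 erefl.
split; (apply: (gradedD g3); [apply: (gradedM_eq g3 vb) | apply: (gradedM_eq g3 av)]);
  do ?[exact: tri_a1 | exact: tri_a2 | exact: tri_b1 | exact: tri_b2];
  rewrite -E; move: (d) => [[d1 d2] d3]; congr (_, _, _) => /=; by rewrite /= ?addr0 ?add0r // addrC.
Qed.

Lemma tri_hom d k v : tri d (fun x => (v x).1) -> tri d (fun x => (v x).2) ->
  (1, 0, 0)%N + d *+ 4 = k ->
  tri k (fun x => (hom4 x.1.1 (v x)).1) /\ tri k (fun x => (hom4 x.1.1 (v x)).2).
Proof.
move=> v1 v2 E; split.
  exact: (graded_form4 g3 tri_num v1 v2 E).
exact: (graded_form4 g3 tri_den v1 v2 E).
Qed.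

End Tri.

Lemma rot_parallel z a m v : rot z a (m * a.1, m * a.2) v =
  ((z - 1) * m * det2 v a * a.1, (z - 1) * m * det2 v a * a.2).
Proof. by rewrite /rot /det2 /=; congr pair; ring. Qed.

Lemma hom4Z f c v : hom4 f (c * v.1, c * v.2) = (c ^+ 4 * (hom4 f v).1, c ^+ 4 * (hom4 f v).2).
Proof. by rewrite /hom4 /= !form4Z. Qed.

Lemma hom4_nonzero f v : nonzero2 v.1 v.2 -> nonzero2 (hom4 f v).1 (hom4 f v).2.
Proof. by case/lowest_terms4P: (num_den_lowest f) => _ _; apply. Qed.

Lemma rot_eq_independent z w f a b : z != 1 -> nonzero2 a.1 a.2 -> nonzero2 b.1 b.2 ->
  (forall v, rot_eq z w f a b v) -> det2 a b != 0.
Proof.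
move=> z1 na nb h; apply/eqP => ab0.
have [m m0 [E1 E2]] : exists2 m, m != 0 & b.1 = m * a.1 /\ b.2 = m * a.2.
  apply: proportional2 => //; apply/eqP; rewrite -subr_eq0.
  by rewrite -oppr_eq0; apply/eqP; rewrite -[RHS]ab0 /det2; ring.
have [v va] : exists v, det2 v a != 0.
  have /nonzero2P := na; have [a20 n|a20 _] := eqVneq a.2 0.
    exists (0, 1); rewrite /det2 /= mul0r mul1r sub0r oppr_eq0.
    by apply/eqP => a10; apply: n.
  by exists (1, 0); rewrite /det2 /= mul1r mul0r subr0.
have := h v; rewrite /rot_eq ab0 expr0n /= !mulr0 !mul0r.
rewrite [b]surjective_pairing E1 E2 rot_parallel hom4Z => -[] e1 e2.
have c0 : ((z - 1) * m * det2 v a) ^+ 4 != 0.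
  by rewrite expf_neq0 // !mulf_neq0 // subr_eq0.
have /nonzero2P := hom4_nonzero f na; apply; split; apply: (mulfI c0);
  by rewrite ?e1 ?e2 mulr0.
Qed.

Lemma tri_scale N : ((1, 4, 4)%N : nat * nat * nat) *+ N = (N, N * 4, N * 4)%N.
Proof.
elim: N => [|N IH] //; rewrite mulrS IH; congr (_, _, _) => /=; rewrite ?mulSn //.
Qed.

(** * Elimination of the two fixed points *)

Section RotClosed.
Variables (z w : algC) (N : nat) (I : Type).
Variable H : I -> Rat 4 * (algC * algC) * (algC * algC) -> algC.
Hypotheses (z1 : z != 1) (N_gt0 : (0 < N)%N).
Hypothesis hH : forall i, tri ((1, 4, 4)%N *+ N) (H i).

Lemma rot_closed : zariski_closed [set f : Rat 4 | exists a b,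
  [/\ det2 a b != 0, forall v, rot_eq z w f a b v & forall i, H i (f, a, b) = 0]].
Proof.
pose e1 v (x : Rat 4 * (algC * algC) * (algC * algC)) := (hom4 x.1.1 (rot z x.1.2 x.2 v)).1 -
  w * det2 x.1.2 x.2 ^+ 3 * (rot z x.1.2 x.2 (hom4 x.1.1 v)).1.
pose e2 v (x : Rat 4 * (algC * algC) * (algC * algC)) := (hom4 x.1.1 (rot z x.1.2 x.2 v)).2 -
  w * det2 x.1.2 x.2 ^+ 3 * (rot z x.1.2 x.2 (hom4 x.1.1 v)).2.
have g3 := tri_graded.
have [he1 he2] : (forall v, tri (1, 4, 4)%N (e1 v)) /\ (forall v, tri (1, 4, 4)%N (e2 v)).
  have aux v : tri (1, 4, 4)%N (e1 v) /\ tri (1, 4, 4)%N (e2 v).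
    have [r1 r2] := tri_rot z (v := fun=> v) (tri_const v.1) (tri_const v.2) erefl.
    have [hr1 hr2] := tri_hom r1 r2 erefl.
    have [h1 h2] := tri_hom (v := fun=> v) (tri_const v.1) (tri_const v.2) erefl.
    have [rh1 rh2] := tri_rot z h1 h2 erefl.
    have d3 := gradedZ g3 w (gradedX g3 3 tri_detab).
    split; apply: (gradedB g3).
    - exact: hr1.
    - exact: (gradedM_eq g3 d3 rh1).
    - exact: hr2.
    - exact: (gradedM_eq g3 d3 rh2).
  by split=> v; case: (aux v).
(* [elimination] takes equations of one common degree. Raising [e1] and [e2] to the power N gives
   them the degree of [H] without changing their zeros. *)
pose F (i : (algC * algC) * bool + I) x := match i with
  | inl (v, true) => e1 v x ^+ N
  | inl (v, false) => e2 v x ^+ N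
  | inr i => H i x
  end.
have hF i : tri (N, N * 4, N * 4)%N (F i).
  rewrite -tri_scale; case: i => [[v []]|i]; last exact: hH.
    exact: (gradedX g3 N (he1 v)).
  exact: (gradedX g3 N (he2 v)).
have N4 : (0 < N * 4)%N by rewrite muln_gt0 N_gt0.
have [J1 [hJ1 J1P]] := elimination (adjoin2_graded rat_form_graded) N4 hF.
have dJ : ((N, N * 4)%N : nat * nat) *+ (N * 4 + N * 4) =
    (N * (N * 4 + N * 4), (N * 4) * (N * 4 + N * 4))%N.
  elim: (N * 4 + N * 4)%N => [|k IH]; first by rewrite mulr0n !muln0.
  by rewrite mulrS IH !mulnS.
have N8 : (0 < (N * 4) * (N * 4 + N * 4))%N by rewrite muln_gt0 N4 addn_gt0 N4.
(* What remains after eliminating b is a system of equations in (f, a), from which a is eliminated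
   in turn. *)
pose F1 (r : {r | J1 r}) := sval r.
have hF1 r : adjoin2 rat_form (N * (N * 4 + N * 4), (N * 4) * (N * 4 + N * 4))%N (F1 r).
  by rewrite -dJ; apply: hJ1; case: r.
have [J [hJ JP]] := elimination rat_form_graded N8 hF1.
exists [set P | (exists e, P \is mpoly.ishomog1 e (@mpoly.mdeg (5 + 5))) /\
  exists2 r, J r & forall f, r f = mpoly.meval (coefs f) P].
split; first by move=> P [].
apply/seteqP; split => f /=.
  move=> [a [b [ab eqs eqH]]] P [_ [r Jr <-]].
  apply: (proj1 (JP f)) => //.
  have [na nb] : nonzero2 a.1 a.2 /\ nonzero2 b.1 b.2.
    by split; apply/nonzero2P => -[x1 x2]; move/eqP: ab; apply;
      rewrite /det2 x1 x2; ring.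
  exists a => // -[r1 Jr1] /=; apply: (proj1 (J1P (f, a))) => //.
  exists b => // i; case: i => [[v []]|i] //=.
    have := eqs v; rewrite /rot_eq /e1 /= [hom4 f (rot _ _ _ _)]surjective_pairing => -[-> _].
    by rewrite subrr expr0n eqn0Ngt N_gt0.
  have := eqs v; rewrite /rot_eq /e2 /= [hom4 f (rot _ _ _ _)]surjective_pairing => -[_ ->].
  by rewrite subrr expr0n eqn0Ngt N_gt0.
move=> h; have [|a na ha] := proj2 (JP f).
  move=> r Jr; have [P hP EP] := hJ r Jr; rewrite EP; apply: h.
  by split; [exists (N * (N * 4 + N * 4) *+ ((N * 4) * (N * 4 + N * 4) + (N * 4) * (N * 4 + N * 4)))%R | exists r].
have [|b nb hb] := proj2 (J1P (f, a)).
  by move=> r Jr; apply: (ha (exist _ r Jr)).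
exists a, b.
have eqs v : rot_eq z w f a b v.
  have h1 := hb (inl (v, true)); have h2 := hb (inl (v, false)).
  rewrite /rot_eq [hom4 f _]surjective_pairing; congr pair.
    by apply/eqP; rewrite -subr_eq0; move/eqP: h1; rewrite /= expf_eq0 N_gt0.
  by apply/eqP; rewrite -subr_eq0; move/eqP: h2; rewrite /= expf_eq0 N_gt0.
split=> //; last by move=> i; apply: (hb (inr i)).
exact: rot_eq_independent (eqs).
Qed.

End RotClosed.

Definition comb2 (a b : algC * algC) (s t : algC) : algC * algC :=
  (a.1 * s + b.1 * t, a.2 * s + b.2 * t).

(* p / q is the expression of f in the basis (a, b). *)
Definition basis_eq f a b p q := forall s t,
  hom4 f (comb2 a b s t) = comb2 a b (form4 p s t) (form4 q s t).

Definition basis_mx (a b : algC * algC) : 'M[algC]_2 :=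
  \matrix_(i, j) if i == 0 then (if j == 0 then a.1 else b.1) else (if j == 0 then a.2 else b.2).

Lemma basis_mx_unit a b : (basis_mx a b \in unitmx) = (det2 a b != 0).
Proof. by rewrite unitmx22 !mxE /= /det2 [b.1 * _]mulrC. Qed.

Lemma basis_conj4 f a b p q :
  basis_eq f a b p q <-> conj4 (basis_mx a b) (num f) (den f) p q.
Proof.
by split=> h s t; have := h s t; rewrite !mxE /= /hom4 /comb2 /= => -[-> ->].
Qed.

Lemma basis_exists f a b : det2 a b != 0 ->
  exists p q, lowest_terms 4 (p, q) /\ basis_eq f a b p q.
Proof.
rewrite -basis_mx_unit => u.
have [p [q [lt cj]]] := conj4_exists u (num_den_lowest f).
by exists p, q; split=> //; apply/basis_conj4.
Qed.

Lemma basis_mclass f a b p q : det2 a b != 0 -> lowest_terms 4 (p, q) ->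
  basis_eq f a b p q -> mclass f = mclass (mkRat p q).
Proof.
rewrite -basis_mx_unit => u lt /basis_conj4 h; rewrite {1}(num_denE f).
exact: conj4_mclass (num_den_lowest f) lt h.
Qed.

Lemma mclass_basis f p q : lowest_terms 4 (p, q) -> mclass f = mclass (mkRat p q) ->
  exists a b c, [/\ det2 a b != 0, c != 0 & basis_eq f a b (c *: p) (c *: q)].
Proof.
move=> lt; rewrite {1}(num_denE f) => /(mclass_conj4 (num_den_lowest f) lt).
case=> M uM [c c0 h]; exists (M 0 0, M 1 0), (M 0 1, M 1 1), c; split=> //.
  by move: uM; rewrite unitmx22 /det2 /= [M 0 1 * _]mulrC.
by move=> s t; have [e1 e2] := h s t; rewrite /hom4 /comb2 /= e1 e2.
Qed.

Lemma comb2_inj a b s t s' t' : det2 a b != 0 ->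
  comb2 a b s t = comb2 a b s' t' -> s = s' /\ t = t'.
Proof.
move=> d [e1 e2]; split; apply: (mulfI d).
  transitivity ((a.1 * s + b.1 * t) * b.2 - (a.2 * s + b.2 * t) * b.1).
    by rewrite /det2; ring.
  by rewrite e1 e2 /det2; ring.
transitivity (a.1 * (a.2 * s + b.2 * t) - a.2 * (a.1 * s + b.1 * t)).
  by rewrite /det2; ring.
by rewrite e1 e2 /det2; ring.
Qed.

Lemma comb2_surj a b v : det2 a b != 0 -> exists s t, v = comb2 a b s t.
Proof.
move=> d; exists (det2 v b / det2 a b), (det2 a v / det2 a b).
rewrite [LHS]surjective_pairing /comb2; congr pair; rewrite /det2; by field.
Qed.

Lemma rot_comb2 z a b s t :
  rot z a b (comb2 a b s t) = comb2 a b (det2 a b * (z * s)) (det2 a b * t).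
Proof. by rewrite /rot /comb2 /det2 /=; congr pair; ring. Qed.

Lemma comb2Z a b c s t : comb2 a b (c * s) (c * t) = (c * (comb2 a b s t).1, c * (comb2 a b s t).2).
Proof. by rewrite /comb2 /=; congr pair; ring. Qed.

Lemma form4_eq_coef p q : (forall s t, form4 p s t = form4 q s t) ->
  forall i, (i < 5)%N -> p`_i = q`_i.
Proof.
move=> h; suff : \poly_(i < 5) p`_i = \poly_(i < 5) q`_i.
  by move=> e i i5; move/(congr1 (fun r : {poly algC} => r`_i)): e; rewrite !coef_poly i5.
apply: form4_inj; rewrite ?size_poly // => s t.
by rewrite !form4_poly; exact: h.
Qed.

(** In coordinates with respect to (a, b), [rot] is det2 a b times (s, t) |-> (z s, t). The quartic
    forms turn this factor into its fourth power on the left of [rot_eq], while [rot] supplies one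
    factor on the right: hence the exponent 3 there. Cancelling leaves the semi-invariance of p and
    q, coefficient by coefficient. *)
Lemma rot_basis z w f a b p q : det2 a b != 0 -> basis_eq f a b p q ->
  (forall v, rot_eq z w f a b v) <->
  (forall i, (i < 5)%N -> p`_i * z ^+ i = w * z * p`_i /\ q`_i * z ^+ i = w * q`_i).
Proof.
move=> d h.
have scaled (r : {poly algC}) s t : form4 (\poly_(i < 5) (r`_i * z ^+ i)) s t = form4 r (z * s) t.
  by rewrite form4_poly /form4; ring.
have eqvE s t : rot_eq z w f a b (comb2 a b s t) <->
    comb2 a b (form4 p (z * s) t) (form4 q (z * s) t) =
    comb2 a b (w * z * form4 p s t) (w * form4 q s t).
  rewrite /rot_eq h !rot_comb2 h !form4Z !comb2Z.
  have -> c1 c2 : c1 * z * c2 = c1 * (z * c2) by ring.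
  rewrite comb2Z; split=> [[e1 e2]|[e1 e2]].
    have d4 := expf_neq0 4 d.
    by rewrite /comb2 /= in e1 e2 *; congr pair; apply: (mulfI d4); rewrite ?e1 ?e2; ring.
  rewrite /comb2 /= in e1 e2 *; congr pair; rewrite ?e1 ?e2; ring.
split=> [hr i i5|hc v].
  have hst s t : form4 p (z * s) t = w * z * form4 p s t /\ form4 q (z * s) t = w * form4 q s t.
    by apply: (comb2_inj d); apply/eqvE; apply: hr.
  split.
    have /(_ _ i i5) := @form4_eq_coef (\poly_(i < 5) (p`_i * z ^+ i)) ((w * z) *: p).
    rewrite coef_poly i5 coefZ; apply=> s t; rewrite scaled form4Zp.
    by case: (hst s t).
  have /(_ _ i i5) := @form4_eq_coef (\poly_(i < 5) (q`_i * z ^+ i)) (w *: q).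
  rewrite coef_poly i5 coefZ; apply=> s t; rewrite scaled form4Zp.
  by case: (hst s t).
have [s [t ->]] := comb2_surj v d; apply/eqvE; congr comb2.
  rewrite -scaled form4_poly /form4.
  by rewrite !(proj1 (hc _ _)) //; ring.
rewrite -scaled form4_poly /form4.
by rewrite !(proj2 (hc _ _)) //; ring.
Qed.

Definition sub4v f (a b : algC * algC) i :=
  (sub4 (num f) a.1 a.2 b.1 b.2 i, sub4 (den f) a.1 a.2 b.1 b.2 i).

(** Cramer's rule. The left sides are multihomogeneous in (f, a, b), which makes the coefficients of
    the normal form accessible to elimination. *)
Lemma basis_sub4 f a b p q i : basis_eq f a b p q -> (i < 5)%N ->
  det2 (sub4v f a b i) b = det2 a b * p`_i /\ det2 a (sub4v f a b i) = det2 a b * q`_i.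
Proof.
move=> h i5.
have e1 : sub4 (num f) a.1 a.2 b.1 b.2 i = a.1 * p`_i + b.1 * q`_i.
  have /(_ _ i i5) := @form4_eq_coef (\poly_(i < 5) sub4 (num f) a.1 a.2 b.1 b.2 i) (a.1 *: p + b.1 *: q).
  rewrite coef_poly i5 coefD !coefZ; apply=> s t; rewrite form4_poly form4D !form4Zp -sub4E.
  by have [] := h s t.
have e2 : sub4 (den f) a.1 a.2 b.1 b.2 i = a.2 * p`_i + b.2 * q`_i.
  have /(_ _ i i5) := @form4_eq_coef (\poly_(i < 5) sub4 (den f) a.1 a.2 b.1 b.2 i) (a.2 *: p + b.2 *: q).
  rewrite coef_poly i5 coefD !coefZ; apply=> s t; rewrite form4_poly form4D !form4Zp -sub4E.
  by have [] := h s t.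
by rewrite /sub4v /det2 /= e1 e2; split; ring.
Qed.

Section TriSub4.
Let g3 := tri_graded.

Ltac tri_leaf := first [exact: tri_a1 | exact: tri_a2 | exact: tri_b1 | exact: tri_b2
  | exact: (@tri_num 0 isT) | exact: (@tri_num 1 isT) | exact: (@tri_num 2 isT)
  | exact: (@tri_num 3 isT) | exact: (@tri_num 4 isT)
  | exact: (@tri_den 0 isT) | exact: (@tri_den 1 isT) | exact: (@tri_den 2 isT)
  | exact: (@tri_den 3 isT) | exact: (@tri_den 4 isT)].
Ltac tri_auto := first [tri_leaf
  | refine (gradedD g3 _ _); [tri_auto | tri_auto]
  | refine (gradedMn g3 _ _); tri_auto
  | refine (gradedX g3 _ _); tri_auto
  | eapply (gradedM_eq g3); [tri_auto | tri_auto | reflexivity]].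

Lemma tri_sub4_1 : tri (1, 1, 3)%N (fun x => (sub4v x.1.1 x.1.2 x.2 1).1) /\
  tri (1, 1, 3)%N (fun x => (sub4v x.1.1 x.1.2 x.2 1).2).
Proof. split; rewrite /sub4v /sub4 /=; tri_auto. Qed.

Lemma tri_sub4_3 : tri (1, 3, 1)%N (fun x => (sub4v x.1.1 x.1.2 x.2 3).1) /\
  tri (1, 3, 1)%N (fun x => (sub4v x.1.1 x.1.2 x.2 3).2).
Proof. split; rewrite /sub4v /sub4 /=; tri_auto. Qed.

Lemma tri_sub4_0 : tri (1, 0, 4)%N (fun x => (sub4v x.1.1 x.1.2 x.2 0).1) /\
  tri (1, 0, 4)%N (fun x => (sub4v x.1.1 x.1.2 x.2 0).2).
Proof. exact: (tri_hom tri_b1 tri_b2 erefl). Qed.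

Lemma tri_sub4_4 : tri (1, 4, 0)%N (fun x => (sub4v x.1.1 x.1.2 x.2 4).1) /\
  tri (1, 4, 0)%N (fun x => (sub4v x.1.1 x.1.2 x.2 4).2).
Proof. exact: (tri_hom tri_a1 tri_a2 erefl). Qed.

End TriSub4.

(** * Normal forms *)

Lemma lowest_diag (p q p' q' : {poly algC}) (s0 t0 : algC) : s0 != 0 -> t0 != 0 -> lowest_terms 4 (p, q) ->
  (size p' <= 5)%N -> (size q' <= 5)%N ->
  (forall s t, form4 p (s0 * s) (t0 * t) = s0 * form4 p' s t /\
     form4 q (s0 * s) (t0 * t) = t0 * form4 q' s t) ->
  lowest_terms 4 (p', q').
Proof.
move=> s00 t00 /lowest_terms4P [_ _ lt] sp sq h; apply/lowest_terms4P; split=> // x y /nonzero2P n.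
have : nonzero2 (s0 * x) (t0 * y).
  apply/nonzero2P => -[/eqP e1 /eqP e2]; apply: n.
  by move: e1 e2; rewrite !mulf_eq0 (negbTE s00) (negbTE t00) => /eqP -> /eqP ->.
move/lt; have [-> ->] := h x y; move=> /nonzero2P n'; apply/nonzero2P => -[e1 e2].
by apply: n'; rewrite e1 e2 !mulr0.
Qed.

Lemma mclass_diag (p q p' q' : {poly algC}) (s0 t0 : algC) : s0 != 0 -> t0 != 0 -> lowest_terms 4 (p, q) ->
  lowest_terms 4 (p', q') ->
  (forall s t, form4 p (s0 * s) (t0 * t) = s0 * form4 p' s t /\
     form4 q (s0 * s) (t0 * t) = t0 * form4 q' s t) ->
  mclass (mkRat p q) = mclass (mkRat p' q').
Proof.
move=> s00 t00 lt lt' h.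
have u : basis_mx (s0, 0) (0, t0) \in unitmx.
  by rewrite basis_mx_unit /det2 /= mul0r subr0 mulf_neq0.
apply: (conj4_mclass u lt lt') => s t; rewrite !mxE /= !mul0r !add0r !addr0.
by have [-> ->] := h s t.
Qed.

Lemma lowest_swap (p q p' q' : {poly algC}) : lowest_terms 4 (p, q) ->
  (size p' <= 5)%N -> (size q' <= 5)%N ->
  (forall s t, form4 p t s = form4 q' s t /\ form4 q t s = form4 p' s t) ->
  lowest_terms 4 (p', q').
Proof.
move=> /lowest_terms4P [_ _ lt] sp sq h; apply/lowest_terms4P; split=> // x y n.
have := lt y x; have [-> ->] := h x y; rewrite /nonzero2 orbC => /(_ n).
by rewrite orbC.
Qed.

Lemma mclass_swap (p q p' q' : {poly algC}) : lowest_terms 4 (p, q) -> lowest_terms 4 (p', q') ->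
  (forall s t, form4 p t s = form4 q' s t /\ form4 q t s = form4 p' s t) ->
  mclass (mkRat p q) = mclass (mkRat p' q').
Proof.
move=> lt lt' h.
have u : basis_mx (0, 1) (1, 0) \in unitmx.
  by rewrite basis_mx_unit /det2 /= mul0r mul1r sub0r oppr_eq0 oner_eq0.
apply: (conj4_mclass u lt lt') => s t; rewrite !mxE /= !mul0r !mul1r !add0r !addr0.
by have [-> ->] := h s t.
Qed.

Lemma mclass_swap_ex (p q : {poly algC}) : lowest_terms 4 (p, q) -> exists p' q',
  [/\ lowest_terms 4 (p', q'), mclass (mkRat p q) = mclass (mkRat p' q') &
    forall i, (i < 5)%N -> p'`_i = q`_(4 - i) /\ q'`_i = p`_(4 - i)].
Proof.
move=> lt; exists (\poly_(i < 5) q`_(4 - i)), (\poly_(i < 5) p`_(4 - i)).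
have h (s t : algC) : form4 p t s = form4 (\poly_(i < 5) p`_(4 - i)) s t /\
    form4 q t s = form4 (\poly_(i < 5) q`_(4 - i)) s t.
  by rewrite !form4_poly /form4 /=; split; ring.
have lt' : lowest_terms 4 (\poly_(i < 5) q`_(4 - i), \poly_(i < 5) p`_(4 - i)).
  by apply: lowest_swap lt _ _ h; apply: size_poly.
split=> //; first exact: mclass_swap lt lt' h.
by move=> i i5; rewrite !coef_poly i5.
Qed.

Lemma root_ex n (c : algC) : (0 < n)%N -> exists x, x ^+ n = c.
Proof. by move=> n0; exists (n.-root c); apply: rootCK. Qed.

Lemma root_neq0 n (c : algC) : (0 < n)%N -> c != 0 -> exists2 x, x != 0 & x ^+ n = c.
Proof.
move=> n0 c0; have [x E] := root_ex c n0; exists x => //.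
by apply: contraNneq c0 => x0; rewrite -E x0 expr0n eqn0Ngt n0.
Qed.

Lemma lowest_at_infty (p q : {poly algC}) : lowest_terms 4 (p, q) -> nonzero2 p`_4 q`_4.
Proof.
move=> /lowest_terms4P [_ _ /(_ 1 0)].
rewrite {1}/nonzero2 oner_eq0 => /(_ isT).
by rewrite !form4_0 !expr1n !mulr1.
Qed.

Lemma lowest_at_0 (p q : {poly algC}) : lowest_terms 4 (p, q) -> nonzero2 p`_0 q`_0.
Proof.
move=> /lowest_terms4P [_ _ /(_ 0 1)].
rewrite {1}/nonzero2 oner_eq0 orbT => /(_ isT).
by rewrite /form4 !expr0n /= !expr1n !mulr0 !mul0r !addr0 !mulr1.
Qed.

Definition C3map (k1 k2 : algC) := mkRat ('X^4 + k1 *: 'X) (k2 *: 'X^3 + 1).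
Definition C4map (k : algC) := mkRat ('X^4 + 1) (k *: 'X^3).

Lemma size5 (p : {poly algC}) : (forall i, (4 < i)%N -> p`_i = 0) -> (size p <= 5)%N.
Proof. by move=> h; apply/leq_sizeP. Qed.

Ltac coefs_simpl := rewrite ?(coefD, coefZ, coefXn, coefX, coef1, coefN) /=.

Ltac size5_tac := apply: size5 => -[|[|[|[|[|?]]]]] // _; coefs_simpl;
  rewrite ?(mulr0, addr0) //.

Lemma C3_formE (k1 k2 s t : algC) :
  form4 ('X^4 + k1 *: 'X) s t = s ^+ 4 + k1 * s * t ^+ 3 /\
  form4 (k2 *: 'X^3 + 1) s t = k2 * s ^+ 3 * t + t ^+ 4.
Proof. by rewrite /form4; coefs_simpl; split; ring. Qed.

Lemma C4_formE (k s t : algC) :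
  form4 ('X^4 + 1) s t = s ^+ 4 + t ^+ 4 /\ form4 (k *: 'X^3) s t = k * s ^+ 3 * t.
Proof. by rewrite /form4; coefs_simpl; split; ring. Qed.

Lemma expf0_eq0 (x : algC) n : x ^+ n.+1 = 0 -> x = 0.
Proof. by move=> /eqP; rewrite expf_eq0 => /andP [_ /eqP]. Qed.

Lemma lowest_C3 k1 k2 : k1 * k2 != 1 ->
  lowest_terms 4 ('X^4 + k1 *: 'X : {poly algC}, k2 *: 'X^3 + 1).
Proof.
move=> k; apply/lowest_terms4P; split; [size5_tac | size5_tac |] => s t /nonzero2P n.
apply/nonzero2P; have [-> ->] := C3_formE k1 k2 s t => -[e1 e2].
have [s0|s0] := eqVneq s 0.
  by apply: n; split=> //; apply: (@expf0_eq0 _ 3); rewrite -e2 s0; ring.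
have [t0|t0] := eqVneq t 0.
  by apply: n; split=> //; apply: (@expf0_eq0 _ 3); rewrite -e1 t0; ring.
have E1 : s ^+ 3 = - k1 * t ^+ 3.
  by apply: (mulfI s0); apply/eqP; rewrite -subr_eq0 -[X in _ == X]e1; apply/eqP; ring.
have E2 : (k1 * k2 - 1) * t ^+ 4 = 0.
  by transitivity (- (k2 * (- k1 * t ^+ 3) * t + t ^+ 4)); [ring | rewrite -E1 e2 oppr0].
move/eqP: E2; rewrite mulf_eq0 subr_eq0 (negbTE k) expf_eq0 (negbTE t0) //.
Qed.

(** The rescaling extracts cube roots, but k1 and k2 are plain quotients of coefficients. This is
    why conditions on them can be rewritten as multihomogeneous equations. *)
Lemma C3_norm (p q : {poly algC}) : lowest_terms 4 (p, q) -> p`_0 = 0 -> p`_2 = 0 -> p`_3 = 0 ->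
  q`_1 = 0 -> q`_2 = 0 -> q`_4 = 0 ->
  let k1 := p`_1 / q`_0 in let k2 := q`_3 / p`_4 in
  [/\ p`_4 != 0, q`_0 != 0, k1 * k2 != 1 & mclass (mkRat p q) = mclass (C3map k1 k2)].
Proof.
move=> lt p0 p2 p3 q1 q2 q4 k1 k2.
have p40 : p`_4 != 0 by have := lowest_at_infty lt; rewrite /nonzero2 q4 eqxx orbF.
have q00 : q`_0 != 0 by have := lowest_at_0 lt; rewrite /nonzero2 p0 eqxx.
have k12 : k1 * k2 != 1.
  (* If k1 k2 = 1, a nonzero-leading pair still has the common zero (x : 1), where x^3 = -p_1 / p_4
     makes both forms vanish. *)
  apply/eqP => E; have [x Ex] := root_ex (- p`_1 / p`_4) (isT : 0 < 3)%N.
  have [_ _ /(_ x 1)] := (lowest_terms4P _ _ lt).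
  rewrite {1}/nonzero2 oner_eq0 orbT => /(_ isT) /nonzero2P; apply.
  rewrite /form4 p0 p2 p3 q1 q2 q4; split.
    transitivity (x * (p`_1 + p`_4 * x ^+ 3)); first by ring.
    by rewrite Ex; field.
  transitivity (q`_0 * (1 - k1 * k2)); last by rewrite E subrr mulr0.
  transitivity (q`_0 + q`_3 * x ^+ 3); first by ring.
  by rewrite Ex /k1 /k2; field; rewrite ?p40 ?q00.
split=> //.
have [s0 s00 Es] := root_neq0 (isT : 0 < 3)%N (invr_neq0 p40).
have [t0 t00 Et] := root_neq0 (isT : 0 < 3)%N (invr_neq0 q00).
apply: (mclass_diag s00 t00 lt (lowest_C3 k12)) => s t.
have [-> ->] := C3_formE k1 k2 s t; rewrite /form4 p0 p2 p3 q1 q2 q4; split.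
  transitivity (s0 * ((p`_4 * s0 ^+ 3) * s ^+ 4 + p`_1 * t0 ^+ 3 * s * t ^+ 3)); first by ring.
  by rewrite Es Et divff // mul1r.
transitivity (t0 * ((q`_3 * s0 ^+ 3) * s ^+ 3 * t + (q`_0 * t0 ^+ 3) * t ^+ 4)); first by ring.
by rewrite Es Et divff // mul1r.
Qed.

Lemma lowest_C4 k : k != 0 -> lowest_terms 4 ('X^4 + 1 : {poly algC}, k *: 'X^3).
Proof.
move=> k0; apply/lowest_terms4P; split; [size5_tac | size5_tac |] => s t /nonzero2P n.
apply/nonzero2P; have [-> ->] := C4_formE k s t => -[e1 e2].
have [s0|s0] := eqVneq s 0.
  by apply: n; split=> //; apply: (@expf0_eq0 _ 3); rewrite -e1 s0; ring.
have [t0|t0] := eqVneq t 0.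
  by apply: n; split=> //; apply: (@expf0_eq0 _ 3); rewrite -e1 t0; ring.
by have := mulf_neq0 (mulf_neq0 k0 (expf_neq0 3 s0)) t0; rewrite e2 eqxx.
Qed.

Lemma C4_norm (p q : {poly algC}) : lowest_terms 4 (p, q) -> p`_1 = 0 -> p`_2 = 0 -> p`_3 = 0 ->
  q`_0 = 0 -> q`_1 = 0 -> q`_2 = 0 -> q`_4 = 0 ->
  let k := q`_3 / p`_4 in
  [/\ p`_4 != 0, k != 0 & mclass (mkRat p q) = mclass (C4map k)].
Proof.
move=> lt p1 p2 p3 q0 q1 q2 q4 k.
have p40 : p`_4 != 0 by have := lowest_at_infty lt; rewrite /nonzero2 q4 eqxx orbF.
have p00 : p`_0 != 0 by have := lowest_at_0 lt; rewrite /nonzero2 q0 eqxx orbF.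
have q30 : q`_3 != 0.
  have [_ ] := lowest_terms_neq0 lt; apply: contraNneq => q30.
  apply/eqP/polyP => i; rewrite coef0; have [_ /leq_sizeP sq _] := lowest_terms4P _ _ lt.
  by case: i => [|[|[|[|[|i]]]]] //; apply: sq.
have k0 : k != 0 by rewrite mulf_neq0 ?invr_eq0.
split=> //.
have [s0 s00 Es] := root_neq0 (isT : 0 < 3)%N (invr_neq0 p40).
(* Conjugation by diag(s0, t0) divides p by s0 and q by t0, so the coefficients p_4 and p_0 become 1
   exactly when p_4 s0^3 = 1 and p_0 t0^4 = s0. *)
have [t0 t00 Et] := root_neq0 (isT : 0 < 4)%N (mulf_neq0 s00 (invr_neq0 p00)).
apply: (mclass_diag s00 t00 lt (lowest_C4 k0)) => s t.
have [-> ->] := C4_formE k s t; rewrite /form4 p1 p2 p3 q0 q1 q2 q4; split.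
  transitivity (s0 * (p`_4 * s0 ^+ 3) * s ^+ 4 + p`_0 * t0 ^+ 4 * t ^+ 4); first by ring.
  by rewrite Es Et; field; rewrite ?p40 ?p00.
transitivity (t0 * ((q`_3 * s0 ^+ 3) * s ^+ 3 * t)); first by ring.
by rewrite Es.
Qed.

(** * Closedness of subfamilies *)

Lemma moduli_closedP (B : set (moduli 4)) :
  closed B <-> zariski_closed [set f : Rat 4 | B (mclass f)].
Proof.
have E : zariski_open ([set f : Rat 4 | (~` B) (mclass f)]) <->
    zariski_closed [set f : Rat 4 | B (mclass f)].
  by rewrite /zariski_open; have -> : ~` [set f : Rat 4 | (~` B) (mclass f)] =
    [set f | B (mclass f)] by rewrite -[RHS]setCK.
by rewrite -openC; exact: E.
Qed.

Lemma prim_neq1 n (z : algC) : (1 < n)%N -> n.-primitive_root z -> z != 1.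
Proof.
move=> n1 pz; apply/eqP => z1; have := prim_order_dvd pz 1.
by rewrite z1 expr1 eqxx => /idP; rewrite dvdn1 => /eqP E; rewrite E in n1.
Qed.

Section C3closed.
Variables (I : Type) (m : nat) (c : I -> nat -> nat -> algC).
Hypothesis m_gt0 : (0 < m)%N.

(** c i is the coefficient table of the i-th condition. The common bound m on the degrees in k1 and
    in k2 lets all conditions be cleared of denominators to the same tridegree. *)
Definition bivar_eval i (k1 k2 : algC) :=
  \sum_(j < m.+1) \sum_(l < m.+1) c i j l * k1 ^+ j * k2 ^+ l.

Let sA (x : Rat 4 * (algC * algC) * (algC * algC)) := det2 (sub4v x.1.1 x.1.2 x.2 4) x.2.
Let sB (x : Rat 4 * (algC * algC) * (algC * algC)) := det2 (sub4v x.1.1 x.1.2 x.2 1) x.2.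
Let sC (x : Rat 4 * (algC * algC) * (algC * algC)) := det2 x.1.2 (sub4v x.1.1 x.1.2 x.2 3).
Let sD (x : Rat 4 * (algC * algC) * (algC * algC)) := det2 x.1.2 (sub4v x.1.1 x.1.2 x.2 0).

(* k1 = sB / sD and k2 = sC / sA *)
Let H i x := (\sum_(j < m.+1) \sum_(l < m.+1)
  c i j l * ((sB x ^+ j * sD x ^+ (m - j)) * (sC x ^+ l * sA x ^+ (m - l))))
  * det2 x.1.2 x.2 ^+ (3 * m).

(** The double sum has tridegree m (2, 5, 5). The factor det2 a b ^ (3 m), nonzero on the locus,
    contributes m (0, 3, 3) and makes it the multiple 2 m of (1, 4, 4) required by [rot_closed]. *)
Lemma tri_H i : tri ((1, 4, 4)%N *+ (2 * m)) (H i).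
Proof.
have g3 := tri_graded.
have hA : tri (1, 4, 1)%N sA.
  by have [h1 h2] := tri_sub4_4; apply: tri_det2 h1 h2 tri_b1 tri_b2 _.
have hB : tri (1, 1, 4)%N sB.
  by have [h1 h2] := tri_sub4_1; apply: tri_det2 h1 h2 tri_b1 tri_b2 _.
have hC : tri (1, 4, 1)%N sC.
  by have [h1 h2] := tri_sub4_3; apply: tri_det2 tri_a1 tri_a2 h1 h2 _.
have hD : tri (1, 1, 4)%N sD.
  by have [h1 h2] := tri_sub4_0; apply: tri_det2 tri_a1 tri_a2 h1 h2 _.
have hdet := gradedX g3 (3 * m) tri_detab.
apply: (gradedM_eq (d := (2, 5, 5)%N *+ m) g3 _ hdet); last first.
  by rewrite !mulrnA -mulrnDl.
apply: (graded_sum g3) => j; apply: (graded_sum g3) => l; apply: (gradedZ g3).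
have jm : (j <= m)%N by rewrite -ltnS.
have lm : (l <= m)%N by rewrite -ltnS.
have bd : tri ((1, 1, 4)%N *+ m) (fun x => sB x ^+ j * sD x ^+ (m - j)).
  apply: (gradedM_eq g3 (gradedX g3 j hB) (gradedX g3 (m - j) hD)).
  by rewrite -mulrnDr subnKC.
have ca : tri ((1, 4, 1)%N *+ m) (fun x => sC x ^+ l * sA x ^+ (m - l)).
  apply: (gradedM_eq g3 (gradedX g3 l hC) (gradedX g3 (m - l) hA)).
  by rewrite -mulrnDr subnKC.
by apply: (gradedM_eq g3 bd ca); rewrite -mulrnDl.
Qed.

Lemma H_eval i f a b p q : basis_eq f a b p q -> p`_4 != 0 -> q`_0 != 0 ->
  H i (f, a, b) = det2 a b ^+ (2 * m) * (q`_0 * p`_4) ^+ m * det2 a b ^+ (3 * m) *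
    bivar_eval i (p`_1 / q`_0) (q`_3 / p`_4).
Proof.
move=> h p4 q0; rewrite /H [RHS]mulrAC; congr (_ * _).
rewrite /bivar_eval mulr_sumr; apply: eq_bigr => j _.
rewrite mulr_sumr; apply: eq_bigr => l _.
have jm : (j <= m)%N by rewrite -ltnS.
have lm : (l <= m)%N by rewrite -ltnS.
rewrite /sA /sB /sC /sD /=.
rewrite (proj1 (basis_sub4 h (isT : (1 < 5)%N))) (proj1 (basis_sub4 h (isT : (4 < 5)%N))).
rewrite (proj2 (basis_sub4 h (isT : (0 < 5)%N))) (proj2 (basis_sub4 h (isT : (3 < 5)%N))).
set D := det2 a b.
have E (x y : algC) (e : nat) : (e <= m)%N -> y != 0 ->
    (D * x) ^+ e * (D * y) ^+ (m - e) = D ^+ m * y ^+ m * (x / y) ^+ e.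
  move=> em y0; have S (r : algC) : r ^+ m = r ^+ e * r ^+ (m - e).
    by rewrite -exprD subnKC.
  by rewrite !S !exprMn exprVn; field; rewrite expf_neq0.
rewrite !E // (exprMn m q`_0) mul2n -addnn exprD; by ring.
Qed.

Lemma C3_closed : closed [set x : moduli 4 | exists k1 k2,
  [/\ k1 * k2 != 1, forall i, bivar_eval i k1 k2 = 0 & x = mclass (C3map k1 k2)]].
Proof.
apply/moduli_closedP.
have [z pz] := C_prim_root_exists (isT : (0 < 3)%N).
have z1 := prim_neq1 (isT : (1 < 3)%N) pz.
have z3 : z ^+ 3 = 1 by apply: prim_expr_order.
have m2 : (0 < 2 * m)%N by rewrite muln_gt0.
(* The multiplier 1 selects the exponents congruent to 1 modulo 3 in p and to 0 modulo 3 in q. *)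
have := rot_closed 1 z1 m2 tri_H; congr zariski_closed.
apply/seteqP; split=> f /=.
  move=> [a [b [d eqs eH]]].
  have [p [q [lt h]]] := basis_exists f d.
  have sel := proj1 (rot_basis z 1 d h) eqs.
  have z2 : z ^+ 2 != 1 by rewrite -(prim_order_dvd pz).
  have nz (x y : algC) : x * y = 0 -> y != 0 -> x = 0.
    by move=> /eqP; rewrite mulf_eq0 => /orP [/eqP //|->].
  have z0 : z != 0 by apply: contraNneq z1 => z0; move: z3; rewrite z0 expr0n => /esym/eqP; rewrite eq_sym.
  have zd1 : z - 1 != 0 by rewrite subr_eq0.
  have zd2 : z ^+ 2 - 1 != 0 by rewrite subr_eq0.
  have p0 : p`_0 = 0.
    apply: (nz _ (1 - z)); last by rewrite -opprB oppr_eq0.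
    have [e _] := sel 0%N isT; rewrite mulrBr mulr1 -{1}[p`_0]mulr1 -(expr0 z) e; ring.
  have p2 : p`_2 = 0.
    apply: (nz _ (z * (z - 1))); last by rewrite mulf_neq0.
    have [e _] := sel 2%N isT; rewrite mulrBr mulr1 mulrBr -expr2 e; ring.
  have p3 : p`_3 = 0.
    apply: (nz _ (1 - z)); last by rewrite -opprB oppr_eq0.
    have [e _] := sel 3%N isT; rewrite mulrBr -{1}z3 e; ring.
  have q1 : q`_1 = 0.
    apply: (nz _ (z - 1)) => //.
    have [_ e] := sel 1%N isT; rewrite mulrBr -{1}(expr1 z) e; ring.
  have q2 : q`_2 = 0.
    apply: (nz _ (z ^+ 2 - 1)) => //.
    have [_ e] := sel 2%N isT; rewrite mulrBr e; ring.
  have q4 : q`_4 = 0.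
    apply: (nz _ (z - 1)) => //.
    have [_ e] := sel 4%N isT; rewrite mulrBr; have -> : q`_4 * z = q`_4 * z ^+ 4 by rewrite (exprSr z 3) z3 mul1r.
    by rewrite e; ring.
  have [p40 q00 k12 E] := C3_norm lt p0 p2 p3 q1 q2 q4.
  exists (p`_1 / q`_0), (q`_3 / p`_4); split=> //; last by rewrite -E (basis_mclass d lt h).
  move=> i; have := eH i; rewrite (H_eval i h p40 q00).
  have nz0 : det2 a b ^+ (2 * m) * (q`_0 * p`_4) ^+ m * det2 a b ^+ (3 * m) != 0.
    by rewrite !mulf_neq0 // expf_neq0 // mulf_neq0.
  by move=> e; apply: (mulfI nz0); rewrite e mulr0.
move=> [k1 [k2 [k12 ev E]]].
have [a [b [e [d e0 h]]]] := mclass_basis (lowest_C3 k12) E.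
have cf : [/\ (e *: ('X^4 + k1 *: 'X) : {poly algC})`_4 = e,
    (e *: ('X^4 + k1 *: 'X) : {poly algC})`_1 = e * k1,
    (e *: (k2 *: 'X^3 + 1) : {poly algC})`_0 = e &
    (e *: (k2 *: 'X^3 + 1) : {poly algC})`_3 = e * k2].
  by split; coefs_simpl; ring.
case: cf => c4 c1 c0 c3.
exists a, b; split=> //; last first.
  move=> i; rewrite (H_eval i h) ?c4 ?c0 //.
  have -> : (e *: ('X^4 + k1 *: 'X) : {poly algC})`_1 / e = k1 by rewrite c1; field.
  have -> : (e *: (k2 *: 'X^3 + 1) : {poly algC})`_3 / e = k2 by rewrite c3; field.
  by rewrite ev mulr0.
apply/(rot_basis z 1 d h) => -[|[|[|[|[|i]]]]] // _; coefs_simpl; split; rewrite ?z3; try ring.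
by rewrite exprS z3; ring.
Qed.

End C3closed.

Section C4closed.
Variables u v : algC.

Let sA (x : Rat 4 * (algC * algC) * (algC * algC)) := det2 (sub4v x.1.1 x.1.2 x.2 4) x.2.
Let sC (x : Rat 4 * (algC * algC) * (algC * algC)) := det2 x.1.2 (sub4v x.1.1 x.1.2 x.2 3).

(* k = sC / sA *)
Let H (y : algC * algC) (x : Rat 4 * (algC * algC) * (algC * algC)) :=
  (u * sA x + v * sC x) * det2 y x.2 ^+ 3.

(** The linear combination has tridegree (1, 4, 1), so only the degree in b must grow. A cube of
    det2 y b does this for every fixed vector y, and y = a makes it nonzero on the locus. *)
Let tri_H4 y : tri ((1, 4, 4)%N *+ 1) (H y).
Proof.
have g3 := tri_graded.
have hA : tri (1, 4, 1)%N sA.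
  by have [h1 h2] := tri_sub4_4; apply: tri_det2 h1 h2 tri_b1 tri_b2 _.
have hC : tri (1, 4, 1)%N sC.
  by have [h1 h2] := tri_sub4_3; apply: tri_det2 tri_a1 tri_a2 h1 h2 _.
have hd := tri_det2 (u := fun=> y) (tri_const y.1) (tri_const y.2) tri_b1 tri_b2 erefl.
exact: (gradedM_eq g3 (gradedD g3 (gradedZ g3 u hA) (gradedZ g3 v hC)) (gradedX g3 3 hd)).
Qed.

(** The condition u + v k = 0 serves twice: for u = v = 0 it is void and gives the whole locus, for
    v = 1 it isolates a single class. *)
Lemma C4_closed : closed [set x : moduli 4 | exists k,
  [/\ k != 0, u + v * k = 0 & x = mclass (C4map k)]].
Proof.
apply/moduli_closedP.
have [z pz] := C_prim_root_exists (isT : (0 < 4)%N).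
have z1 := prim_neq1 (isT : (1 < 4)%N) pz.
have z4 : z ^+ 4 = 1 by apply: prim_expr_order.
(* The multiplier z^3 selects the exponents divisible by 4 in p and congruent to 3 modulo 4 in q. *)
have := rot_closed (z ^+ 3) z1 (isT : (0 < 1)%N) tri_H4; congr zariski_closed.
apply/seteqP; split=> f /=.
  move=> [a [b [d eqs eH]]].
  have [p [q [lt h]]] := basis_exists f d.
  have sel := proj1 (rot_basis z (z ^+ 3) d h) eqs.
  have pw i j : (i < 4)%N -> (j < 4)%N -> i != j -> z ^+ i != z ^+ j.
    by move=> hi hj; apply: contraNneq => /eqP; rewrite (eq_prim_root_expr pz) !modn_small.
  have selp i : (i < 4)%N -> i != 0%N -> p`_i = 0.
    move=> i4 i0; have [e _] := sel i (ltnW i4).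
    have : p`_i * (z ^+ i - z ^+ 0) = 0 by rewrite mulrBr e -exprSr z4; ring.
    by move/eqP; rewrite mulf_eq0 subr_eq0 (negbTE (pw i 0%N _ _ _)) // orbF => /eqP.
  have selq i : (i < 4)%N -> i != 3%N -> q`_i = 0.
    move=> i4 i0; have [_ e] := sel i (ltnW i4).
    have : q`_i * (z ^+ i - z ^+ 3) = 0 by rewrite mulrBr e; ring.
    by move/eqP; rewrite mulf_eq0 subr_eq0 (negbTE (pw i 3%N _ _ _)) // orbF => /eqP.
  have q4 : q`_4 = 0.
    have [_ e] := sel 4%N isT.
    have : q`_4 * (z ^+ 4 - z ^+ 3) = 0 by rewrite mulrBr e; ring.
    by rewrite z4 -(expr0 z) => /eqP; rewrite mulf_eq0 subr_eq0 (negbTE (pw 0%N 3%N _ _ _)) // orbF => /eqP.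
  have [p40 k0 E] := C4_norm lt (selp 1%N isT isT) (selp 2%N isT isT) (selp 3%N isT isT)
    (selq 0%N isT isT) (selq 1%N isT isT) (selq 2%N isT isT) q4.
  exists (q`_3 / p`_4); split=> //; last by rewrite -E (basis_mclass d lt h).
  have [y yb] : exists y, det2 y b != 0 by exists a.
  have := eH y; rewrite /H /sA /sC /=.
  rewrite (proj1 (basis_sub4 h (isT : (4 < 5)%N))) (proj2 (basis_sub4 h (isT : (3 < 5)%N))).
  move=> e; have nz0 : det2 a b * p`_4 * det2 y b ^+ 3 != 0.
    by rewrite !mulf_neq0 // expf_neq0.
  by apply: (mulfI nz0); rewrite mulr0 -[RHS]e; field.
move=> [k [k0 ev E]].
have [a [b [e [d e0 h]]]] := mclass_basis (lowest_C4 k0) E.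
exists a, b; split=> //; last first.
  move=> y; rewrite /H /sA /sC /=.
  rewrite (proj1 (basis_sub4 h (isT : (4 < 5)%N))) (proj2 (basis_sub4 h (isT : (3 < 5)%N))).
  coefs_simpl; rewrite [X in X * _](_ : _ = det2 a b * e * (u + v * k)); last by ring.
  by rewrite ev mulr0 mul0r.
by apply/(rot_basis z (z ^+ 3) d h) => -[|[|[|[|[|i]]]]] // _; coefs_simpl; split;
  rewrite -?exprSr ?z4; ring.
Qed.

End C4closed.

(** * Dimension of parametrized sets *)

Section Chains.
Variable X : topologicalType.
Implicit Types A Z : set X.

Lemma irreducible_chain_le A n m :
  (m <= n)%N -> irreducible_chain A n -> irreducible_chain A m.
Proof.
move=> mn [Z [h1 h2]]; exists Z; split=> i hi; first exact/h1/(leq_trans hi mn).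
exact/h2/(leq_trans hi mn).
Qed.

Lemma has_dim_chain A d : irreducible_chain A d -> ~ irreducible_chain A d.+1 -> has_dim A d.
Proof.
move=> h1 h2 n; split=> [hn|nd]; last exact: irreducible_chain_le h1.
by rewrite leqNgt; apply/negP => dn; apply: h2; apply: irreducible_chain_le hn.
Qed.

Lemma irreducible_set1 (x : X) : irreducible [set x].
Proof.
split; first by exists x.
move=> B C _ _ h; case: (h x erefl) => hx; [left|right] => y -> //.
Qed.

Lemma irreducible_finite (K : eqType) (phi : K -> X) (s : seq K) Z :
  irreducible Z -> (forall k, k \in s -> closed [set phi k]) ->
  (forall x, Z x -> exists2 k, k \in s & x = phi k) -> exists x, Z = [set x].
Proof.
move=> [[x0 Zx0] irr]; elim: s => [|k s IH] cl h; first by have [] := h x0 Zx0.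
have cls (t : seq K) : (forall k, k \in t -> closed [set phi k]) ->
    closed [set x | exists2 k, k \in t & x = phi k].
  elim: t => [|j t IHt] clt.
    by rewrite (_ : [set x | _] = set0) ?eqEsubset; [exact: closed0|split=> y // [] ].
  rewrite (_ : [set x | _] = [set phi j] `|` [set x | exists2 k, k \in t & x = phi k]).
    apply: closedU; first by apply: clt; rewrite mem_head.
    by apply: IHt => i it; apply: clt; rewrite inE it orbT.
  apply/seteqP; split=> y.
    by move=> [i]; rewrite inE => /orP [/eqP -> ->|it ->]; [left|right; exists i].
  case=> [->|[i it ->]]; first by exists j; rewrite ?mem_head.
  by exists i; rewrite // inE it orbT.
have cls' : forall i, i \in s -> closed [set phi i].
  by move=> i it; apply: cl; rewrite inE it orbT.
case: (irr [set phi k] [set x | exists2 k, k \in s & x = phi k]).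
- by apply: cl; rewrite mem_head.
- exact: cls.
- move=> y /h [i]; rewrite inE => /orP [/eqP -> ->|it ->]; first by left.
  by right; exists i.
- move=> sub; exists (phi k); apply/seteqP; split=> // y ->.
  by rewrite -(sub x0 Zx0).
- by move=> sub; apply: IH.
Qed.

Lemma not_chain_set1 Z x Z0 : Z = [set x] -> irreducible Z0 -> ~ (Z0 `<` Z).
Proof.
move=> -> [[y Z0y] _] [sub]; apply=> w ->.
by rewrite -(sub y Z0y).
Qed.

End Chains.

Section Parametrization.
Variables (X : topologicalType) (K : Type) (T : idomainType).
Variables (ev : K -> {rmorphism T -> algC}) (phi : K -> X) (d : T).
Hypothesis ev_inj : forall P, (forall k, ev k P = 0) -> P = 0.
Hypothesis d_neq0 : d != 0.

Let U := [set k | ev k d != 0].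

(** Continuity of phi on the open set d != 0, where the closed sets of parameters are the common
    zeros of subsets of T. *)
Definition zariski_continuous := forall B : set X, closed B -> exists I : set T,
  forall k, U k -> (B (phi k) <-> forall P, I P -> ev k P = 0).

Hypothesis phi_cont : zariski_continuous.

Lemma closed_equation (D : set X) : closed D -> ~ (phi @` U `<=` D) ->
  exists2 P, P != 0 & forall k, U k -> D (phi k) -> ev k P = 0.
Proof.
move=> cD nD; have [I IP] := phi_cont cD.
have [k [Uk nDk]] : exists k, U k /\ ~ D (phi k).
  apply: contrapT => /forallNP h; apply: nD => _ [k Uk <-].
  by apply: contrapT => nDk; apply: (h k).
have [P [IP0 Pk]] : exists P, I P /\ ev k P != 0.
  apply: contrapT => /forallNP h; apply: nDk; apply/IP => // P IP0.
  by apply/eqP; apply: contrapT => /negP Pk; apply: (h P).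
exists P; last by move=> k' Uk' /IP; apply.
by apply: contraNneq Pk => ->; rewrite rmorph0.
Qed.

(** If neither B nor C contains the image, they pull back into the zeros of nonzero P and Q. Then P
    Q d vanishes everywhere, which is impossible in a domain. *)
Lemma param_irreducible : irreducible (phi @` U).
Proof.
split.
  have [k Uk] : exists k, U k.
    apply: contrapT => /forallNP h; case/eqP: d_neq0; apply: ev_inj => k.
    by apply/eqP; apply: contrapT => /negP; apply: h.
  by exists (phi k), k.
move=> B C cB cC sub; apply: contrapT => /not_orP [nB nC].
have [P P0 hP] := closed_equation cB nB; have [Q Q0 hQ] := closed_equation cC nC.
have : P * Q * d != 0 by rewrite !mulf_neq0.
case/eqP; apply: ev_inj => k; rewrite !rmorphM /=.
have [->|Uk] := eqVneq (ev k d) 0; first by rewrite mulr0.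
by case: (sub (phi k)) => [|/hP ->|/hQ ->] //; rewrite ?(mulr0, mul0r) //; exists k.
Qed.

End Parametrization.

(** * Polynomials in one and in two parameters *)

Definition ev1 (k : algC) : {rmorphism {poly algC} -> algC} :=
  GRing.RMorphism.clone _ _ (horner_eval k) _.

(** The outer variable is k2, and the coefficients are polynomials in k1. *)
Definition ev2 (k : algC * algC) : {rmorphism {poly {poly algC}} -> algC} :=
  GRing.RMorphism.clone _ _ (horner_eval k.1 \o horner_eval k.2%:P) _.

Lemma ev1E k P : ev1 k P = P.[k]. Proof. by []. Qed.
Lemma ev2E k P : ev2 k P = P.[k.2%:P].[k.1]. Proof. by []. Qed.

Lemma ev1_inj P : (forall k, ev1 k P = 0) -> P = 0.
Proof. exact: poly_fun_eq0. Qed.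

(* the restriction to the line k1 = c *)
Definition slice (c : algC) (P : {poly {poly algC}}) : {poly algC} :=
  map_poly (horner_eval c) P.

Lemma ev2_slice k P : ev2 k P = (slice k.1 P).[k.2].
Proof.
have -> : k.2 = horner_eval k.1 (k.2%:P) by rewrite /horner_eval hornerC.
by rewrite /slice horner_map.
Qed.

Lemma slice_eq0 c P : slice c P = 0 -> exists P', P = ('X - c%:P)%:P * P'.
Proof.
move=> h; exists (\poly_(i < size P) (P`_i %/ ('X - c%:P))).
apply/polyP => i; rewrite coefCM coef_poly; case: ltnP => [_|hi]; last first.
  by rewrite mulr0 nth_default.
rewrite mulrC divpK // dvdp_XsubCl; apply/eqP.
by have := congr1 (fun Q : {poly algC} => Q`_i) h; rewrite coef_map coef0.
Qed.

Lemma ev2_inj P : (forall k, ev2 k P = 0) -> P = 0.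
Proof.
move=> h; apply/polyP => i; rewrite coef0; apply: poly_fun_eq0 => c.
have : slice c P = 0 by apply: poly_fun_eq0 => y; have := h (c, y); rewrite ev2_slice.
by move/(congr1 (fun Q : {poly algC} => Q`_i)); rewrite coef_map coef0.
Qed.

Lemma poly_roots_seq (P : {poly algC}) : P != 0 ->
  exists rs : seq algC, forall x, P.[x] = 0 -> x \in rs.
Proof.
move=> P0; have [rs E] := closed_field_poly_normal P; exists rs => x /eqP.
by rewrite -/(root P x) E rootZ ?lead_coef_eq0 // root_prod_XsubC.
Qed.

Section CurveParam.
Variables (X : topologicalType) (phi : algC -> X) (d : {poly algC}).
Hypothesis d_neq0 : d != 0.
Hypothesis phi_cont : zariski_continuous ev1 phi d.

Let A := phi @` [set k | d.[k] != 0].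

(** In a chain with three members, the middle one lies over the finitely many roots of a nonzero
    polynomial. Being irreducible it is a point, which leaves no room for the smallest member. *)
Lemma curve_param : closed A -> (forall k, d.[k] != 0 -> closed [set phi k]) ->
  (exists k k', [/\ d.[k] != 0, d.[k'] != 0 & phi k <> phi k']) -> irreducible_curve A.
Proof.
move=> cA pts [k0 [k1 [U0 U1 neq]]].
have irA : irreducible A := param_irreducible ev1_inj d_neq0 phi_cont.
split=> //; apply: has_dim_chain.
  exists (fun i => if i == 0%N then [set phi k0] else A); split=> i.
    case: i => [|i] _ /=; split=> //; first exact: irreducible_set1.
      exists [set phi k0]; first exact: pts.
      by apply/seteqP; split=> x //=; [move=> ->; split=> //; exists k0 | case].
    by exists A; rewrite ?setIid.
  case: i => // _ /=; split=> [_ ->|]; first by exists k0.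
  by move=> /(_ (phi k1)) h; apply: neq; apply/esym/h; exists k1.
move=> [Z [hZ sZ]].
have [ir0 _] := hZ 0%N isT; have [ir1 [C1 cC1 E1]] := hZ 1%N isT.
have [s01 s12] := (sZ 0%N isT, sZ 1%N isT).
have [_ [C2 _ E2]] := hZ 2 isT.
have n1 : ~ (phi @` [set k | ev1 k d != 0] `<=` C1).
  move=> sub; case: s12 => _; apply; rewrite E1 E2 => x [Ax _]; split=> //.
  exact: sub.
have [P P0 hP] := closed_equation phi_cont cC1 n1.
have [rs hrs] := poly_roots_seq P0.
have [|x|x E] := irreducible_finite (phi := phi) (s := [seq k <- rs | d.[k] != 0]) ir1.
- by move=> k; rewrite mem_filter => /andP [Uk _]; apply: pts.
- rewrite E1 => -[[k Uk <-] C1k]; exists k => //.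
  by rewrite mem_filter Uk hrs //; apply: hP.
exact: not_chain_set1 E ir0 s01.
Qed.

End CurveParam.

Lemma ev2Z k (c : {poly algC}) P : ev2 k (c *: P) = c.[k.1] * ev2 k P.
Proof. by rewrite !ev2E hornerZ hornerM. Qed.

Lemma ev2C k (c : {poly algC}) : ev2 k c%:P = c.[k.1].
Proof. by rewrite ev2E hornerC. Qed.

Lemma minimal_nat (P : nat -> Prop) : (exists n, P n) ->
  exists n, P n /\ forall m, P m -> (n <= m)%N.
Proof.
case=> n Pn; have ex : exists n, `[< P n >] by exists n; apply/asboolP.
case: (ex_minnP ex) => m /asboolP Pm hm; exists m; split=> // j /asboolP; exact: hm.
Qed.

Lemma root_factor (e : {poly algC}) : e != 0 -> (size e == 1)%N \/
  exists c e', e = ('X - c%:P) * e' /\ (size e' < size e)%N.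
Proof.
move=> e0; have [s1|s1] := boolP (size e == 1)%N; first by left.
right; have [c /factor_theorem [e' E]] := closed_rootP _ s1.
exists c, e'; rewrite mulrC; split=> //.
have e'0 : e' != 0 by apply: contraNneq e0 => z; rewrite E z mul0r.
by rewrite E size_Mmonic ?monicXsubC // size_XsubC addn2.
Qed.

Section SurfaceParam.
Variables (X : topologicalType) (phi : algC * algC -> X) (d : {poly {poly algC}}).
Hypothesis d_neq0 : d != 0.
Hypothesis phi_cont : zariski_continuous ev2 phi d.

Let U := [set k | ev2 k d != 0].
Let A := phi @` U.
Let E (h : {poly {poly algC}}) := [set x | exists k, [/\ U k, ev2 k h = 0 & x = phi k]].

Hypothesis E_closed : forall h, closed (E h).
Hypothesis pt_closed : forall k, U k -> closed [set phi k].

Section Chain3.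
Variables (Z0 Z1 Z2 C1 : set X).
Hypotheses (ir0 : irreducible Z0) (ir1 : irreducible Z1) (ir2 : irreducible Z2).
Hypotheses (s01 : Z0 `<` Z1) (s12 : Z1 `<` Z2) (cC1 : closed C1) (Z1E : Z1 = A `&` C1).

Lemma subE_or h h1 h2 : Z2 `<=` E h ->
  (forall k, ev2 k h = 0 -> ev2 k h1 = 0 \/ ev2 k h2 = 0) ->
  Z2 `<=` E h1 \/ Z2 `<=` E h2.
Proof.
move=> sub hk; case: ir2 => _; apply=> // x /sub [k [Uk k0 ->]].
by case: (hk k k0) => e; [left|right]; exists k.
Qed.

Lemma subE_factor h h1 h2 : Z2 `<=` E h -> h = h1 * h2 ->
  Z2 `<=` E h1 \/ Z2 `<=` E h2.
Proof.
move=> sub eh; apply: subE_or sub _ => k; rewrite eh rmorphM => /eqP.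
by rewrite mulf_eq0 => /orP [] /eqP; [left|right].
Qed.

Lemma Z1_infinite (s : seq (algC * algC)) :
  ~ (forall x, Z1 x -> exists k, [/\ k \in s, U k & x = phi k]).
Proof.
move=> h.
have [|x|x e] := irreducible_finite (phi := phi) (s := [seq k <- s | ev2 k d != 0]) ir1.
- by move=> k; rewrite mem_filter => /andP [Uk _]; apply: pt_closed.
- by move=> /h [k [ks Uk ->]]; exists k => //; rewrite mem_filter Uk.
exact: not_chain_set1 e ir0 s01.
Qed.

(** Otherwise every equation of Z1 would vanish on the whole curve h = 0, and Z2 would be contained
    in Z1. *)
Lemma E_not_sub_Z1 h : Z2 `<=` E h -> exists g, (exists k, ev2 k h = 0 /\ ev2 k g != 0) /\
  forall k, U k -> Z1 (phi k) -> ev2 k g = 0.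
Proof.
move=> sub; have [I IP] := phi_cont cC1.
apply: contrapT => none; case: s12 => _; apply=> x /sub [k [Uk k0 ->]].
rewrite Z1E; split; first by exists k.
apply/IP => // g Ig; apply/eqP; apply: contrapT => /negP gk; apply: none.
exists g; split; first by exists k.
by move=> k' Uk'; rewrite Z1E => -[_ /IP]; apply.
Qed.

(** Minimality in two stages, first of the degree in k2, then of the degree in k1 of the leading
    coefficient, stands in for the choice of an irreducible factor. The second stage serves to split
    off factors that depend on k1 only. *)
Lemma minimal_equation h : h != 0 -> Z2 `<=` E h -> exists h0,
  [/\ h0 != 0, Z2 `<=` E h0,
    forall h', h' != 0 -> Z2 `<=` E h' -> (size h0 <= size h')%N &
    forall h', h' != 0 -> Z2 `<=` E h' -> size h' = size h0 ->
      (size (lead_coef h0) <= size (lead_coef h'))%N].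
Proof.
move=> h0 sub.
have [|n [[h1 [h10 sub1 <-]] min1]] := @minimal_nat (fun n => exists h', [/\ h' != 0, Z2 `<=` E h' & size h' = n]).
  by exists (size h), h.
have [|m [[h2 [h20 sub2 sz <-]] min2]] := @minimal_nat (fun n => exists h',
    [/\ h' != 0, Z2 `<=` E h', size h' = size h1 & size (lead_coef h') = n]).
  by exists (size (lead_coef h1)), h1.
exists h2; split=> // h' h'0 sub'; first by rewrite sz; apply: min1; exists h'.
by rewrite sz => sz'; apply: min2; exists h'.
Qed.

Section Minimal.
Variable h : {poly {poly algC}}.
Hypotheses (h_neq0 : h != 0) (h_sub : Z2 `<=` E h).
Hypothesis h_min : forall h', h' != 0 -> Z2 `<=` E h' -> (size h <= size h')%N.
Hypothesis h_min2 : forall h', h' != 0 -> Z2 `<=` E h' -> size h' = size h ->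
  (size (lead_coef h) <= size (lead_coef h'))%N.

(** By irreducibility Z2 lies over the line k1 = c or over P = 0. In the latter case P would have
    the same degree in k2 as h but a shorter leading coefficient. *)
Lemma sub_line c P : h = ('X - c%:P)%:P * P -> Z2 `<=` E ('X - c%:P)%:P.
Proof.
move=> e; case: (subE_factor h_sub e) => // subP.
have P0 : P != 0 by apply: contraNneq h_neq0 => z; rewrite e z mulr0.
have X0 : ('X - c%:P : {poly algC}) != 0 by rewrite polyXsubC_eq0.
have sz : size P = size h by rewrite e mul_polyC size_scale.
have := h_min2 P0 subP sz; rewrite e lead_coefM lead_coefC.
by rewrite mulrC size_Mmonic ?lead_coef_eq0 ?monicXsubC // size_XsubC addn2 ltnn.
Qed.

Lemma no_line_factor c P : (1 < size h)%N -> h <> ('X - c%:P)%:P * P.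
Proof.
move=> s1 /sub_line /(h_min _); rewrite polyC_eq0 polyXsubC_eq0 size_polyC polyXsubC_eq0.
by move=> /(_ isT); rewrite leqNgt s1.
Qed.

Lemma slice_neq0 c : (1 < size h)%N -> slice c h != 0.
Proof. by move=> s1; apply/eqP => /slice_eq0 [P]; apply: no_line_factor. Qed.

(** An equation in k1 alone puts Z2 over a line k1 = c. An equation of Z1 that is nonzero somewhere
    on this line has finitely many zeros there, so that Z1 would be finite. *)
Lemma size1_false : (size h <= 1)%N -> False.
Proof.
move=> s1; have [r rE] : exists r, h = r%:P by exists h`_0; apply: size1_polyC.
have r0 : r != 0 by move: h_neq0; rewrite rE polyC_eq0.
case: (root_factor r0) => [/size_poly1P [c c0 rc]|[c [r' [re _]]]].
  have [[x Zx] _] := ir2; have [k [_ /eqP e _]] := h_sub Zx.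
  by move: e; rewrite rE rc ev2C hornerC (negbTE c0).
have sub : Z2 `<=` E ('X - c%:P)%:P by apply: (@sub_line c r'%:P); rewrite rE re polyCM.
have [g [[k [k0 gk]] Z1g]] := E_not_sub_Z1 sub.
have k1 : k.1 = c.
  by move/eqP: k0; rewrite ev2C hornerD hornerN hornerX hornerC subr_eq0 => /eqP.
have gc : slice c g != 0.
  by apply: contraNneq gk => z; rewrite ev2_slice k1 z horner0.
have [rs hrs] := poly_roots_seq gc.
apply: (@Z1_infinite [seq (c, y) | y <- rs]) => x Zx.
have [j [Uj j0 xe]] := sub _ (proj1 s12 _ Zx).
have j1 : j.1 = c.
  by move/eqP: j0; rewrite ev2C hornerD hornerN hornerX hornerC subr_eq0 => /eqP.
exists j; split=> //; rewrite [j]surjective_pairing j1 map_f // hrs //.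
by rewrite -j1 -ev2_slice; apply: Z1g => //; rewrite -xe.
Qed.

(** A form of Gauss's lemma: for a root c of e, the right side vanishes on the line k1 = c while h
    does not, so that X - c divides w and can be cancelled. After finitely many cancellations e is a
    constant. *)
Lemma vanish_of_multiple (e : {poly algC}) g w : (1 < size h)%N -> e != 0 ->
  e *: g = w * h -> forall k, ev2 k h = 0 -> ev2 k g = 0.
Proof.
move=> s1; have [n] := ubnP (size e); elim: n e w => // n IH e w; rewrite ltnS => se e0 eq k k0.
case: (root_factor e0) => [/size_poly1P [c c0 ec]|[c [e' [ee se']]]].
  have := congr1 (ev2 k) eq; rewrite ev2Z ec hornerC rmorphM k0 mulr0 => /eqP.
  by rewrite mulf_eq0 (negbTE c0) => /eqP.
have e'0 : e' != 0 by apply: contraNneq e0 => z; rewrite ee z mulr0.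
have sw : slice c w = 0.
  have ec : horner_eval c e = 0 by rewrite /horner_eval ee hornerM hornerXsubC subrr mul0r.
  apply/eqP; have := congr1 (slice c) eq; rewrite /slice rmorphM /= => /esym/eqP.
  rewrite map_polyZ [X in X *: _]ec scale0r mulf_eq0 => /orP [//|].
  by rewrite -/(slice c h) (negbTE (slice_neq0 c s1)).
have [w' we] := slice_eq0 sw.
have X0 : (('X - c%:P)%:P : {poly {poly algC}}) != 0 by rewrite polyC_eq0 polyXsubC_eq0.
apply: (IH e' w') => //; first exact: leq_trans se' se.
by apply: (mulfI X0); rewrite mulrA -we -eq ee mul_polyC scalerA.
Qed.

(** The gcd D is taken over the field of rational functions in k1, so that h = u D up to a factor in
    k1. Z2 lies over u = 0 or over D = 0; minimality of h excludes the former and leaves u free of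
    k2 in the latter. Hence h divides g up to a factor in k1. *)
Lemma common_factor_divides g : (1 < size h)%N -> g != 0 -> (1 < size (gcdp h g))%N ->
  forall k, ev2 k h = 0 -> ev2 k g = 0.
Proof.
move=> s1 g0 sd; set D := gcdp h g in sd.
have D0 : D != 0 by apply: contraTneq sd => ->; rewrite size_poly0.
have [[c1 u] /= c10 hE] := Pdiv.Idomain.dvdpP _ _ (dvdp_gcdl h g).
have [[c2 w] /= c20 gE] := Pdiv.Idomain.dvdpP _ _ (dvdp_gcdr h g).
rewrite -/D in hE gE.
have u0 : u != 0.
  by apply: contraNneq h_neq0 => z; move/eqP: hE; rewrite z mul0r scale_poly_eq0 (negbTE c10).
have szh : size h = (size u + size D).-1 by rewrite -(size_scale h c10) hE size_mul.
have szu : size u = 1%N.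
  have pu : (0 < size u)%N by rewrite size_poly_gt0.
  have uD k : ev2 k h = 0 -> ev2 k u = 0 \/ ev2 k D = 0.
    move=> k0; have := congr1 (ev2 k) hE; rewrite ev2Z k0 mulr0 rmorphM => /esym/eqP.
    by rewrite mulf_eq0 => /orP [] /eqP; [left|right].
  case: (subE_or h_sub uD) => [/(h_min u0)|/(h_min D0)]; rewrite szh.
    rewrite -{2}(addn0 (size u)) -subn1 -addnBA ?leq_add2l; last exact: ltnW.
    by rewrite leqn0 subn_eq0 leqNgt sd.
  rewrite -{2}(add0n (size D)) -(prednK pu) addSn /= leq_add2r leqn0 => /eqP e.
  by rewrite e.
have [u' u'0 ue] := size_poly1P _ (introT eqP szu).
apply: (@vanish_of_multiple (u' * c2) g (c1 *: w) s1); first by rewrite mulf_neq0.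
rewrite -scalerA gE -[RHS]scalerAl [in RHS]scalerAr hE ue mul_polyC.
by rewrite -[RHS]scalerAr.
Qed.

Lemma minimal_false : False.
Proof.
have [s1|s1] := leqP (size h) 1; first exact: size1_false.
have [g [[k [k0 gk]] Z1g]] := E_not_sub_Z1 h_sub.
have g0 : g != 0 by apply: contraNneq gk => ->; rewrite rmorph0.
have sD : (size (gcdp h g) <= 1)%N.
  rewrite leqNgt; apply/negP => /(common_factor_divides s1 g0) /(_ k k0) z.
  by rewrite z eqxx in gk.
(* A polynomial in k1 that vanishes at the first coordinates of all common zeros of h and g: the
   resultant with respect to k2, or g itself if it does not involve k2. *)
have [R R0 hR] : exists2 R : {poly algC}, R != 0 &
    forall j, ev2 j h = 0 -> ev2 j g = 0 -> R.[j.1] = 0.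
  have [sg|sg] := leqP (size g) 1.
    have ge : g = (g`_0)%:P by apply: size1_polyC.
    exists g`_0; first by rewrite -polyC_eq0 -ge.
    by move=> j _; rewrite ge ev2C coefC.
  have [[u v] [_ _] /= e] := resultant_in_ideal s1 sg.
  exists (resultant h g); first by rewrite resultant_eq0 ltnNge sD.
  by move=> j j0 gj; rewrite -ev2C e rmorphD !rmorphM /= j0 gj !mulr0 addr0.
have [rs hrs] := poly_roots_seq R0.
have ys c : exists r : seq algC, forall y, (slice c h).[y] = 0 -> y \in r.
  exact: poly_roots_seq (slice_neq0 c s1).
pose F c := projT1 (cid (ys c)).
have FP c y : (slice c h).[y] = 0 -> y \in F c by rewrite /F; case: cid => r /=; apply.
apply: (@Z1_infinite [seq (c, y) | c <- rs, y <- F c]) => x Zx.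
have [j [Uj j0 xe]] := h_sub (proj1 s12 _ Zx).
exists j; split=> //; apply/allpairsPdep; exists j.1, j.2; split.
- by apply: hrs; apply: hR => //; apply: Z1g => //; rewrite -xe.
- by apply: FP; rewrite -ev2_slice.
- exact: surjective_pairing.
Qed.

End Minimal.
End Chain3.

Lemma surface_param : closed A -> irreducible_chain A 2 -> irreducible_surface A.
Proof.
move=> cA ch2; have irA : irreducible A := param_irreducible ev2_inj d_neq0 phi_cont.
split=> //; apply: has_dim_chain => // -[Z [hZ sZ]].
have [ir0 _] := hZ 0%N isT; have [ir1 [C1 cC1 E1]] := hZ 1%N isT.
have [ir2 [C2 cC2 E2]] := hZ 2 isT; have [_ [C3 _ E3]] := hZ 3 isT.
have [s01 s12 s23] := And3 (sZ 0%N isT) (sZ 1%N isT) (sZ 2 isT).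
have n2 : ~ (phi @` [set k | ev2 k d != 0] `<=` C2).
  move=> sub; case: s23 => _; apply; rewrite E2 E3 => x [Ax _]; split=> //.
  exact: sub.
have [P P0 hP] := closed_equation phi_cont cC2 n2.
have sub : Z 2 `<=` E P.
  by rewrite E2 => _ [[k Uk <-] C2k]; exists k; split=> //; apply: hP.
have [h [h0 hsub hm hm2]] := minimal_equation P0 sub.
exact: (minimal_false ir0 ir1 ir2 s01 s12 cC1 E1 h0 hsub hm hm2).
Qed.

End SurfaceParam.

(** * Continuity of families with polynomial coefficients *)

Lemma coefs_mkRat p q : lowest_terms 4 (p, q) ->
  exists2 e, e != 0 & num (mkRat p q) = e *: p /\ den (mkRat p q) = e *: q.
Proof.
move=> lt; apply: (ratfun_inj (num_den_lowest _) lt).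
have := congr1 (fun f : Rat 4 => f : P1 -> P1) (num_denE (mkRat p q)).
by rewrite (mkRatE (num_den_lowest _)) mkRatE.
Qed.

Lemma meval_homog n e c (v w : 'I_n -> algC) (P : mpoly.mpoly n algC) :
  P \is mpoly.ishomog1 e (@mpoly.mdeg n) -> (forall i, v i = c * w i) ->
  mpoly.meval v P = c ^+ e * mpoly.meval w P.
Proof.
move=> /mpoly.dhomogP hP vw; rewrite !mpoly.mevalE mulr_sumr.
apply: eq_big_seq => m /hP /= <-; rewrite mulrCA; congr (_ * _).
rewrite mpoly.mdegE -prodrXr -big_split /=; apply: eq_bigr => i _.
by rewrite vw exprMn.
Qed.

Section Family.
Variables (K : Type) (T : idomainType) (ev : K -> {rmorphism T -> algC}).
Variables (iota : algC -> T) (d : T) (P Q : K -> {poly algC}) (VP VQ : nat -> T).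
Hypothesis ev_iota : forall k c, ev k (iota c) = c.
Hypothesis PQ_lowest : forall k, ev k d != 0 -> lowest_terms 4 (P k, Q k).
Hypothesis PE : forall k i, (i < 5)%N -> (P k)`_i = ev k (VP i).
Hypothesis QE : forall k i, (i < 5)%N -> (Q k)`_i = ev k (VQ i).

Let V (i : 'I_(5 + 5)) : T := match fintype.split i with inl j => VP j | inr j => VQ j end.

(** The coefficients of the family are substituted into the homogeneous equations of the preimage in
    [Rat 4]. The representative chosen by [coefs] differs from (P k, Q k) by a nonzero scalar
    only. *)
Lemma family_continuous :
  zariski_continuous ev (fun k => mclass (mkRat (P k) (Q k))) d.
Proof.
move=> B /moduli_closedP [J [hJ EJ]].
pose lift (R : mpoly.mpoly (5 + 5) algC) : T :=
  \sum_(m <- mpoly.msupp R) iota (mpoly.mcoeff m R) * \prod_i V i ^+ (m i).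
have liftE k R : ev k (lift R) = mpoly.meval (fun i => ev k (V i)) R.
  rewrite mpoly.mevalE rmorph_sum; apply: eq_bigr => m _.
  rewrite rmorphM ev_iota rmorph_prod; congr (_ * _).
  by apply: eq_bigr => i _; rewrite rmorphXn.
exists (lift @` J) => k Uk.
have [e e0 [En Ed]] := coefs_mkRat (PQ_lowest Uk).
have cE i : coefs (mkRat (P k) (Q k)) i = e * ev k (V i).
  rewrite /V; case: (fintype.split_ordP i) => j ->.
    by rewrite coefs_num En coefZ PE // -[lshift _ _]/(unsplit (inl j)) unsplitK.
  by rewrite coefs_den Ed coefZ QE // -[rshift _ _]/(unsplit (inr j)) unsplitK.
have BE : B (mclass (mkRat (P k) (Q k))) <->
    forall R, J R -> mpoly.meval (coefs (mkRat (P k) (Q k))) R = 0.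
  have := congr1 (fun S : set (Rat 4) => S (mkRat (P k) (Q k))) EJ.
  by rewrite /= => ->.
rewrite BE; split=> [h _ [R JR <-]|h R JR].
  have [e' he'] := hJ _ JR; apply: (mulfI (expf_neq0 e' e0)).
  by rewrite liftE mulr0 -(meval_homog he' cE) h.
have [e' he'] := hJ _ JR; rewrite (meval_homog he' cE) -liftE h ?mulr0 //.
Qed.

End Family.

Lemma conj4_coef (M : 'M[algC]_2) p q p' q' i : conj4 M p q p' q' -> (i < 5)%N ->
  sub4 p (M 0 0) (M 1 0) (M 0 1) (M 1 1) i = M 0 0 * p'`_i + M 0 1 * q'`_i /\
  sub4 q (M 0 0) (M 1 0) (M 0 1) (M 1 1) i = M 1 0 * p'`_i + M 1 1 * q'`_i.
Proof.
move=> h i5.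
have aux (r : {poly algC}) x y : (forall s t, form4 r (M 0 0 * s + M 0 1 * t) (M 1 0 * s + M 1 1 * t) =
    x * form4 p' s t + y * form4 q' s t) ->
    sub4 r (M 0 0) (M 1 0) (M 0 1) (M 1 1) i = x * p'`_i + y * q'`_i.
  move=> hr.
  have /(_ _ i i5) := @form4_eq_coef (\poly_(i < 5) sub4 r (M 0 0) (M 1 0) (M 0 1) (M 1 1) i) (x *: p' + y *: q').
  rewrite coef_poly i5 coefD !coefZ; apply=> s t.
  by rewrite form4_poly form4D !form4Zp -sub4E.
by split; apply: aux => s t; have [] := h s t.
Qed.

(** * The curve of maps with a symmetry of order 4 *)

Lemma C4_continuous : zariski_continuous ev1 (fun k => mclass (C4map k)) 'X.
Proof.
apply: (@family_continuous _ _ ev1 polyC 'X (fun=> 'X^4 + 1) (fun k => k *: 'X^3)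
  (fun i => if i is 4 then 1 else if i is 0 then 1 else 0) (fun i => if i is 3 then 'X else 0)).
- by move=> k c; rewrite ev1E hornerC.
- by move=> k; rewrite ev1E hornerX; apply: lowest_C4.
- by move=> k [|[|[|[|[|i]]]]] // _; coefs_simpl; rewrite ?(add0r, addr0) ev1E hornerC.
- by move=> k [|[|[|[|[|i]]]]] // _; coefs_simpl; rewrite ?(mulr0, mulr1) ev1E ?hornerC ?hornerX.
Qed.

(** Fixed points distinguish the two maps: for k = 1 infinity is the only one, whereas for k = 2
    both infinity and 1 are fixed, and M would send both to infinity. *)
Lemma C4_not_conj : mclass (C4map 1) <> mclass (C4map 2).
Proof.
have n1 : (1 : algC) != 0 by rewrite oner_eq0.
have n2 : (2 : algC) != 0 by rewrite pnatr_eq0.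
move=> /(mclass_conj4 (lowest_C4 n1) (lowest_C4 n2)) [M uM [c c0 h]].
have fix1 x y u v : x ^+ 4 + y ^+ 4 = c * u -> 1 * x ^+ 3 * y = c * v ->
    u * y = v * x -> y = 0.
  move=> e1 e2 e; apply: (@expf0_eq0 _ 4).
  transitivity ((x ^+ 4 + y ^+ 4) * y - (1 * x ^+ 3 * y) * x); first by ring.
  by rewrite e1 e2 -!mulrA e subrr.
have m10 : M 1 0 = 0.
  have [] := h 1 0; rewrite !(form4Zp _ c) !(proj1 (C4_formE 1 _ _)) !(proj2 (C4_formE _ _ _)).
  rewrite !mulr0 !mulr1 !addr0 !expr1n => e1 e2.
  by apply: (fix1 (M 0 0) (M 1 0) (M 0 0) (M 1 0)); rewrite ?e1 ?e2; ring.
have m11 : M 1 0 + M 1 1 = 0.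
  have [] := h 1 1; rewrite !(form4Zp _ c) !(proj1 (C4_formE 1 _ _)) !(proj2 (C4_formE _ _ _)).
  rewrite !mulr1 !expr1n => e1 e2.
  by apply: (fix1 (M 0 0 + M 0 1) _ (2 * (M 0 0 + M 0 1)) (2 * (M 1 0 + M 1 1)));
    rewrite ?e1 ?e2; ring.
move: uM; rewrite unitmx22 m10; move: m11; rewrite m10 add0r => ->.
by rewrite !mulr0 subrr eqxx.
Qed.

Definition C4locus := [set x : moduli 4 | exists2 k, k != 0 & x = mclass (C4map k)].

Lemma C4_curve : irreducible_curve C4locus.
Proof.
have E : C4locus = (fun k => mclass (C4map k)) @` [set k | ('X : {poly algC}).[k] != 0].
  apply/seteqP; split=> x /=.
    by move=> [k k0 ->]; exists k; rewrite //= hornerX.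
  by move=> [k]; rewrite /= hornerX => k0 <-; exists k.
rewrite E; apply: (curve_param _ C4_continuous); first by rewrite polyX_eq0.
- rewrite -E; have := @C4_closed 0 0; congr closed; apply/seteqP; split=> x /=.
    by move=> [k [k0 _ ->]]; exists k.
  by move=> [k k0 ->]; exists k; rewrite mul0r addr0.
- move=> k; rewrite hornerX => k0; have := @C4_closed (- k) 1; congr closed.
  apply/seteqP; split=> x /=.
    by move=> [j [j0 /eqP]]; rewrite mul1r addrC subr_eq0 => /eqP -> ->.
  by move=> ->; exists k; rewrite mul1r addNr.
- exists 1, 2; rewrite !hornerX oner_eq0 pnatr_eq0; split=> //; exact: C4_not_conj.
Qed.

(** * The surface of maps with a symmetry of order 3 *)

Definition Ddisc : {poly {poly algC}} := 1 - 'X%:P * 'X.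

Lemma ev2_Ddisc k : (ev2 k Ddisc != 0) = (k.1 * k.2 != 1).
Proof.
rewrite ev2E /Ddisc hornerD hornerN hornerM !hornerC hornerX hornerD hornerN hornerM.
by rewrite hornerX !hornerC subr_eq0 eq_sym.
Qed.

Lemma Ddisc_neq0 : Ddisc != 0.
Proof.
have : ev2 (0, 0) Ddisc != 0 by rewrite ev2_Ddisc /= mul0r eq_sym oner_eq0.
by apply: contraNneq => ->; rewrite rmorph0.
Qed.

Lemma C3_continuous : zariski_continuous ev2 (fun k => mclass (C3map k.1 k.2)) Ddisc.
Proof.
apply: (@family_continuous _ _ ev2 (fun c => c%:P%:P) _ (fun k => 'X^4 + k.1 *: 'X)
  (fun k => k.2 *: 'X^3 + 1)
  (fun i => if i is 4 then 1 else if i is 1 then 'X%:P else 0)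
  (fun i => if i is 3 then 'X else if i is 0 then 1 else 0)).
- by move=> k c; rewrite ev2C hornerC.
- by move=> k; rewrite ev2_Ddisc; apply: lowest_C3.
- move=> k [|[|[|[|[|i]]]]] // _; coefs_simpl; rewrite ?(mulr0, mulr1, add0r, addr0);
  by rewrite /horner_eval ?hornerX ?hornerC ?hornerX ?hornerC.
- move=> k [|[|[|[|[|i]]]]] // _; coefs_simpl; rewrite ?(mulr0, mulr1, add0r, addr0);
  by rewrite /horner_eval ?hornerX ?hornerC ?hornerX ?hornerC.
Qed.

Lemma C3_closed_eqs (hs : seq {poly {poly algC}}) : closed [set x : moduli 4 |
  exists k, [/\ k.1 * k.2 != 1, forall h, h \in hs -> ev2 k h = 0 & x = mclass (C3map k.1 k.2)]].
Proof.
(* A bound for the degrees in k1 and in k2 of all the equations; the successor keeps it positive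
   when [hs] is empty. *)
pose m := (\sum_(h <- hs) (size h + \max_(l < size h) size (h`_l)%R)).+1%N.
have sz h : h \in hs -> (size h <= m.+1)%N /\ forall l, (size (h`_l)%R <= m.+1)%N.
  move=> hin; have le : (size h + \max_(l < size h) size (h`_l)%R <= m)%N.
    by rewrite /m (big_rem h) //= ltnW // ltnS leq_addr.
  split; first by rewrite ltnW // ltnS (leq_trans _ le) // leq_addr.
  move=> l; case: (ltnP l (size h)) => hl; last by rewrite nth_default // size_poly0.
  rewrite ltnW // ltnS (leq_trans _ le) // (leq_trans _ (leq_addl _ _)) //.
  exact: (leq_bigmax (Ordinal hl)).
have := @C3_closed {h | h \in hs} m (fun h j l => (sval h)`_l`_j) isT.
have evE (h : {h | h \in hs}) k1 k2 : bivar_eval m (fun (h : {h | h \in hs}) j l => (sval h)`_l`_j) h k1 k2 = ev2 (k1, k2) (sval h).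
  case: h => h hin; rewrite ev2E /bivar_eval /=.
  have [s1 s2] := sz h hin.
  rewrite (horner_coef_wide _ s1) horner_sum exchange_big /=; apply: eq_bigr => l _.
  rewrite hornerM -polyC_exp hornerC (horner_coef_wide _ (s2 l)) mulr_suml.
  by apply: eq_bigr => j _.
congr closed; apply/seteqP; split=> x /=.
  move=> [k1 [k2 [k12 hk ->]]]; exists (k1, k2); split=> // h hin.
  by have := hk (exist _ h hin); rewrite evE.
move=> [[k1 k2] [k12 hk ->]]; exists k1, k2; split=> // -[h hin].
by rewrite evE; apply: hk.
Qed.

Definition C3locus := [set x : moduli 4 | exists k, k.1 * k.2 != 1 /\ x = mclass (C3map k.1 k.2)].
Definition D3locus := [set x : moduli 4 | exists k, k ^+ 2 != 1 /\ x = mclass (C3map k k)].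

Lemma C3_closed_pt k : k.1 * k.2 != 1 -> closed [set mclass (C3map k.1 k.2)].
Proof.
move=> k12; have := @C3_closed_eqs [:: ('X - k.1%:P)%:P; 'X - k.2%:P%:P].
congr closed; apply/seteqP; split=> x.
  move=> [j [_ hj ->]].
  have := hj _ (mem_head _ _); rewrite ev2C hornerD hornerN hornerX hornerC => /eqP.
  rewrite subr_eq0 => /eqP ->.
  have := hj ('X - k.2%:P%:P); rewrite !inE eqxx orbT => /(_ isT) /eqP.
  by rewrite ev2E hornerD hornerN hornerX hornerC hornerD hornerN !hornerC subr_eq0 => /eqP ->.
move=> ->; exists k; split=> // h; rewrite !inE => /orP [] /eqP ->.
  by rewrite ev2C hornerD hornerN hornerX hornerC subrr.
by rewrite ev2E hornerD hornerN hornerX hornerC hornerD hornerN !hornerC subrr.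
Qed.

Lemma D3_closed : closed D3locus.
Proof.
have := @C3_closed_eqs [:: 'X%:P - 'X]; congr closed; apply/seteqP; split=> x.
  move=> [k [k12 hk ->]]; have := hk _ (mem_head _ _).
  rewrite ev2E hornerD hornerN hornerX hornerC hornerD hornerN hornerX hornerC => /eqP.
  by rewrite subr_eq0 => /eqP e; exists k.1; move: k12; rewrite -e expr2.
move=> [k [k2 ->]]; exists (k, k); rewrite -expr2; split=> // h; rewrite inE => /eqP ->.
by rewrite ev2E hornerD hornerN hornerX hornerC hornerD hornerN hornerX hornerC subrr.
Qed.

Lemma D3_continuous : zariski_continuous ev1 (fun k => mclass (C3map k k)) (1 - 'X^2).
Proof.
apply: (@family_continuous _ _ ev1 polyC _ (fun k => 'X^4 + k *: 'X) (fun k => k *: 'X^3 + 1)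
  (fun i => if i is 4 then 1 else if i is 1 then 'X else 0)
  (fun i => if i is 3 then 'X else if i is 0 then 1 else 0)).
- by move=> k c; rewrite ev1E hornerC.
- move=> k; rewrite ev1E hornerD hornerN hornerXn hornerC subr_eq0 eq_sym expr2.
  exact: lowest_C3.
- move=> k [|[|[|[|[|i]]]]] // _; coefs_simpl; rewrite ?(mulr0, mulr1, add0r, addr0);
  by rewrite /horner_eval ?hornerX ?hornerC ?hornerX ?hornerC.
- move=> k [|[|[|[|[|i]]]]] // _; coefs_simpl; rewrite ?(mulr0, mulr1, add0r, addr0);
  by rewrite /horner_eval ?hornerX ?hornerC ?hornerX ?hornerC.
Qed.

(* The x^2 y^2 coefficient of a fourth power of a linear form vanishes only for
   multiples of x^4 and y^4. *)
Lemma fourth_power_conj (M : 'M[algC]_2) b k e : M \in unitmx -> e != 0 ->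
  conj4 M ('X^4 + 0 *: 'X) (b *: 'X^3 + 1) (e *: ('X^4 + k *: 'X)) (e *: (k *: 'X^3 + 1)) ->
  k = 0 /\ M 0 0 * M 0 1 = 0.
Proof.
move=> uM e0 h.
have [c2 _] := conj4_coef h (isT : (2 < 5)%N).
have [c3 _] := conj4_coef h (isT : (3 < 5)%N).
have [c1 _] := conj4_coef h (isT : (1 < 5)%N).
move: c1 c2 c3; rewrite /sub4; coefs_simpl.
rewrite !(mulr0, mul0r, add0r, addr0, mulr1, mul1r) => c1 c2 c3.
have m0 : M 0 0 * M 0 1 = 0.
  apply: (@expf0_eq0 _ 1); apply/eqP; move/eqP: c2; rewrite -exprMn mulrn_eq0 /=.
  by [].
split=> //; move/eqP: m0; rewrite mulf_eq0 => /orP [] /eqP z.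
  have m01 : M 0 1 != 0.
    by move: uM; rewrite unitmx22 z mul0r sub0r oppr_eq0 mulf_eq0 negb_or => /andP [].
  move/eqP: c3; rewrite z expr0n /= mulr0 mul0rn eq_sym !mulf_eq0 (negbTE m01) (negbTE e0) /=.
  by move/eqP.
have m00 : M 0 0 != 0.
  by move: uM; rewrite unitmx22 z mul0r subr0 mulf_eq0 negb_or => /andP [].
move/eqP: c1; rewrite z expr0n /= mulr0 mul0rn eq_sym !mulf_eq0 (negbTE m00) (negbTE e0) /=.
by move/eqP.
Qed.

Lemma D3_not_conj : mclass (C3map 0 0) <> mclass (C3map 2 2).
Proof.
have l1 : (0 : algC) * 0 != 1 by rewrite mul0r eq_sym oner_eq0.
have l2 : (2 : algC) * 2 != 1 by rewrite -natrM (eqr_nat _ 4 1).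
move=> /(mclass_conj4 (lowest_C3 l1) (lowest_C3 l2)) [M uM [c c0 h]].
have [/eqP] := fourth_power_conj uM c0 h.
by rewrite pnatr_eq0.
Qed.

(** By [fourth_power_conj] the other map could only be z^4, whose lift has no mixed monomials. The
    three mixed coefficients of the transformed denominator then force both products in the
    determinant of M to vanish. *)
Lemma C3map_not_D3 : ~ D3locus (mclass (C3map 0 1)).
Proof.
have l1 : (0 : algC) * 1 != 1 by rewrite mul0r eq_sym oner_eq0.
move=> [k []]; rewrite expr2 => k2.
move=> /(mclass_conj4 (lowest_C3 l1) (lowest_C3 k2)) [M uM [c c0 h]].
have [k0 m0] := fourth_power_conj uM c0 h; rewrite {k2}k0 in h.
have [_ c1] := conj4_coef h (isT : (1 < 5)%N).
have [_ c2] := conj4_coef h (isT : (2 < 5)%N).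
have [_ c3] := conj4_coef h (isT : (3 < 5)%N).
move: uM c1 c2 c3; rewrite unitmx22 /sub4; coefs_simpl.
rewrite !(mulr0, mul0r, add0r, addr0, mulr1, mul1r).
have sq (x y : algC) n : (0 < n)%N -> x ^+ 2 * y ^+ 2 *+ n = 0 -> x * y = 0.
  move=> n0 /eqP; rewrite mulrn_eq0 -exprMn eqn0Ngt n0 /= => /eqP.
  exact: expf0_eq0.
have cube (x y : algC) : x ^+ 3 * y = 0 -> x * y = 0.
  by move=> /eqP; rewrite mulf_eq0 expf_eq0 /= => /orP [] /eqP ->; rewrite ?mul0r ?mulr0.
set x := M 0 0 in m0 *; set y := M 0 1 in m0 *; set u := M 1 0; set v := M 1 1 => uM c1 c2 c3.
have uv : u * v = 0.
  apply: (sq _ _ 6) => //; rewrite -[RHS]c2.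
  by rewrite -[LHS]addr0 -[X in _ + X = _](mul0r (x * v *+ 3 + y * u *+ 3)) -m0; ring.
have yu : y * u = 0.
  apply: cube; rewrite -[RHS]c1.
  transitivity (y ^+ 3 * u + (u * v) * (v ^+ 2 *+ 4) + (x * y) * (y * v *+ 3)); last by ring.
  by rewrite uv m0 !mul0r !addr0.
have xv : x * v = 0.
  apply: cube; rewrite -[RHS]c3.
  transitivity (x ^+ 3 * v + (u * v) * (u ^+ 2 *+ 4) + (x * y) * (x * u *+ 3)); last by ring.
  by rewrite uv m0 !mul0r !addr0.
by move: uM; rewrite xv yu subrr eqxx.
Qed.

Lemma D3_curve : irreducible_curve D3locus.
Proof.
have dE k : ((1 - 'X^2 : {poly algC}).[k] != 0) = (k ^+ 2 != 1).
  by rewrite hornerD hornerN hornerXn hornerC subr_eq0 eq_sym.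
have E : D3locus = (fun k => mclass (C3map k k)) @` [set k | (1 - 'X^2 : {poly algC}).[k] != 0].
  apply/seteqP; split=> x /=.
    by move=> [k [k0 ->]]; exists k; rewrite /= ?dE.
  by move=> [k]; rewrite /= dE => k0 <-; exists k.
have h0 : (0 : algC) ^+ 2 != 1 by rewrite expr0n eq_sym oner_eq0.
have h2 : (2 : algC) ^+ 2 != 1 by rewrite -natrX (eqr_nat _ 4 1).
rewrite E; apply: (curve_param _ D3_continuous).
- by apply/negP => /eqP e; have := dE 0; rewrite e horner0 eqxx h0.
- by rewrite -E; apply: D3_closed.
- by move=> k; rewrite dE expr2 => k2; exact: (@C3_closed_pt (k, k)).
- by exists 0, 2; rewrite !dE; split=> //; exact: D3_not_conj.
Qed.

Lemma C3_surface : irreducible_surface C3locus.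
Proof.
have E : C3locus = (fun k => mclass (C3map k.1 k.2)) @` [set k | ev2 k Ddisc != 0].
  apply/seteqP; split=> x.
    by move=> [k [k0 ->]]; exists k => //=; rewrite ev2_Ddisc.
  by move=> [k] /=; rewrite ev2_Ddisc => k0 <-; exists k.
have cA : closed C3locus.
  have := @C3_closed_eqs [::]; congr closed; apply/seteqP; split=> x.
    by move=> [k [k12 _ ->]]; exists k.
  by move=> [k [k12 ->]]; exists k.
rewrite E; apply: (surface_param Ddisc_neq0 C3_continuous); rewrite -?E //.
- move=> h; have := @C3_closed_eqs [:: h]; congr closed; apply/seteqP; split=> x.
    move=> [k [k12 hk ->]]; exists k; split=> //=; last exact: (hk _ (mem_head _ _)).
    by rewrite ev2_Ddisc.
  move=> [k [Uk hk ->]]; exists k; split=> //; first by rewrite -ev2_Ddisc.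
  by move=> h'; rewrite inE => /eqP ->.
- by move=> k /=; rewrite ev2_Ddisc; apply: C3_closed_pt.
have DC : D3locus `<=` C3locus.
  by move=> _ [k [k2 ->]]; exists (k, k); rewrite -expr2.
have k00 : (0 : algC) * 0 != 1 by rewrite mul0r eq_sym oner_eq0.
have D0 : D3locus (mclass (C3map 0 0)) by exists 0; rewrite expr2.
have irC : irreducible C3locus.
  by rewrite E; apply: (param_irreducible ev2_inj Ddisc_neq0 C3_continuous).
have [cD irD _] := D3_curve.
(* The chain consists of the class of z^4, the D_3 curve and the whole locus. *)
exists (fun i => if i == 0%N then [set mclass (C3map 0 0)] else if i == 1%N then D3locus else C3locus).
split=> -[|[|[|i]]] //= _.
- split; first exact: irreducible_set1.
  exists [set mclass (C3map 0 0)]; first exact: (@C3_closed_pt (0, 0)).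
  by apply/esym/setIidPr => _ ->; apply: DC.
- split=> //; exists D3locus => //.
  by apply/esym/setIidPr.
- by split=> //; exists C3locus; rewrite ?setIid.
- split=> [_ -> //|sub]; apply: D3_not_conj; apply/esym/sub.
  by exists 2; rewrite -natrX (eqr_nat _ 4 1).
- split=> // sub; apply: C3map_not_D3; apply: sub; exists (0, 1) => /=.
  by rewrite mul0r eq_sym oner_eq0.
Qed.

(** * Finite order elements of PGL_2 *)

(* junk value 1 on singular matrices *)
Definition pgl (M : 'M[algC]_2) : PGL2 :=
  if insub M is Some A then \pi_PGL2 (A : GL2) else 1%g.

Lemma pglE (A : GL2) : pgl (val A) = \pi_PGL2 A.
Proof. by rewrite /pgl valK. Qed.

Lemma pgl_unitE (M : 'M[algC]_2) (u : M \in unitmx) :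
  pgl M = \pi_PGL2 (exist (fun M => M \in unitmx) M u).
Proof. exact: (pglE (exist (fun M => M \in unitmx) M u)). Qed.

Lemma pgl_surj (a : PGL2) : exists2 M : 'M[algC]_2, M \in unitmx & a = pgl M.
Proof. by exists (val (repr a)); [exact: (valP (repr a)) | rewrite pglE reprK]. Qed.

Lemma pglM (M N : 'M[algC]_2) : M \in unitmx -> N \in unitmx ->
  pgl (M *m N) = (pgl M * pgl N)%g.
Proof.
move=> uM uN; have uMN : M *m N \in unitmx by rewrite unitmx_mul uM.
rewrite !pgl_unitE [RHS]PGL2_mulE; congr \pi_PGL2; exact: val_inj.
Qed.

Lemma pgl1 : pgl 1%:M = 1%g.
Proof. exact: (pglE GL2_one). Qed.

Lemma pgl_eq (M N : 'M[algC]_2) : M \in unitmx -> N \in unitmx ->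
  pgl M = pgl N <-> exists2 c, c != 0 & M = c *: N.
Proof. by move=> uM uN; rewrite !pgl_unitE; apply: eq_pgl. Qed.

Lemma pglX (M : 'M[algC]_2) k : M \in unitmx -> pgl (M ^+ k) = (pgl M ^+ k)%g.
Proof.
move=> uM; elim: k => [|k IH]; first by rewrite expr0 expg0 pgl1.
by rewrite exprS expgS -IH -pglM // unitrX.
Qed.

Lemma pgl_act (M : 'M[algC]_2) : M \in unitmx -> pglact (pgl M) = moebius M.
Proof. by move=> uM; rewrite pgl_unitE pglactE. Qed.

Definition dmx (z : algC) : 'M[algC]_2 := basis_mx (z, 0) (0, 1).
Definition swapmx : 'M[algC]_2 := basis_mx (0, 1) (1, 0).

Lemma dmxE z : [/\ dmx z 0 0 = z, dmx z 0 1 = 0, dmx z 1 0 = 0 & dmx z 1 1 = 1].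
Proof. by rewrite !mxE. Qed.

Lemma dmx_unit z : (dmx z \in unitmx) = (z != 0).
Proof. by rewrite basis_mx_unit /det2 /= mul0r subr0 mulr1. Qed.

Lemma swapmx_unit : swapmx \in unitmx.
Proof. by rewrite basis_mx_unit /det2 /= mul0r mul1r sub0r oppr_eq0 oner_eq0. Qed.

Lemma mx2P (A B : 'M[algC]_2) : A 0 0 = B 0 0 -> A 0 1 = B 0 1 -> A 1 0 = B 1 0 ->
  A 1 1 = B 1 1 -> A = B.
Proof.
move=> h00 h01 h10 h11; apply/matrixP => i j.
have aux (k : 'I_2) : k = 0 \/ k = 1.
  by case: k => [[|[|k]] hk] //; [left|right]; apply: val_inj.
by case: (aux i) => ->; case: (aux j) => ->.
Qed.

Lemma dmxM x y : dmx x *m dmx y = dmx (x * y).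
Proof. by apply: mx2P; rewrite !mul22E !mxE /=; ring. Qed.

Lemma dmx1 : dmx 1 = 1%:M.
Proof. by apply: mx2P; rewrite !mxE. Qed.

Lemma dmxX z k : dmx z ^+ k = dmx (z ^+ k).
Proof.
elim: k => [|k IH]; first by rewrite !expr0 dmx1.
by rewrite !exprS IH [LHS]dmxM.
Qed.

Lemma pgl_dmxX_eq1 z k : z != 0 -> (pgl (dmx z) ^+ k = 1)%g <-> z ^+ k = 1.
Proof.
move=> z0; rewrite -pglX ?dmx_unit // dmxX -pgl1 -dmx1 pgl_eq ?dmx_unit ?expf_neq0 ?oner_eq0 //.
split=> [[c c0 /matrixP e]|->]; last by exists 1; rewrite ?oner_eq0 ?scale1r.
have := e 0 0; have := e 1 1; by rewrite !mxE /= mulr1 => <-.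
Qed.

Lemma prim_root_of_order n (z : algC) : (0 < n)%N -> (forall k, z ^+ k = 1 <-> (n %| k)%N) ->
  n.-primitive_root z.
Proof.
move=> n0 h; have zn : z ^+ n = 1 by apply/h.
have [m pm mn] := prim_order_exists n0 zn.
have nm : (n %| m)%N by apply/h; apply: prim_expr_order.
by have /eqP <- : m == n by rewrite eqn_dvd mn nm.
Qed.

(** A is annihilated by X^n - c, which has the n distinct roots l z^i. *)
Lemma diagonalize_finite_order (A : 'M[algC]_2) n c : (0 < n)%N -> c != 0 ->
  A ^+ n = c%:M -> exists2 P : 'M[algC]_2, P \in unitmx & exists D, P *m A = diag_mx D *m P.
Proof.
move=> n0 c0 An; have [z pz] := C_prim_root_exists n0.
have [l l0 ln] := root_neq0 n0 c0.
have hA : exists2 rs, uniq rs & mxminpoly A %| \prod_(x <- rs) ('X - x%:P).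
  exists [seq l * z ^+ i | i <- iota 0 n].
    rewrite map_inj_in_uniq ?iota_uniq // => i j; rewrite !mem_iota !add0n /= => hi hj.
    by move=> /(mulfI l0)/eqP; rewrite (eq_prim_root_expr pz) !modn_small // => /eqP.
  have -> : \prod_(x <- [seq l * z ^+ i | i <- iota 0 n]) ('X - x%:P) = 'X^n - c%:P.
    rewrite big_map; apply/poly_fun_inj => x.
    rewrite horner_prod hornerD hornerN hornerXn hornerC -ln.
    have := congr1 (fun p : {poly algC} => p.[x / l]) (factor_Xn_sub_1 pz).
    rewrite horner_prod hornerD hornerN hornerXn hornerC big_mkord => e.
    have -> : x ^+ n - l ^+ n = l ^+ n * ((x / l) ^+ n - 1).
      by rewrite mulrBr -exprMn mulrCA divff // !mulr1.
    rewrite -e -[X in l ^+ X](card_ord n) -prodr_const -big_split -[n in iota 0 n]subn0.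
    rewrite -[iota _ _]/(index_iota 0 n) big_mkord; apply: eq_bigr => i _ /=.
    by rewrite !hornerXsubC mulrBr mulrCA divff // mulr1.
  apply: mxminpoly_min; rewrite rmorphB /= rmorphXn /= horner_mx_X An horner_mx_C.
  by rewrite subrr.
have [P uP] := proj2 (diagonalizableP A) hA.
case/diagonalizable_forPex => D /(simmxP uP) e; by exists P => //; exists D.
Qed.

Lemma finite_order_conj (a : PGL2) n : (1 < n)%N -> (forall k, (a ^+ k = 1)%g <-> (n %| k)%N) ->
  exists g z, n.-primitive_root z /\ (g^-1 * a * g = pgl (dmx z))%g.
Proof.
move=> n1 ha; have n0 := ltnW n1.
have [A uA aE] := pgl_surj a.
have : (a ^+ n = 1)%g by apply/ha.
rewrite aE -pglX // -pgl1 pgl_eq ?unitmx1 ?unitrX // => -[c c0].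
rewrite scalemx1 => An.
have [P uP [D PA]] := diagonalize_finite_order n0 c0 An.
have uD : diag_mx D \in unitmx.
  have : P *m A \in unitmx by rewrite unitmx_mul uP.
  by rewrite PA unitmx_mul => /andP [].
have [D0 D1] : D 0 0 != 0 /\ D 0 1 != 0.
  by move: uD; rewrite unitmx22 !mxE /= mulr1n mulr0n mul0r subr0 mulf_eq0 negb_or => /andP [].
(* D is a row vector holding the two eigenvalues, of which only the ratio matters in PGL_2. Its
   order is that of a, as conjugation preserves it. *)
pose z := D 0 0 / D 0 1.
have z0 : z != 0 by rewrite mulf_neq0 ?invr_eq0.
have Dz : diag_mx D = D 0 1 *: dmx z.
  by apply: mx2P; rewrite !mxE /= ?mulr1n ?mulr0n ?mulr0 ?mulr1 // mulrCA divff // mulr1.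
have conj_eq : (pgl P * a * (pgl P)^-1 = pgl (dmx z))%g.
  apply: (mulIg (pgl P)); rewrite mulgKV aE -!pglM ?dmx_unit // PA Dz.
  have u1 : dmx z *m P \in unitmx by rewrite unitmx_mul dmx_unit z0.
  rewrite -scalemxAl; apply/pgl_eq => //; last by exists (D 0 1).
  by rewrite unitmxZ // unitfE.
exists (pgl P)^-1%g, z; rewrite invgK; split; last by rewrite -aE.
apply: prim_root_of_order => // k; rewrite -ha -pgl_dmxX_eq1 // -conj_eq.
have -> : ((pgl P * a * (pgl P)^-1) ^+ k = pgl P * a ^+ k * (pgl P)^-1)%g.
  elim: k => [|k IH]; first by rewrite !expg0 mulg1 mulgV.
  by rewrite !expgS IH !mulgA mulgKV.
split=> [e|->]; last by rewrite mulg1 mulgV.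
by apply: (mulgI (pgl P)); apply: (mulIg (pgl P)^-1%g); rewrite e mulg1 mulgV.
Qed.

Lemma AutP1_M f a b : AutP1 f a -> AutP1 f b -> AutP1 f (a * b)%g.
Proof. by move=> ha hb; rewrite /AutP1 /= conjmapM ha. Qed.

Lemma AutP1_X f a k : AutP1 f a -> AutP1 f (a ^+ k)%g.
Proof.
move=> ha; elim: k => [|k IH]; first by rewrite expg0; apply: conjmap1.
by rewrite expgS; apply: AutP1_M.
Qed.

Lemma AutP1_conj f g a : AutP1 f a -> AutP1 (conjmap f g) (g^-1 * a * g)%g.
Proof. by move=> ha; rewrite /AutP1 /= -conjmapM !mulgA mulgV mul1g conjmapM ha. Qed.

Lemma conj_rat (f : Rat 4) (g : PGL2) : exists p q,
  [/\ lowest_terms 4 (p, q), conjmap f g = mkRat p q & mclass f = mclass (mkRat p q)].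
Proof.
have [M uM ->] := pgl_surj g.
have [p [q [lt cj]]] := conj4_exists uM (num_den_lowest f).
have e : conjmap f (pgl M) = mkRat p q.
  apply/conjmapP; rewrite pgl_act // {1}(num_denE f) !mkRatE ?num_den_lowest //.
  exact: conj4_ratfun (num_den_lowest f) lt cj.
by exists p, q; split=> //; apply/mclass_eqP; exists (pgl M).
Qed.

Lemma lowest_scale (p q : {poly algC}) c : c != 0 -> lowest_terms 4 (p, q) ->
  lowest_terms 4 (c *: p, c *: q).
Proof.
move=> c0 /lowest_terms4P [sp sq h]; apply/lowest_terms4P; rewrite !size_scale //.
split=> // x y /h /nonzero2P n; apply/nonzero2P => -[]; rewrite !form4Zp.
move=> /eqP e1 /eqP e2; apply: n.
by move: e1 e2; rewrite !mulf_eq0 (negbTE c0) => /eqP -> /eqP ->.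
Qed.

Lemma ratfun_scale (p q : {poly algC}) c : c != 0 -> lowest_terms 4 (p, q) ->
  ratfun (c *: p) (c *: q) = ratfun p q.
Proof.
move=> c0 lt; apply: funext => z; have [x [y [n ->]]] := hpt_surj z.
by rewrite !ratfun_hpt ?lowest_scale // !form4Zp hptZ.
Qed.

Lemma AutP1_mkRat (p q : {poly algC}) M : M \in unitmx -> lowest_terms 4 (p, q) ->
  AutP1 (mkRat p q) (pgl M) <-> exists2 c, c != 0 & conj4 M p q (c *: p) (c *: q).
Proof.
move=> uM lt; rewrite AutP1P pgl_act // mkRatE //; split=> [|[c c0 h]].
  exact: ratfun_comp_inj.
by rewrite (conj4_ratfun uM lt (lowest_scale c0 lt) h) ratfun_scale.
Qed.

Lemma AutP1_dmx (p q : {poly algC}) z : z != 0 -> lowest_terms 4 (p, q) ->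
  AutP1 (mkRat p q) (pgl (dmx z)) <-> exists2 c, c != 0 &
    forall i, (i < 5)%N -> p`_i * z ^+ i = c * z * p`_i /\ q`_i * z ^+ i = c * q`_i.
Proof.
move=> z0 lt; rewrite AutP1_mkRat ?dmx_unit //.
have scaled (r : {poly algC}) s t : form4 (\poly_(i < 5) (r`_i * z ^+ i)) s t = form4 r (z * s) t.
  by rewrite form4_poly /form4; ring.
have [d00 d01 d10 d11] := dmxE z.
split=> -[c c0 h]; exists c => //.
  move=> i i5; split.
    have /(_ _ i i5) := @form4_eq_coef (\poly_(i < 5) (p`_i * z ^+ i)) ((c * z) *: p).
    rewrite coef_poly i5 coefZ; apply=> s t; rewrite scaled form4Zp.
    have [] := h s t; rewrite d00 d01 d10 d11 !mul0r add0r !addr0 mul1r => -> _.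
    by rewrite form4Zp; ring.
  have /(_ _ i i5) := @form4_eq_coef (\poly_(i < 5) (q`_i * z ^+ i)) (c *: q).
  rewrite coef_poly i5 coefZ; apply=> s t; rewrite scaled form4Zp.
  have [] := h s t; rewrite d00 d01 d10 d11 !mul0r !add0r !addr0 !mul1r => _ ->.
  by rewrite form4Zp.
move=> s t; rewrite d00 d01 d10 d11 !mul0r !add0r !addr0 !mul1r !(form4Zp _ c).
rewrite -!scaled !form4_poly /form4; split.
  by rewrite !(proj1 (h _ _)) //; ring.
by rewrite !(proj2 (h _ _)) //; ring.
Qed.

(** * Copies of cyclic and dihedral groups *)

Section Copies.
Variables (gT : groupType) (Gam : finGroupType) (rho : Gam -> gT).
Hypotheses (rhoM : {morph rho : x y / (x * y)%g}) (rho_inj : injective rho).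

Lemma copy1 : rho 1%g = 1%g.
Proof. by apply: (mulgI (rho 1%g)); rewrite -rhoM !mulg1. Qed.

Lemma copyX x k : rho (x ^+ k)%g = (rho x ^+ k)%g.
Proof. by elim: k => [|k IH]; rewrite ?expg0 ?copy1 // !expgS rhoM IH. Qed.

Lemma copy_order x k : (rho x ^+ k = 1)%g <-> (#[x]%g %| k)%N.
Proof.
rewrite -copyX order_dvdn; split=> [e|/eqP ->]; last exact: copy1.
by apply/eqP/rho_inj; rewrite e copy1.
Qed.

End Copies.

Lemma cyclic_copy (gT : groupType) (S : set gT) n : (1 < n)%N ->
  (forall a k, S a -> S (a ^+ k)%g) ->
  contains_copy S 'Z_n <->
  exists2 a, S a & forall k, (a ^+ k = 1)%g <-> (n %| k)%N.
Proof.
move=> n1 SX; split=> [[rho [rM ri rS]]|[a Sa ha]].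
  exists (rho (Zp1 : 'Z_n)) => [|k]; first by apply: rS; exists (Zp1 : 'Z_n).
  by rewrite copy_order // order_Zp1 Zp_cast.
have an : (a ^+ n = 1)%g by apply/ha.
have amod k : (a ^+ (k %% n) = a ^+ k)%g.
  by rewrite {2}(divn_eq k n) expgD mulnC expgM an expg1n mul1g.
exists (fun i : 'Z_n => (a ^+ i)%g); split.
- have amod' k : (a ^+ (k %% (Zp_trunc n).+2) = a ^+ k)%g by rewrite Zp_cast.
  by move=> i j; rewrite -expgD; apply: amod'.
- move=> i j e; apply: val_inj; wlog ij : i j e / (i <= j)%N.
    by move=> w; case/orP: (leq_total i j) => [|/w ->] //; apply: w.
  have : (a ^+ (j - i) = 1)%g.
    by apply: (mulIg (a ^+ i)%g); rewrite -expgD subnK // mul1g e.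
  move/ha/dvdn_leq; have [/eqP|_ /(_ isT)] := posnP (j - i).
    by rewrite subn_eq0 => ji _; apply/eqP; rewrite eqn_leq ij.
  move=> le; have := leq_trans le (leq_subr i j).
  by rewrite leqNgt (leq_trans (ltn_ord j) (eq_leq (Zp_cast n1))).
- by move=> _ [i _ <-]; apply: SX.
Qed.

(** The presentation only bounds the orders of x and y by q and 2. Since the group has 2q elements
    and is the product of the two cyclic subgroups, both bounds are attained and the intersection is
    trivial. *)
Lemma dihedral_generators q : (1 < q)%N -> exists x y : 'D_(q.*2),
  [/\ #[x]%g = q, (y ^+ 2 = 1)%g, (x ^ y = x^-1)%g, y \notin <[x]>%g &
      forall g : 'D_(q.*2), exists i j, (g = x ^+ i * y ^+ j)%g].
Proof.
move=> q1; have := homg_refl [set: 'D_(q.*2)]; rewrite (Grp_dihedral q1).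
case/existsP=> -[x y] /= /eqP [defG xq y2 xy]; exists x, y.
have ny : <[y]>%g \subset 'N(<[x]>)%g.
  by rewrite cycle_subG; apply/normP; rewrite -cycleJ xy cycleV.
have G2 : (<[x]> * <[y]>)%g = [set: 'D_(q.*2)]%SET by rewrite -norm_joinEr.
have cG := mul_cardG <[x]>%g <[y]>%g; rewrite G2 card_dihedral // in cG.
have ox : (#[x]%g %| q)%N by rewrite order_dvdn; apply/eqP.
have oy : (#[y]%g %| 2)%N by rewrite order_dvdn; apply/eqP.
have lx : (#[x]%g <= q)%N by apply: dvdn_leq => //; apply: ltnW.
have ly : (#[y]%g <= 2)%N by apply: dvdn_leq.
have cI : (0 < #|(<[x]> :&: <[y]>)%g|)%N by apply: cardG_gt0.
have le1 : (#[x]%g * #[y]%g <= q * 2)%N by apply: leq_mul.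
have ge1 : (q * 2 <= #[x]%g * #[y]%g)%N.
  by rewrite -/(order x) -/(order y) in cG *; rewrite cG (leq_trans _ (leq_pmulr _ cI)) // muln2.
have q0 := ltnW q1.
have oxq : #[x]%g = q.
  apply/eqP; rewrite eqn_leq lx -(leq_pmul2r (isT : 0 < 2)%N) (leq_trans ge1) //.
  by rewrite leq_mul2l ly orbT.
split=> //.
- apply/negP => yx; have : (#|(<[x]> :&: <[y]>)%g| = #[y]%g)%N.
    by rewrite (finset.setIidPr _) // cycle_subG.
  move=> e; move: cG; rewrite -/(order x) -/(order y) e oxq => /eqP.
  rewrite eqn_pmul2r ?order_gt0 // => /eqP e2.
  by move/eqP: e2; rewrite -addnn -{1}[q]addn0 eqn_add2l eq_sym eqn0Ngt q0.
- move=> g; have : g \in (<[x]> * <[y]>)%g by rewrite G2 finset.in_setT.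
  by case/mulsgP=> _ _ /cycleP [i ->] /cycleP [j ->] ->; exists i, j.
Qed.

Section DihedralCopy.
Variables (gT : groupType) (q : nat) (a b : gT).
Hypotheses (q_gt1 : (1 < q)%N) (a_order : forall k, (a ^+ k = 1)%g <-> (q %| k)%N).
Hypotheses (b2 : (b ^+ 2 = 1)%g) (ab : (b^-1 * a * b = a^-1)%g).
Hypothesis b_notin : forall k, b <> (a ^+ k)%g.

Lemma exp_mod (hT : groupType) (x : hT) n k : (x ^+ n = 1)%g -> (x ^+ (k %% n) = x ^+ k)%g.
Proof. by move=> xn; rewrite {2}(divn_eq k n) expgD mulnC expgM xn expg1n mul1g. Qed.

Lemma exp_eq_mod i j : (a ^+ i = a ^+ j)%g <-> (i = j %[mod q])%N.
Proof.
have aq : (a ^+ q = 1)%g by apply/a_order.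
split=> [|e]; last by rewrite -(exp_mod i aq) e exp_mod.
rewrite -(exp_mod i aq) -(exp_mod j aq).
have := ltn_pmod i (ltnW q_gt1); have := ltn_pmod j (ltnW q_gt1).
move: (i %% q)%N (j %% q)%N => {i j} i j; wlog ij : i j / (i <= j)%N.
  by move=> w jq iq e; case/orP: (leq_total i j) => h; [|apply/esym]; apply: w.
move=> jq _ e; have : (a ^+ (j - i) = 1)%g.
  by apply: (mulIg (a ^+ i)%g); rewrite -expgD subnK // mul1g e.
move/a_order/dvdn_leq; have [/eqP|_ /(_ isT)] := posnP (j - i).
  by rewrite subn_eq0 => ji _; apply/eqP; rewrite eqn_leq ij.
by move=> le; have := leq_trans le (leq_subr i j); rewrite leqNgt jq.
Qed.

(** Inversion of x is written as the power q - 1, so that all words have natural exponents and the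
    same multiplication rule applies in both groups. *)
Lemma commute_dihedral (hT : groupType) (x y : hT) j k : (x ^+ q = 1)%g ->
  (y^-1 * x * y = x^-1)%g -> (y ^+ j * x ^+ k = x ^+ (k * q.-1 ^ j) * y ^+ j)%g.
Proof.
move=> xq xy.
have xV : (x^-1 = x ^+ q.-1)%g.
  by apply: (mulgI x); rewrite mulgV -expgS prednK // ltnW.
have yx : (y * x = x ^+ q.-1 * y)%g.
  have := congr1 (fun g => (y * g^-1)%g) xy.
  by rewrite invgK !invgM invgK !mulgA mulgV mul1g -xV => <-.
have yxk m : (y * x ^+ m = x ^+ (m * q.-1) * y)%g.
  elim: m => [|m IH]; first by rewrite expg0 mulg1 mul1g.
  by rewrite expgS mulgA yx -mulgA IH mulgA -expgD mulSn.
elim: j k => [|j IH] k; first by rewrite expn0 muln1 expg0 mul1g mulg1.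
by rewrite expgS -mulgA IH mulgA yxk -mulgA -mulnA -expnSr -expgS.
Qed.

Lemma mul_dihedral (hT : groupType) (x y : hT) i j k l : (x ^+ q = 1)%g ->
  (y^-1 * x * y = x^-1)%g ->
  ((x ^+ i * y ^+ j) * (x ^+ k * y ^+ l) = x ^+ (i + k * q.-1 ^ j) * y ^+ (j + l))%g.
Proof.
move=> xq xy; rewrite !expgD -!mulgA; congr (_ * _)%g; rewrite !mulgA; congr (_ * _)%g.
exact: commute_dihedral.
Qed.

Lemma exp2_odd (hT : groupType) (y : hT) j : (y ^+ 2 = 1)%g -> (y ^+ j = y ^+ odd j)%g.
Proof. by move=> y2; rewrite -(exp_mod j y2) modn2. Qed.

(** Whether two words x^i y^j agree depends only on i modulo q and the parity of j, and likewise for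
    a and b. Hence the value on any chosen word is well defined and injective. *)
Lemma dihedral_copy (S : set gT) : S a -> S b ->
  (forall u v, S u -> S v -> S (u * v)%g) -> S 1%g -> contains_copy S 'D_(q.*2).
Proof.
move=> Sa Sb SM S1.
have [x [y [ox y2 xy ynx gen]]] := dihedral_generators q_gt1.
have xq : (x ^+ q = 1)%g by apply/eqP; rewrite -order_dvdn ox.
have aq : (a ^+ q = 1)%g by apply/a_order.
have xy' : (y^-1 * x * y = x^-1)%g by rewrite -xy /conjg mulgA.
have same i j k l : (x ^+ i * y ^+ j = x ^+ k * y ^+ l)%g <-> (a ^+ i * b ^+ j = a ^+ k * b ^+ l)%g.
  rewrite (exp2_odd j y2) (exp2_odd l y2) (exp2_odd j b2) (exp2_odd l b2).
  have xexp : (x ^+ i = x ^+ k)%g <-> (a ^+ i = a ^+ k)%g.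
    rewrite exp_eq_mod; split=> [/eqP|e]; first by rewrite eq_expg_mod_order ox => /eqP.
    by apply/eqP; rewrite eq_expg_mod_order ox e.
  case: (odd j); case: (odd l); rewrite ?expg0 ?expg1 ?mulg1 //.
  - by split=> /mulIg /xexp ->.
  - split=> e.
      case/negP: ynx; have -> : y = (x ^- i * x ^+ k)%g by rewrite -e mulKg.
      by rewrite groupM ?groupV ?mem_cycle.
    case: (@b_notin (i * q.-1 + k)%N); apply: (mulgI (a ^+ i)%g).
    rewrite e -expgD addnA -mulnS prednK ?(ltnW q_gt1) // expgD.
    by rewrite mulnC expgM aq expg1n mul1g.
  - split=> e.
      case/negP: ynx; have -> : y = (x ^- k * x ^+ i)%g by rewrite e mulKg.
      by rewrite groupM ?groupV ?mem_cycle.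
    case: (@b_notin (k * q.-1 + i)%N); apply: (mulgI (a ^+ k)%g).
    rewrite -e -expgD addnA -mulnS prednK ?(ltnW q_gt1) // expgD.
    by rewrite mulnC expgM aq expg1n mul1g.
pose dec (g : 'D_(q.*2)) := cid (gen g).
pose i_ g := projT1 (dec g); pose j_ g := projT1 (cid (projT2 (dec g))).
have ij g : g = (x ^+ i_ g * y ^+ j_ g)%g by rewrite /j_; case: cid.
pose rho g := (a ^+ i_ g * b ^+ j_ g)%g.
have rhoE i j : rho (x ^+ i * y ^+ j)%g = (a ^+ i * b ^+ j)%g.
  by apply/same; rewrite -ij.
exists rho; split.
- by move=> g h; rewrite {1}(ij g) {1}(ij h) (mul_dihedral _ _ _ _ xq xy') rhoE mul_dihedral.
- by move=> g h e; rewrite (ij g) (ij h); apply/same.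
have SX u k : S u -> S (u ^+ k)%g.
  by move=> Su; elim: k => [|k IH]; rewrite ?expg0 // expgS; apply: SM.
by move=> _ [g _ <-]; apply: SM; apply: SX.
Qed.

End DihedralCopy.

(** * Symmetric maps in normal form *)

Lemma prim_neq0 n (z : algC) : (0 < n)%N -> n.-primitive_root z -> z != 0.
Proof.
move=> n0 pz; apply/eqP => z0; have /esym/eqP := prim_expr_order pz.
by rewrite z0 expr0n eqn0Ngt n0 oner_eq0.
Qed.

Lemma prim_pgl_order n (z : algC) k : (0 < n)%N -> n.-primitive_root z ->
  (pgl (dmx z) ^+ k = 1)%g <-> (n %| k)%N.
Proof.
move=> n0 pz; rewrite pgl_dmxX_eq1 ?(prim_neq0 n0 pz) // (prim_order_dvd pz).
by split=> /eqP.
Qed.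

Lemma mkRat_cyclic_copy (p q : {poly algC}) n z c : (1 < n)%N -> n.-primitive_root z -> c != 0 ->
  lowest_terms 4 (p, q) ->
  (forall i, (i < 5)%N -> p`_i * z ^+ i = c * z * p`_i /\ q`_i * z ^+ i = c * q`_i) ->
  contains_copy (AutP1 (mkRat p q)) 'Z_n.
Proof.
move=> n1 pz c0 lt h; apply/(cyclic_copy n1) => [a k|]; first exact: AutP1_X.
exists (pgl (dmx z)); last by move=> k; apply: prim_pgl_order pz; apply: ltnW.
by apply/AutP1_dmx => //; [apply: prim_neq0 pz; apply: ltnW | exists c].
Qed.

Lemma swap_dmx z : dmx z *m swapmx *m dmx z = z *: swapmx.
Proof. by apply: mx2P; rewrite !(mul22E, mxE) /=; ring. Qed.

Lemma swap2 : swapmx *m swapmx = 1%:M.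
Proof. by apply: mx2P; rewrite !mul22E !mxE /=; ring. Qed.

(** The palindromic condition says that z |-> 1 / z is an automorphism; it inverts the rotation. *)
Lemma mkRat_dihedral_copy (p q : {poly algC}) n z c : (1 < n)%N -> n.-primitive_root z -> c != 0 ->
  lowest_terms 4 (p, q) ->
  (forall i, (i < 5)%N -> p`_i * z ^+ i = c * z * p`_i /\ q`_i * z ^+ i = c * q`_i) ->
  (forall i, (i < 5)%N -> p`_(4 - i) = q`_i) ->
  contains_copy (AutP1 (mkRat p q)) 'D_(n.*2).
Proof.
move=> n1 pz c0 lt h sym; have n0 := ltnW n1; have z0 := prim_neq0 n0 pz.
have ud : dmx z \in unitmx by rewrite dmx_unit.
apply: (@dihedral_copy _ n (pgl (dmx z)) (pgl swapmx)) => //.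
- by move=> k; apply: prim_pgl_order.
- by rewrite -pglX ?swapmx_unit // expr2 [swapmx * _]swap2 pgl1.
- apply: (mulgI (pgl swapmx)); rewrite !mulgA mulgV mul1g.
  apply: (mulIg (pgl (dmx z))); rewrite mulgKV.
  rewrite -!pglM ?unitmx_mul ?ud ?swapmx_unit //.
  apply/(pgl_eq _ _); rewrite ?unitmx_mul ?ud ?swapmx_unit //.
  by exists z; rewrite // swap_dmx.
- move=> k; rewrite -pglX // dmxX => /pgl_eq; rewrite swapmx_unit dmx_unit expf_neq0 //.
  case/(_ isT isT) => d _ /matrixP /(_ 0 1); rewrite !mxE /= mulr0 => /eqP.
  by rewrite oner_eq0.
- by apply/AutP1_dmx => //; exists c.
- apply/AutP1_mkRat => //; first exact: swapmx_unit.
  exists 1; first exact: oner_neq0.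
  move=> s t; rewrite !mxE /= !scale1r !mul0r !mul1r !add0r !addr0 /form4.
  rewrite -(sym 0%N) // -(sym 1%N) // -(sym 2) // -(sym 3) // -(sym 4) //=.
  by split; ring.
- by move=> u v; apply: AutP1_M.
- exact: conjmap1.
Qed.

(* The multiplier c of the semi-invariance of (p, q) is a power of zeta, which is
   read off the coefficients at infinity. *)
Lemma selection (p q : {poly algC}) n z : (1 < n)%N -> n.-primitive_root z ->
  lowest_terms 4 (p, q) -> AutP1 (mkRat p q) (pgl (dmx z)) ->
  exists2 e, (e == 3%N) && (p`_4 != 0) || (e == 4%N) && (q`_4 != 0) &
    forall i, (i < 5)%N -> (p`_i != 0 -> (i == e.+1 %[mod n])%N) /\ (q`_i != 0 -> (i == e %[mod n])%N).
Proof.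
move=> n1 pz lt; have z0 := prim_neq0 (ltnW n1) pz.
case/(AutP1_dmx z0 lt) => c c0 h.
have selp i : (i < 5)%N -> p`_i != 0 -> z ^+ i = c * z.
  by move=> i5 pi; apply: (mulfI pi); rewrite (proj1 (h i i5)) mulrC.
have selq i : (i < 5)%N -> q`_i != 0 -> z ^+ i = c.
  by move=> i5 qi; apply: (mulfI qi); rewrite (proj2 (h i i5)) mulrC.
have [e he ce] : exists2 e, (e == 3%N) && (p`_4 != 0) || (e == 4%N) && (q`_4 != 0) & c = z ^+ e.
  have := lowest_at_infty lt; rewrite /nonzero2; have [p40 /= q40|p40 _] := eqVneq p`_4 0.
    by exists 4%N; rewrite ?eqxx ?q40 ?orbT // selq.
  exists 3%N; rewrite ?eqxx ?p40 //; apply: (mulIf z0).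
    by rewrite -exprSr -(selp 4%N).
exists e => // i i5; split=> [/(selp _ i5)|/(selq _ i5)]; rewrite ce -?exprSr => /eqP;
  by rewrite (eq_prim_root_expr pz).
Qed.

Lemma cyclic_normal (f : Rat 4) n : (1 < n)%N -> contains_copy (AutP1 f) 'Z_n ->
  exists p q e, [/\ lowest_terms 4 (p, q), mclass f = mclass (mkRat p q),
    (e == 3%N) && (p`_4 != 0) || (e == 4%N) && (q`_4 != 0) &
    forall i, (i < 5)%N -> (p`_i != 0 -> (i == e.+1 %[mod n])%N) /\ (q`_i != 0 -> (i == e %[mod n])%N)].
Proof.
move=> n1 /(cyclic_copy n1) [|a Sa ha]; first by move=> a k; apply: AutP1_X.
have [g [z [pz ga]]] := finite_order_conj n1 ha.
have [p [q [lt E cl]]] := conj_rat f g.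
have := AutP1_conj g Sa; rewrite ga E => /(selection n1 pz lt) [e he sel].
by exists p, q, e.
Qed.

(** For numerals the congruences of [selection] compute, so that [erefl] certifies that a
    coefficient vanishes. *)
Lemma sel0 (x : algC) (b : bool) : (x != 0 -> b) -> b = false -> x = 0.
Proof. by move=> h b0; apply/eqP; apply: contraT => /h; rewrite b0. Qed.

(** * The loci *)

Lemma C5_norm (f : Rat 4) : contains_copy (AutP1 f) 'Z_5 -> mclass f = mclass (mkRat 1 'X^4).
Proof.
case/(cyclic_normal (isT : (1 < 5)%N)) => p [q [e [lt -> he sel]]].
case/orP: he => /andP [/eqP ee]; rewrite {e}ee in sel => ne.
  have := lowest_at_0 lt; rewrite /nonzero2.
  rewrite (sel0 (proj1 (sel 0%N isT)) erefl) (sel0 (proj2 (sel 0%N isT)) erefl).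
  by rewrite eqxx.
have p1 := sel0 (proj1 (sel 1%N isT)) erefl.
have p2 := sel0 (proj1 (sel 2 isT)) erefl.
have p3 := sel0 (proj1 (sel 3 isT)) erefl.
have p4 := sel0 (proj1 (sel 4 isT)) erefl.
have q0 := sel0 (proj2 (sel 0%N isT)) erefl.
have q1 := sel0 (proj2 (sel 1%N isT)) erefl.
have q2 := sel0 (proj2 (sel 2 isT)) erefl.
have q3 := sel0 (proj2 (sel 3 isT)) erefl.
have p0 : p`_0 != 0 by have := lowest_at_0 lt; rewrite /nonzero2 q0 eqxx orbF.
(* Normalizing both coefficients requires q_4 s0^4 = t0 and p_0 t0^4 = s0, hence p_0 q_4^4 s0^15 =
   1. *)
have [s0 s00 Es] := root_neq0 (isT : 0 < 15)%N (invr_neq0 (mulf_neq0 p0 (expf_neq0 4 ne))).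
have t00 : q`_4 * s0 ^+ 4 != 0 by rewrite mulf_neq0 // expf_neq0.
apply: (mclass_diag s00 t00 lt lowest_terms_inv4) => s t.
rewrite /form4 p1 p2 p3 p4 q0 q1 q2 q3; coefs_simpl; split; last by ring.
transitivity (s0 * ((p`_0 * q`_4 ^+ 4) * s0 ^+ 15) * t ^+ 4); first by ring.
by rewrite Es divff ?mulf_neq0 ?expf_neq0 //; ring.
Qed.

Lemma inv4_sel z : z ^+ 5 = 1 -> forall i, (i < 5)%N ->
  (1 : {poly algC})`_i * z ^+ i = z ^+ 4 * z * (1 : {poly algC})`_i /\
  ('X^4 : {poly algC})`_i * z ^+ i = z ^+ 4 * ('X^4 : {poly algC})`_i.
Proof.
move=> z5 [|[|[|[|[|i]]]]] // _; coefs_simpl; rewrite -?exprSr ?z5; split; ring.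
Qed.

Lemma inv4_D5 : contains_copy (AutP1 (mkRat 1 'X^4)) 'D_10.
Proof.
have [z pz] := C_prim_root_exists (isT : (0 < 5)%N).
have z0 := prim_neq0 (isT : (0 < 5)%N) pz.
apply: (@mkRat_dihedral_copy 1 'X^4 5 z (z ^+ 4)) => //.
- exact: expf_neq0.
- exact: lowest_terms_inv4.
- exact: inv4_sel (prim_expr_order pz).
- by move=> [|[|[|[|[|i]]]]] // _; coefs_simpl.
Qed.

Lemma dihedral_cyclic_copy (gT : groupType) (S : set gT) n : (1 < n)%N ->
  (forall a k, S a -> S (a ^+ k)%g) ->
  contains_copy S 'D_(n.*2) -> contains_copy S 'Z_n.
Proof.
move=> n1 SX [rho [rM ri rS]]; apply/(cyclic_copy n1 SX).
have [x [y [ox _ _ _ _]]] := dihedral_generators n1.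
exists (rho x) => [|k]; first by apply: rS; exists x.
by rewrite copy_order // ox.
Qed.

Lemma D5_locusE : aut_locus 4 'D_10 = [set mclass (mkRat 1 'X^4)].
Proof.
apply/seteqP; split=> x.
  move=> [f /= cf <-]; apply: C5_norm; apply: (@dihedral_cyclic_copy _ _ 5) cf => //.
  by move=> a k; apply: AutP1_X.
by move=> ->; exists (mkRat 1 'X^4); first exact: inv4_D5.
Qed.

Lemma C5_locusE : aut_locus 4 'Z_5 = [set mclass (mkRat 1 'X^4)].
Proof.
apply/seteqP; split=> x; first by move=> [f /= cf <-]; apply: C5_norm.
move=> ->; exists (mkRat 1 'X^4) => //.
apply: (@dihedral_cyclic_copy _ _ 5) inv4_D5 => //.
by move=> a k; apply: AutP1_X.
Qed.

Lemma C4_locusE : aut_locus 4 'Z_4 = C4locus.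
Proof.
apply/seteqP; split=> x.
  move=> [f /= cf <-]; have [p [q [e [lt -> he sel]]]] := cyclic_normal (isT : (1 < 4)%N) cf.
  case/orP: he => /andP [/eqP ee]; rewrite {e}ee in sel => ne.
    have [_ k0 ->] := C4_norm lt (sel0 (proj1 (sel 1%N isT)) erefl)
      (sel0 (proj1 (sel 2 isT)) erefl) (sel0 (proj1 (sel 3 isT)) erefl)
      (sel0 (proj2 (sel 0%N isT)) erefl) (sel0 (proj2 (sel 1%N isT)) erefl)
      (sel0 (proj2 (sel 2 isT)) erefl) (sel0 (proj2 (sel 4 isT)) erefl).
    by exists (q`_3 / p`_4).
  (* Here infinity is not fixed by f and 0 is; z |-> 1 / z reduces to the previous case. *)
  have [p' [q' [lt' -> cs]]] := mclass_swap_ex lt.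
  have p'E i (i5 : (i < 5)%N) := proj1 (cs i i5).
  have q'E i (i5 : (i < 5)%N) := proj2 (cs i i5).
  have [_ k0 ->] := C4_norm lt'
    (etrans (p'E 1%N isT) (sel0 (proj2 (sel 3 isT)) erefl))
    (etrans (p'E 2 isT) (sel0 (proj2 (sel 2 isT)) erefl))
    (etrans (p'E 3 isT) (sel0 (proj2 (sel 1%N isT)) erefl))
    (etrans (q'E 0%N isT) (sel0 (proj1 (sel 4 isT)) erefl))
    (etrans (q'E 1%N isT) (sel0 (proj1 (sel 3 isT)) erefl))
    (etrans (q'E 2 isT) (sel0 (proj1 (sel 2 isT)) erefl))
    (etrans (q'E 4 isT) (sel0 (proj1 (sel 0%N isT)) erefl)).
  by exists (q'`_3 / p'`_4).
move=> [k k0 ->]; exists (C4map k) => //=.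
have [z pz] := C_prim_root_exists (isT : (0 < 4)%N).
have z0 := prim_neq0 (isT : (0 < 4)%N) pz; have z4 := prim_expr_order pz.
apply: (mkRat_cyclic_copy (c := z ^+ 3) _ pz) => //; first exact: expf_neq0.
  exact: lowest_C4.
by move=> [|[|[|[|[|i]]]]] // _; coefs_simpl; rewrite -?exprSr ?z4; split; ring.
Qed.

Lemma C3map_sel z k1 k2 : z ^+ 3 = 1 -> forall i, (i < 5)%N ->
  ('X^4 + k1 *: 'X : {poly algC})`_i * z ^+ i = 1 * z * ('X^4 + k1 *: 'X : {poly algC})`_i /\
  (k2 *: 'X^3 + 1 : {poly algC})`_i * z ^+ i = 1 * (k2 *: 'X^3 + 1 : {poly algC})`_i.
Proof.
move=> z3 [|[|[|[|[|i]]]]] // _; coefs_simpl; rewrite ?(exprSr z 3) ?z3; split; ring.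
Qed.

Lemma C3_normal (p q : {poly algC}) z : 3.-primitive_root z -> lowest_terms 4 (p, q) ->
  AutP1 (mkRat p q) (pgl (dmx z)) ->
  [/\ p`_0 = 0, p`_2 = 0 & p`_3 = 0] /\ [/\ q`_1 = 0, q`_2 = 0 & q`_4 = 0].
Proof.
move=> pz lt /(selection (isT : (1 < 3)%N) pz lt) [e he sel].
case/orP: he => /andP [/eqP ee]; rewrite {e}ee in sel => ne.
  split; split.
  - exact: sel0 (proj1 (sel 0%N isT)) erefl.
  - exact: sel0 (proj1 (sel 2 isT)) erefl.
  - exact: sel0 (proj1 (sel 3 isT)) erefl.
  - exact: sel0 (proj2 (sel 1%N isT)) erefl.
  - exact: sel0 (proj2 (sel 2 isT)) erefl.
  - exact: sel0 (proj2 (sel 4 isT)) erefl.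
(* The exponent e = 4 would allow only z^2 in p and z, z^4 in q, a common zero at 0. *)
have := lowest_at_0 lt; rewrite /nonzero2.
rewrite (sel0 (proj1 (sel 0%N isT)) erefl) (sel0 (proj2 (sel 0%N isT)) erefl).
by rewrite eqxx.
Qed.

Lemma C3_locusE : aut_locus 4 'Z_3 = C3locus.
Proof.
apply/seteqP; split=> x.
  move=> [f /= cf <-].
  have [|a Sa ha] := proj1 (cyclic_copy (S := AutP1 f) (isT : (1 < 3)%N) _) cf.
    by move=> a k; apply: AutP1_X.
  have [g [z [pz ga]]] := finite_order_conj (isT : (1 < 3)%N) ha.
  have [p [q [lt E ->]]] := conj_rat f g.
  have := AutP1_conj g Sa; rewrite ga E => /(C3_normal pz lt) [[p0 p2 p3] [q1 q2 q4]].
  have [_ _ k12 ->] := C3_norm lt p0 p2 p3 q1 q2 q4.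
  by exists (p`_1 / q`_0, q`_3 / p`_4).
move=> [k [k12 ->]]; exists (C3map k.1 k.2) => //=.
have [z pz] := C_prim_root_exists (isT : (0 < 3)%N).
apply: (mkRat_cyclic_copy (c := 1) _ pz) => //; first exact: oner_neq0.
  exact: lowest_C3.
exact: C3map_sel (prim_expr_order pz).
Qed.

(** The relation reads dmx z B dmx z = c B. It multiplies the diagonal entries by z^2 and 1 and the
    others by z. As these three values differ, c = z unless B is diagonal, and an invertible
    diagonal B would need z^2 = 1. *)
Lemma antidiagonal (B : 'M[algC]_2) z : 3.-primitive_root z -> B \in unitmx ->
  (pgl B * pgl (dmx z) = (pgl (dmx z))^-1 * pgl B)%g -> B 0 0 = 0 /\ B 1 1 = 0.
Proof.
move=> pz uB e; have z0 := prim_neq0 (isT : (0 < 3)%N) pz.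
have z1 := prim_neq1 (isT : (1 < 3)%N) pz.
have z2 : z ^+ 2 != 1 by rewrite -(prim_order_dvd pz).
have ud : dmx z \in unitmx by rewrite dmx_unit.
have e' : pgl (dmx z *m B *m dmx z) = pgl B.
  by rewrite !pglM ?unitmx_mul ?ud // -mulgA e mulgA mulgV mul1g.
have [c c0 /matrixP E] : exists2 c, c != 0 & dmx z *m B *m dmx z = c *: B.
  have u3 : dmx z *m B *m dmx z \in unitmx by rewrite !unitmx_mul ud uB.
  exact/(pgl_eq u3 uB).
have [d00 d01 d10 d11] := dmxE z.
have E00 := E 0 0; have E01 := E 0 1; have E10 := E 1 0; have E11 := E 1 1.
rewrite !mul22E ?d00 ?d01 ?d10 ?d11 mxE in E00.
rewrite !mul22E ?d00 ?d01 ?d10 ?d11 mxE in E01.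
rewrite !mul22E ?d00 ?d01 ?d10 ?d11 mxE in E10.
rewrite !mul22E ?d00 ?d01 ?d10 ?d11 mxE in E11.
have nz (x y : algC) : x * y = 0 -> x != 0 -> y = 0.
  by move=> /eqP; rewrite mulf_eq0 => /orP [/eqP ->|/eqP //]; rewrite eqxx.
have h00 : (z ^+ 2 - c) * B 0 0 = 0 by rewrite mulrBl -E00; ring.
have h01 : (z - c) * B 0 1 = 0 by rewrite mulrBl -E01; ring.
have h10 : (z - c) * B 1 0 = 0 by rewrite mulrBl -E10; ring.
have h11 : (1 - c) * B 1 1 = 0 by rewrite mulrBl -E11; ring.
have [zc|zc] := eqVneq z c.
  split; first by apply: (nz _ _ h00); rewrite -zc subr_eq0 expr2 -{3}[z]mulr1 (inj_eq (mulfI z0)).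
  by apply: (nz _ _ h11); rewrite -zc subr_eq0 eq_sym.
have b01 : B 0 1 = 0 by apply: (nz _ _ h01); rewrite subr_eq0.
have [b00 b11] : B 0 0 != 0 /\ B 1 1 != 0.
  by move: uB; rewrite unitmx22 b01 mul0r subr0 mulf_eq0 negb_or => /andP [].
case/eqP: z2.
have c1 : 1 - c = 0 by apply: (nz (B 1 1)) => //; rewrite mulrC.
have c2 : z ^+ 2 - c = 0 by apply: (nz (B 0 0)) => //; rewrite mulrC.
by rewrite -[LHS](subrK c) c2 -c1 subrK.
Qed.

Lemma D3_locusE : aut_locus 4 'D_6 = D3locus.
Proof.
apply/seteqP; split=> x.
  move=> [f /= [rho [rM ri rS]] <-].
  have [u [v [ou v2 uv _ _]]] := dihedral_generators (isT : (1 < 3)%N).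
  have ha k : (rho u ^+ k = 1)%g <-> (3 %| k)%N by rewrite copy_order // ou.
  have Sa : AutP1 f (rho u) by apply: rS; exists u.
  have Sb : AutP1 f (rho v) by apply: rS; exists v.
  have [g [z [pz ga]]] := finite_order_conj (isT : (1 < 3)%N) ha.
  have [p [q [lt E ->]]] := conj_rat f g.
  have := AutP1_conj g Sa; rewrite ga E => /(C3_normal pz lt) [[p0 p2 p3] [q1 q2 q4]].
  have [p40 q00 k12 ->] := C3_norm lt p0 p2 p3 q1 q2 q4.
  have [B uB BE] := pgl_surj (g^-1 * rho v * g)%g.
  have := AutP1_conj g Sb; rewrite BE E => /(AutP1_mkRat uB lt) [c c0 h].
  have vu : (v * u = u^-1 * v)%g.
    have e : (u^-1 ^ v = u)%g by rewrite conjVg uv invgK.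
    by rewrite -{1}e /conjg !mulgA mulgV mul1g.
  have rvu : (rho v * rho u = (rho u)^-1 * rho v)%g.
    by apply: (mulgI (rho u)); rewrite !mulgA mulgV mul1g -!rM -mulgA vu mulgA mulgV mul1g.
  have [b00 b11] : B 0 0 = 0 /\ B 1 1 = 0.
    apply: (antidiagonal pz uB); rewrite -BE -ga !invgM invgK !mulgA !mulgK.
    by rewrite -[(g^-1 * rho v * rho u)%g]mulgA rvu !mulgA.
  have [b01 b10] : B 0 1 != 0 /\ B 1 0 != 0.
    by move: uB; rewrite unitmx22 b00 mul0r sub0r oppr_eq0 mulf_eq0 negb_or => /andP [].
  have [c1 c1'] := conj4_coef h (isT : (1 < 5)%N).
  have [c3 c3'] := conj4_coef h (isT : (3 < 5)%N).
  have [c0a c0'] := conj4_coef h (isT : (0 < 5)%N).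
  have [c4 c4'] := conj4_coef h (isT : (4 < 5)%N).
  rewrite !coefZ b00 b11 /sub4 /form4 p0 p2 p3 q1 q2 q4 in c0a c0' c1 c1' c3 c3' c4 c4'.
  have e1 : p`_4 * B 0 1 ^+ 3 = c * q`_0.
    apply: (mulfI b01); transitivity (0 * (c * 0) + B 0 1 * (c * q`_0)); last by ring.
    by rewrite -c0a; ring.
  have e2 : p`_1 * B 1 0 ^+ 3 = c * q`_3.
    apply: (mulfI b01); transitivity (0 * (c * 0) + B 0 1 * (c * q`_3)); last by ring.
    by rewrite -c3; ring.
  have e3 : q`_0 * B 1 0 ^+ 3 = c * p`_4.
    apply: (mulfI b10); transitivity (B 1 0 * (c * p`_4) + 0 * (c * 0)); last by ring.
    by rewrite -c4'; ring.
  (* The multiplier c of the involution is unknown; this relation expresses c^2 by B, which is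
     enough to cancel it in the comparison of k1 and k2. *)
  have b3 : (B 0 1 * B 1 0) ^+ 3 = c ^+ 2.
    apply: (mulfI (mulf_neq0 p40 q00)).
    transitivity ((p`_4 * B 0 1 ^+ 3) * (q`_0 * B 1 0 ^+ 3)); first by ring.
    by rewrite e1 e3; ring.
  have k12E : p`_1 / q`_0 = q`_3 / p`_4.
    apply: (mulIf (expf_neq0 2 c0)); rewrite -{1}b3.
    transitivity ((p`_4 * B 0 1 ^+ 3) * (p`_1 * B 1 0 ^+ 3) / (p`_4 * q`_0)).
      by field; rewrite ?p40 ?q00.
    by rewrite e1 e2; field; rewrite ?p40 ?q00.
  by move: k12; rewrite -k12E -expr2 => k12; exists (p`_1 / q`_0).
move=> [k [k2 ->]]; exists (C3map k k) => //=.
have [z pz] := C_prim_root_exists (isT : (0 < 3)%N).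
apply: (@mkRat_dihedral_copy _ _ 3 z 1) => //; first exact: oner_neq0.
- by apply: lowest_C3; rewrite -expr2.
- exact: C3map_sel (prim_expr_order pz).
- by move=> [|[|[|[|[|i]]]]] // _; coefs_simpl; ring.
Qed.

(** * Normal form for a symmetry of order 2 *)

Definition C2map (k1 k2 k3 : algC) := mkRat ('X^4 + k1 *: 'X^2 + 1) (k2 *: 'X^3 + k3 *: 'X).

Lemma C2_formE (k1 k2 k3 s t : algC) :
  form4 ('X^4 + k1 *: 'X^2 + 1) s t = s ^+ 4 + k1 * s ^+ 2 * t ^+ 2 + t ^+ 4 /\
  form4 (k2 *: 'X^3 + k3 *: 'X) s t = s * t * (k2 * s ^+ 2 + k3 * t ^+ 2).
Proof. by rewrite /form4; coefs_simpl; split; ring. Qed.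

Lemma size_C2 (k1 k2 k3 : algC) : (size ('X^4 + k1 *: 'X^2 + 1 : {poly algC})%R <= 5)%N /\
  (size (k2 *: 'X^3 + k3 *: 'X : {poly algC})%R <= 5)%N.
Proof. by split; size5_tac. Qed.

(** k2^2 + k3^2 - k1 k2 k3 is the resultant of w^2 + k1 w + 1 and k2 w + k3, where w = z^2. At 0 and
    at infinity the numerator form does not vanish. *)
Lemma lowest_C2 (k1 k2 k3 : algC) :
  lowest_terms 4 ('X^4 + k1 *: 'X^2 + 1 : {poly algC}, k2 *: 'X^3 + k3 *: 'X) =
  (k2 ^+ 2 + k3 ^+ 2 != k1 * k2 * k3).
Proof.
apply/idP/idP => [lt|k].
  have [_ q0] := lowest_terms_neq0 lt; apply: contraNneq q0 => e.
  have [k20|k20] := eqVneq k2 0.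
    have k30 : k3 = 0 by apply: (@expf0_eq0 _ 1); move: e; rewrite k20 => e'; rewrite -[LHS]add0r -[0 in LHS](expr0n _ 2) e'; ring.
    by rewrite k20 k30 !scale0r addr0.
  have [x Ex] := root_ex (- k3 / k2) (isT : (0 < 2)%N).
  have [_ _ /(_ x 1)] := lowest_terms4P _ _ lt.
  rewrite {1}/nonzero2 oner_eq0 orbT => /(_ isT) /nonzero2P; case.
  have [-> ->] := C2_formE k1 k2 k3 x 1; split.
    transitivity ((x ^+ 2) ^+ 2 + k1 * x ^+ 2 + 1); first by ring.
    rewrite Ex; transitivity ((k2 ^+ 2 + k3 ^+ 2 - k1 * k2 * k3) / k2 ^+ 2); first by field.
    by rewrite e subrr mul0r.
  by rewrite Ex; field.
have [sp sq] := size_C2 k1 k2 k3.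
apply/lowest_terms4P; split=> // s t /nonzero2P n.
apply/nonzero2P; have [-> ->] := C2_formE k1 k2 k3 s t => -[e1 e2].
have [s0|s0] := eqVneq s 0.
  by apply: n; split=> //; apply: (@expf0_eq0 _ 3); rewrite -e1 s0; ring.
have [t0|t0] := eqVneq t 0.
  by apply: n; split=> //; apply: (@expf0_eq0 _ 3); rewrite -e1 t0; ring.
have e3 : k2 * s ^+ 2 + k3 * t ^+ 2 = 0.
  by apply: (mulfI (mulf_neq0 s0 t0)); rewrite mulr0.
have : (k2 ^+ 2 + k3 ^+ 2 - k1 * k2 * k3) * t ^+ 4 = 0.
  transitivity (k2 ^+ 2 * (s ^+ 4 + k1 * s ^+ 2 * t ^+ 2 + t ^+ 4) -
    (k2 * s ^+ 2 + k3 * t ^+ 2) * (k2 * s ^+ 2 - k3 * t ^+ 2 + k1 * k2 * t ^+ 2)); first by ring.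
  by rewrite e1 e3 mulr0 mul0r subr0.
move/eqP; rewrite mulf_eq0 subr_eq0 (negbTE k) expf_eq0 (negbTE t0) //.
Qed.

Lemma C2_norm (p q : {poly algC}) : lowest_terms 4 (p, q) -> p`_1 = 0 -> p`_3 = 0 ->
  q`_0 = 0 -> q`_2 = 0 -> q`_4 = 0 ->
  exists k1 k2 k3, k2 ^+ 2 + k3 ^+ 2 != k1 * k2 * k3 /\
    mclass (mkRat p q) = mclass (C2map k1 k2 k3).
Proof.
move=> lt p1 p3 q0 q2 q4.
have p40 : p`_4 != 0 by have := lowest_at_infty lt; rewrite /nonzero2 q4 eqxx orbF.
have p00 : p`_0 != 0 by have := lowest_at_0 lt; rewrite /nonzero2 q0 eqxx orbF.
have [s0 s00 Es] := root_neq0 (isT : 0 < 3)%N (invr_neq0 p40).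
have [t0 t00 Et] := root_neq0 (isT : 0 < 4)%N (mulf_neq0 s00 (invr_neq0 p00)).
pose k1 := p`_2 * s0 * t0 ^+ 2; pose k2 := q`_3 * s0 ^+ 3; pose k3 := q`_1 * s0 * t0 ^+ 2.
have h s t : form4 p (s0 * s) (t0 * t) = s0 * form4 ('X^4 + k1 *: 'X^2 + 1) s t /\
    form4 q (s0 * s) (t0 * t) = t0 * form4 (k2 *: 'X^3 + k3 *: 'X) s t.
  have [-> ->] := C2_formE k1 k2 k3 s t; rewrite /form4 p1 p3 q0 q2 q4; split; last first.
    by rewrite /k2 /k3; ring.
  transitivity (s0 * (p`_4 * s0 ^+ 3) * s ^+ 4 + p`_2 * (s0 * s) ^+ 2 * (t0 * t) ^+ 2 +
    p`_0 * t0 ^+ 4 * t ^+ 4); first by ring.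
  by rewrite Es Et /k1; field; rewrite p40 p00.
have [sp sq] := size_C2 k1 k2 k3.
have lt' := lowest_diag s00 t00 lt sp sq h.
exists k1, k2, k3; split; first by rewrite -lowest_C2.
exact: mclass_diag s00 t00 lt lt' h.
Qed.

Lemma C2_locusE : aut_locus 4 'Z_2 = [set x | exists k1 k2 k3,
  k2 ^+ 2 + k3 ^+ 2 != k1 * k2 * k3 /\ x = mclass (C2map k1 k2 k3)].
Proof.
apply/seteqP; split=> x.
  move=> [f /= cf <-]; have [p [q [e [lt -> he sel]]]] := cyclic_normal (isT : (1 < 2)%N) cf.
  case/orP: he => /andP [/eqP ee]; rewrite {e}ee in sel => ne.
    exact: C2_norm lt (sel0 (proj1 (sel 1%N isT)) erefl) (sel0 (proj1 (sel 3 isT)) erefl)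
      (sel0 (proj2 (sel 0%N isT)) erefl) (sel0 (proj2 (sel 2 isT)) erefl)
      (sel0 (proj2 (sel 4 isT)) erefl).
  have [p' [q' [lt' -> cs]]] := mclass_swap_ex lt.
  have p'E i (i5 : (i < 5)%N) := proj1 (cs i i5).
  have q'E i (i5 : (i < 5)%N) := proj2 (cs i i5).
  exact: C2_norm lt'
    (etrans (p'E 1%N isT) (sel0 (proj2 (sel 3 isT)) erefl))
    (etrans (p'E 3 isT) (sel0 (proj2 (sel 1%N isT)) erefl))
    (etrans (q'E 0%N isT) (sel0 (proj1 (sel 4 isT)) erefl))
    (etrans (q'E 2 isT) (sel0 (proj1 (sel 2 isT)) erefl))
    (etrans (q'E 4 isT) (sel0 (proj1 (sel 0%N isT)) erefl)).
move=> [k1 [k2 [k3 [k ->]]]]; exists (C2map k1 k2 k3) => //=.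
have pz : 2.-primitive_root (-1 : algC).
  have [z pz] := C_prim_root_exists (isT : (0 < 2)%N).
  have z1 := prim_neq1 (isT : (1 < 2)%N) pz.
  have /eqP := prim_expr_order pz; rewrite sqrf_eq1 (negbTE z1) /= => /eqP zE.
  by rewrite -zE.
apply: (mkRat_cyclic_copy (c := -1) _ pz) => //.
- by rewrite oppr_eq0 oner_neq0.
- by rewrite lowest_C2.
by move=> [|[|[|[|[|i]]]]] // _; coefs_simpl; split; ring.
Qed.

Lemma given_by_mkRat (L : set (moduli 4)) (K : Type) (cond : K -> Prop)
  (P Q : K -> {poly algC}) (family : set (P1 -> P1)) :
  (forall k, cond k -> lowest_terms 4 (P k, Q k)) ->
  (forall F, family F <-> exists2 k, cond k & F = ratfun (P k) (Q k)) ->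
  L = [set x | exists2 k, cond k & x = mclass (mkRat (P k) (Q k))] ->
  given_by L family.
Proof.
move=> lt fam ->; split.
  by move=> F /fam [k ck ->]; exists (mkRat (P k) (Q k)); rewrite mkRatE //; apply: lt.
apply/seteqP; split=> x.
  move=> [k ck ->]; exists (mkRat (P k) (Q k)) => //=.
  by apply/fam; exists k; rewrite ?mkRatE //; apply: lt.
move=> [f /= /fam [k ck fE] <-]; exists k => //; congr mclass.
by apply: ratmap_inj; rewrite mkRatE //; apply: lt.
Qed.

Theorem theorem1p5 :
  [/\ aut_locus 4 'Z_5 = aut_locus 4 'D_10 /\
      (exists f : Rat 4, f = ratfun 1 'X^4 :> (P1 -> P1) /\
        aut_locus 4 'Z_5 = [set mclass f]),
      irreducible_curve (aut_locus 4 'Z_4) /\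
      given_by (aut_locus 4 'Z_4)
        [set F | exists k : algC, k != 0 /\
          F = ratfun ('X^4 + 1) (k *: 'X^3)],
      irreducible_curve (aut_locus 4 'D_6) /\
      given_by (aut_locus 4 'D_6)
        [set F | exists k : algC, (k != 1 /\ k != -1) /\
          F = ratfun ('X^4 + k *: 'X) (k *: 'X^3 + 1)],
      irreducible_surface (aut_locus 4 'Z_3) /\
      given_by (aut_locus 4 'Z_3)
        [set F | exists k1 k2 : algC, k1 * k2 != 1 /\
          F = ratfun ('X^4 + k1 *: 'X) (k2 *: 'X^3 + 1)]
    & given_by (aut_locus 4 'Z_2)
        [set F | exists k1 k2 k3 : algC,
          k2 ^+ 2 + k3 ^+ 2 != k1 * k2 * k3 /\
          F = ratfun ('X^4 + k1 *: 'X^2 + 1) (k2 *: 'X^3 + k3 *: 'X)]].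
Proof.
rewrite C5_locusE D5_locusE C4_locusE D3_locusE C3_locusE C2_locusE; split.
- split=> //; exists (mkRat 1 'X^4); split=> //.
  by rewrite mkRatE //; apply: lowest_terms_inv4.
- split; first exact: C4_curve.
  apply: (given_by_mkRat (K := algC) (cond := fun k => k != 0)
    (P := fun=> 'X^4 + 1) (Q := fun k => k *: 'X^3)) => //; first exact: lowest_C4.
  by move=> F; split=> [[k [k0 ->]]|[k k0 ->]]; exists k.
- split; first exact: D3_curve.
  have kE (k : algC) : k ^+ 2 != 1 <-> k != 1 /\ k != -1.
    by rewrite sqrf_eq1 negb_or; split=> [/andP|[-> ->]].
  apply: (given_by_mkRat (K := algC) (cond := fun k => k ^+ 2 != 1)
    (P := fun k => 'X^4 + k *: 'X) (Q := fun k => k *: 'X^3 + 1)).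
  + by move=> k; rewrite expr2; apply: lowest_C3.
  + move=> F; split=> [[k [/kE k2 ->]]|[k /kE k2 ->]]; exists k => //.
  + by apply/seteqP; split=> x [k]; [move=> [k2 ->] | move=> k2 ->]; exists k.
- split; first exact: C3_surface.
  apply: (given_by_mkRat (K := algC * algC) (cond := fun k => k.1 * k.2 != 1)
    (P := fun k => 'X^4 + k.1 *: 'X) (Q := fun k => k.2 *: 'X^3 + 1)).
  + by move=> k; apply: lowest_C3.
  + move=> F; split=> [[k1 [k2 [k ->]]]|[k ck ->]]; first by exists (k1, k2).
    by exists k.1, k.2.
  + by apply/seteqP; split=> x [k]; [move=> [ck ->] | move=> ck ->]; exists k.
- apply: (given_by_mkRat (K := algC * algC * algC)
    (cond := fun k => k.1.2 ^+ 2 + k.2 ^+ 2 != k.1.1 * k.1.2 * k.2)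
    (P := fun k => 'X^4 + k.1.1 *: 'X^2 + 1) (Q := fun k => k.1.2 *: 'X^3 + k.2 *: 'X)).
  + by move=> k; rewrite lowest_C2.
  + move=> F; split=> [[k1 [k2 [k3 [k ->]]]]|[k ck ->]]; first by exists (k1, k2, k3).
    by exists k.1.1, k.1.2, k.2.
  + apply/seteqP; split=> x.
      by move=> [k1 [k2 [k3 [k ->]]]]; exists (k1, k2, k3).
    by move=> [k ck ->]; exists k.1.1, k.1.2, k.2.
Qed.
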